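(* Let $s\in[1/2,1)$ and $p\in[1,2/(2s-1))$ (with $2/(2s-1)=\infty$ when $s=1/2$). There exist a time $T>0$ and a smooth function $\theta_0$ on $\mathbb{R}^2$ with $\|\theta_0\|_{C^2(\mathbb{R}^2)}\le 1$ such that for every modulus of continuity $\rho$ there exists a smooth, divergence-free, time-independent vector field $u:\mathbb{R}^2\to\mathbb{R}^2$ with $\|u\|_{L^p(\mathbb{R}^2)}\le 1$ such that the smooth solution $\theta$ of $$\partial_t\theta+u\cdot\nabla\theta+(-\Delta)^s\theta=0,\qquad \theta(0,\cdot)=\theta_0,$$ breaks the modulus $\rho$ at some time $t\le T$.
   Context: A modulus of continuity is a continuous non-decreasing function $\rho:[0,\infty)\to[0,\infty)$ with $\rho(0)=0$. A function $\theta:(t_0,t_1)\times\mathbb{R}^2\to\mathbb{R}$ breaks $\rho$ at time $t$ if there exist $x,y\in\mathbb{R}^2$ with $|\theta(t,x)-\theta(t,y)|>\rho(|x-y|)$. $(-\Delta)^s$ denotes the fractional Laplacian on $\mathbb{R}^2$. *)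

(* Defs.v *)
From HB Require Import structures.
From mathcomp Require Import all_boot all_order all_algebra.
From mathcomp Require Import all_classical all_reals all_analysis.
Set Implicit Arguments. Unset Strict Implicit. Unset Printing Implicit Defensive.
Import Order.TTheory GRing.Theory Num.Theory.
Import numFieldNormedType.Exports.
Local Open Scope classical_set_scope.
Local Open Scope ring_scope.

Section Defs.
Variable R : realType.

(** Euclidean norm on R^2 = R * R (the library norm on a product is the
    max-norm, so we use the Euclidean one explicitly). *)
Definition enorm2 (x : R * R) : R := Num.sqrt (x.1 ^+ 2 + x.2 ^+ 2).

Definition leb2 := ((@lebesgue_measure R) \x (@lebesgue_measure R))%E.

Definition pd {V : normedModType R} (v : V) (f : V -> R) : V -> R :=
  fun x => derive1 (fun h : R => f (x + h *: v)) 0.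

Definition iter_pd {V : normedModType R} {n : nat} (e : 'I_n -> V)
  (w : seq 'I_n) (f : V -> R) : V -> R :=
  foldr (fun i g => pd (e i) g) f w.

Definition smooth_on {V : normedModType R} {n : nat} (e : 'I_n -> V)
  (A : set V) (f : V -> R) : Prop :=
  forall (w : seq 'I_n) (x : V), A x ->
    {for x, continuous (iter_pd e w f)} /\
    forall i : 'I_n, derivable (fun h : R => iter_pd e w f (x + h *: e i)) 0 1.

Definition e2 (i : 'I_2) : R * R := if val i == 0%N then (1, 0) else (0, 1).
Definition e3 (i : 'I_3) : R * (R * R) :=
  if val i == 0%N then (1, (0, 0)) else if val i == 1%N then (0, (1, 0))
  else (0, (0, 1)).

Definition smooth2 (f : R * R -> R) := smooth_on e2 setT f.

Definition dx1 (f : R * R -> R) := pd (e2 ord0) f.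
Definition dx2 (f : R * R -> R) := pd (e2 (lift ord0 ord0)) f.

Definition supnorm (f : R * R -> R) : \bar R :=
  ereal_sup [set (`|f x|)%:E | x in [set: R * R]].
Definition C2norm (f : R * R -> R) : \bar R :=
  (supnorm f + supnorm (dx1 f) + supnorm (dx2 f)
   + supnorm (dx1 (dx1 f)) + supnorm (dx1 (dx2 f)) + supnorm (dx2 (dx2 f)))%E.

Definition Lp_norm_vf (p : R) (u : R * R -> R * R) : \bar R :=
  Lnorm leb2 p%:E (fun x => (enorm2 (u x))%:E).

Definition smooth_vf (u : R * R -> R * R) :=
  smooth2 (fun x => (u x).1) /\ smooth2 (fun x => (u x).2).
Definition div_free (u : R * R -> R * R) :=
  forall x, dx1 (fun y => (u y).1) x + dx2 (fun y => (u y).2) x = 0.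

Definition Gamma (z : R) : R :=
  Rintegral (@lebesgue_measure R) `]0, +oo[%classic
    (fun t => t `^ (z - 1) * expR (- t)).

(** Normalising constant of (-Delta)^s in dimension 2:
    C(2,s) = 4^s Gamma(1+s) / (pi |Gamma(-s)|) = s 4^s Gamma(1+s)/(pi Gamma(1-s)). *)
Definition cfrac (s : R) : R :=
  s * 4 `^ s * Gamma (1 + s) / (pi * Gamma (1 - s)).

Definition fraclap_at (s : R) (f : R * R -> R) (x : R * R) (L : R) : Prop :=
  let g := fun y => (f x - f y) / (enorm2 (x - y)) `^ (2 + 2 * s) in
  let D := fun eps : R => [set y | eps < enorm2 (x - y)] in
  (forall eps : R, 0 < eps -> leb2.-integrable (D eps) (fun y => (g y)%:E)) /\
  (fun eps : R => cfrac s * Rintegral leb2 (D eps) g) @ 0^'+ --> L.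

Definition is_smooth_solution (s : R) (u : R * R -> R * R)
  (theta0 : R * R -> R) (theta : R -> R * R -> R) : Prop :=
  let Th := fun q : R * (R * R) => theta q.1 q.2 in
  smooth_on e3 [set q | 0 < q.1] Th /\
  {within [set q : R * (R * R) | 0 <= q.1], continuous Th} /\
  theta 0 = theta0 /\
  (exists M : R, forall t x, 0 <= t -> `|theta t x| <= M) /\
  (forall (t : R) (x : R * R), 0 < t ->
     exists L : R, fraclap_at s (theta t) x L /\
       derive1 (fun tau => theta tau x) t
       + ((u x).1 * dx1 (theta t) x + (u x).2 * dx2 (theta t) x) + L = 0).

Definition modulus (rho : R -> R) : Prop :=
  {within `[0, +oo[%classic, continuous rho} /\
  {in `[0, +oo[ &, {homo rho : a b / a <= b}} /\
  (forall a, 0 <= a -> 0 <= rho a) /\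
  rho 0 = 0.

Definition breaks (rho : R -> R) (theta : R -> R * R -> R) (t : R) : Prop :=
  exists x y : R * R, rho (enorm2 (x - y)) < `|theta t x - theta t y|.

End Defs.

(* Main.v *)
(** A time-independent flow with stream function x1 x2 F(|x|^2), where F(r) is a small multiple of
    (r + eps^2)^(-b) (1 + r)^(-2) and 2s - 1 < 2b - 1 < min(1, 2/p), has L^p norm at most 1 uniformly in
    eps, and it carries the points (0, h0) and (0, -h0) to distance eps from the origin before a time
    independent of eps. A smooth datum, odd in x2, is close to its maximum near (0, h0) and to its minimum
    near (0, -h0). Comparison with a paraboloid cap of radius proportional to h travelling with
    (0, h) shows that the solution keeps most of this amplitude: the fractional Laplacian costs
    h^(-2s) per unit time, the cap moves at speed about h^(1 - 2b), and h^(2b - 1 - 2s) is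
    integrable at 0. So the values at (0, eps) and (0, -eps) end up a fixed amount apart, and a
    small eps defeats any given modulus.

    Smooth solutions are limits of a splitting scheme alternating explicit Euler steps for the
    truncated fractional Laplacian (convex averages of translates) with transport along the drift.
    Every step is bounded on functions with k bounded derivatives and consistent with the generator up to
    a power of the time step, which gives convergence in all C^k and smoothness in time. *)
Require Import Defs.
From HB Require Import structures.
From mathcomp Require Import all_boot all_order all_algebra.
From mathcomp Require Import all_classical all_reals all_analysis.
From mathcomp Require Import measurable_realfun ring lra.
Import Order.TTheory GRing.Theory Num.Theory.
Import numFieldNormedType.Exports.
Local Open Scope classical_set_scope.
Local Open Scope ring_scope.
Set Implicit Arguments. Unset Strict Implicit. Unset Printing Implicit Defensive.

(** * Integrals of power weights in the plane *)

(** The range of p is what two demands on the drift leave. Ignoring eps, the drift has size |x|^(-a)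
    near the origin with a = 2b - 1; this is locally in L^p when a p < 2, and it brings the cap in
    before diffusion flattens it when a > 2s - 1. For s > 1/2, both can hold with a < 1 exactly when
    p < 2 / (2s - 1). The bound a < 1, that is b < 1, provides the slack 2 (1 - b) in the transport
    inequality on the cap; the relative radius of the cap and its starting height are cut out of
    this slack. The datum, the time and all constants must be fixed before the modulus is known, so
    only eps may depend on it and every estimate has to be uniform in eps. The comparison applies to
    every bounded smooth solution, so separation is obtained for all of them. In the scheme, a
    diffusion step is a convex average only if the truncation radius e has e^(2s) at least of the
    order of the time step, while truncation costs e^(2 - 2s) per unit time; tying e to the step
    balances the two. Each estimate loses a few derivatives, which is harmless because drift and
    datum have bounded derivatives of all orders and every bound is proved for all k. *)

Section PlaneMeasure.
Variable R : realType.
Local Notation mR := (measurableTypeR R).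
Local Notation l2 := ((@lebesgue_measure R) \x (@lebesgue_measure R))%E.

(** Balls of the maximum norm are squares, hence measurable rectangles; those with rational centre
    and radius 1/(n+1) that lie in U form a countable cover of U. *)
Lemma open_measurable2 (U : set (R * R)) : open U ->
  measurable (U : set (mR * mR)).
Proof.
move=> oU.
pose B (i : rat * rat * nat) : set (R * R) :=
  ball (ratr i.1.1 : R, ratr i.1.2 : R) (i.2.+1%:R^-1).
have -> : U = \bigcup_(i in [set i | B i `<=` U]) B i.
  apply/seteqP; split => [x Ux|x [i /= Bi]]; last exact: Bi.
  have /nbhs_ballP[e /= e0 be] : nbhs x U by exact: open_nbhs_nbhs.
  have [n nh] : exists n : nat, (n.+1%:R^-1 : R) < e / 2.
    have e20 : 0 < e / 2 by rewrite divr_gt0.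
    have [n _ nh] := near_infty_natSinv_lt (PosNum e20).
    by exists n; apply: (nh n) => /=.
  set r : R := n.+1%:R^-1 in nh.
  have r0 : 0 < r by rewrite invr_gt0.
  have H (y : R) : exists q : rat, `|ratr q - y| < r.
    have [|q] := @rat_in_itvoo R (y - r) (y + r); first by lra.
    by rewrite in_itv/= => /andP[? ?]; exists q; rewrite ltr_norml; apply/andP; split; lra.
  have [q1 h1] := H x.1; have [q2 h2] := H x.2.
  exists (q1, q2, n) => /=; last by split => /=; rewrite /ball/=.
  move=> z [/= z1 z2]; apply: be; rewrite /ball/= in z1 z2.
  have T (a b c : R) : `|a - b| < r -> `|a - c| < r -> `|b - c| < e.
    move=> h h'; rewrite -(subrKA a) (le_lt_trans (ler_normD _ _))//.
    by rewrite (distrC b); lra.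
  by split; rewrite /ball/=; apply: T; [exact: h1|exact: z1|exact: h2|exact: z2].
rewrite bigcup_mkcond; apply: countable_bigcupT_measurable => [|i]; first exact: countableP.
case: ifPn => _; last exact: measurable0.
have -> : B i = ball (ratr i.1.1 : R) (i.2.+1%:R^-1) `*` ball (ratr i.1.2 : R) (i.2.+1%:R^-1).
  by [].
by apply: measurableX; apply: open_measurable; exact: ball_open.
Qed.

Lemma continuous_measurable2 (f : R * R -> R) : continuous f ->
  measurable_fun setT (f : mR * mR -> mR).
Proof.
move=> cf.
apply: (measurability _ (RGenOpens.measurableE R)).
move=> _ [_ [a [b ->] <-]]; rewrite setTI.
apply: open_measurable2.
by apply: open_comp; [move=> x _; exact: cf|exact: interval_open].
Qed.

(** The substitutions y = x + z and y = x - z, treated together. Both preserve Lebesgue measure, and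
    averaging them later replaces first differences by symmetric second differences. *)
Let sig (b : bool) (x z : R) := if b then x + z else x - z.

Let msig b x : measurable_fun setT (sig b x : mR -> mR).
Proof.
by case: b; rewrite /sig; apply: continuous_measurable_fun => z;
  [apply: cvgD; [exact: cvg_cst|exact: cvg_id] | apply: cvgB; [exact: cvg_cst|exact: cvg_id]].
Qed.

Let leb_sig b x (A : set mR) : measurable A ->
  pushforward (@lebesgue_measure R) (sig b x : mR -> mR) A = lebesgue_measure A.
Proof.
move=> mA; apply/esym; move: A mA.
have H := @lebesgue_measure_unique R (pushforward lebesgue_measure (sig b x : mR -> mR)).
apply: H => //= _ [[a c]] _ <-.
rewrite /pushforward/=; case: b => /=.
  have -> : sig true x @^-1` `]a, c]%classic = `]a - x, c - x]%classic.
    by apply/seteqP; split => z /=; rewrite /sig !in_itv/= => /andP[? ?]; apply/andP; split; lra.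
  rewrite !lebesgue_measure_itv/= !lte_fin.
  have -> : (a - x < c - x) = (a < c) by lra.
  by case: ifP => // _; rewrite -!EFinB; congr EFin; lra.
have -> : sig false x @^-1` `]a, c]%classic = `[x - c, x - a[%classic.
  by apply/seteqP; split => z /=; rewrite /sig !in_itv/= => /andP[? ?]; apply/andP; split; lra.
rewrite !lebesgue_measure_itv/= !lte_fin.
have -> : (x - c < x - a) = (a < c) by lra.
by case: ifP => // _; rewrite -!EFinB; congr EFin; lra.
Qed.

Let sig2 (b : bool) (x z : R * R) : R * R := (sig b x.1 z.1, sig b x.2 z.2).

Let msig2 b x : measurable_fun setT (sig2 b x : mR * mR -> mR * mR).
Proof.
apply/measurable_fun_pairP; split.
  exact: (measurableT_comp (msig b x.1) measurable_fst).
exact: (measurableT_comp (msig b x.2) measurable_snd).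
Qed.

Let leb2_sig b x (A : set (mR * mR)) : measurable A ->
  pushforward l2 (sig2 b x : mR * mR -> mR * mR) A = l2 A.
Proof.
move=> mA; apply/esym; move: A mA.
have H := @product_measure_unique _ _ mR mR R lebesgue_measure lebesgue_measure
  (pushforward l2 (sig2 b x : mR * mR -> mR * mR)).
apply: H => A B mA mB.
change (l2 (((sig b x.1 @^-1` A) `*` (sig b x.2 @^-1` B)) : set (mR * mR)) =
  (lebesgue_measure A * lebesgue_measure B)%E).
rewrite product_measure1E.
- by congr (_ * _)%E; apply: leb_sig.
- by rewrite -[_ @^-1` _]setTI; apply: msig.
- by rewrite -[_ @^-1` _]setTI; apply: msig.
Qed.

Lemma integral2_sig b x (D : set (mR * mR)) (f : mR * mR -> \bar R) :
  measurable D -> measurable_fun setT f ->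
  (forall y, 0 <= f y)%E ->
  (\int[l2]_(y in D) f y = \int[l2]_(z in sig2 b x @^-1` D) f (sig2 b x z))%E.
Proof.
move=> mD mf f0.
have H := @ge0_integral_pushforward _ _ (mR * mR)%type (mR * mR)%type R (sig2 b x) (msig2 b x)
  l2 D f mD (measurable_funTS mf) (fun y _ => f0 y).
refine (eq_trans _ H).
apply: eq_measure_integral => A mA AD; symmetry; exact: (leb2_sig b x mA).
Qed.

End PlaneMeasure.

(** * One-dimensional integrals behind the kernel bounds *)

Section Kernel1D.
Variable R : realType.
Implicit Types (f F : R -> R).

Lemma eq_ler (x y : R) : x = y -> x <= y.
Proof. by move->. Qed.

Lemma is_derive_continuous (V : normedModType R) (f : R -> V) (x : R) df :
  is_derive x 1 f df -> {for x, continuous f}.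
Proof. by move=> h; apply/differentiable_continuous/derivable1_diffP; exact: ex_derive. Qed.

Lemma is_derive_powR_comp f (a x df : R) : 0 < f x -> is_derive x 1 f df ->
  is_derive x 1 (fun y => f y `^ a) (a * f x `^ (a - 1) * df).
Proof.
move=> fx h.
have := @is_derive1_comp R (fun y => y `^ a) f x _ _ (is_derive1_powR a fx) h.
by move=> hh; apply: (is_derive_eq hh); rewrite mulrC.
Qed.

Lemma even_integral f F (l : R) : (forall x : R, 0 <= x -> 0 <= f x) ->
  (forall x : R, 0 <= x -> {for x, continuous f}) ->
  (forall x : R, 0 <= x -> is_derive x 1 F (f x)) ->
  F x @[x --> +oo] --> l ->
  (\int[lebesgue_measure]_x (f `|x|)%:E = (2 * (l - F 0))%:E)%E.
Proof.
move=> f0 cf dF Fl.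
rewrite ge0_symfun_integralT; first last.
- by move=> x /=; rewrite normrN.
- move=> x; apply: (@continuous_comp _ _ _ (fun x : R => `|x|) f x).
    exact: norm_continuous.
  exact: cf.
- by move=> x; exact: f0.
rewrite (_ : [set x | 0 <= x] = `[0, +oo[%classic); last first.
  by rewrite set_itvcy.
rewrite EFinM; congr (_ * _)%E.
under eq_integral => x.
  rewrite inE/= in_itv/= andbT => x0; rewrite ger0_norm//; over.
rewrite (@ge0_continuous_FTC2y R f F 0 l)// ?EFinB//.
- apply: continuous_in_subspaceT => x; rewrite inE/= in_itv/= andbT; exact: cf.
- by move=> x x0; apply: (@ex_derive _ _ _ _ _ _ _ (dF x (ltW x0))).
- by apply: cvg_at_right_filter; apply: is_derive_continuous (dF 0 (lexx _)).
- move=> x; rewrite in_itv/= andbT => x0; rewrite derive1E.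
  exact: (@derive_val _ _ _ _ _ _ _ (dF x (ltW x0))).
Qed.

Lemma powR_cvgN (a r : R) : 0 < a -> (x + r) `^ (- a) @[x --> +oo] --> (0 : R).
Proof.
move=> a0; apply/cvgrPdist_lt => e e0.
near=> x.
have h : 0 < x + r by rewrite -ltrBlDr; near: x; apply: nbhs_pinfty_gt; rewrite num_real.
rewrite sub0r normrN ger0_norm ?powR_ge0// powRN.
rewrite -[ltRHS]invrK ltf_pV2 ?posrE ?powR_gt0 ?invr_gt0//.
have E : e^-1 = (e^-1 `^ a^-1) `^ a.
  by rewrite -powRrM mulVf ?gt_eqF// powRr1// invr_ge0 ltW.
rewrite E; apply: gt0_ltr_powR => //; rewrite ?nnegrE ?powR_ge0 ?(ltW h)//.
by rewrite -ltrBlDr; near: x; apply: nbhs_pinfty_gt; rewrite num_real.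
Unshelve. all: by end_near. Qed.

Lemma far_integral (s r : R) : 0 < s -> 0 < r ->
  (\int[lebesgue_measure]_x ((`|x| + r) `^ (- s - 1))%:E = (2 * (r `^ (- s) / s))%:E)%E.
Proof.
move=> s0 r0.
have d (x : R) : 0 <= x -> is_derive x 1 (fun x : R => x + r) 1.
  by move=> _; apply: is_derive_eq; rewrite addr0.
have P (x : R) : 0 <= x -> 0 < x + r by move=> ?; lra.
pose f (x : R) := (x + r) `^ (- s - 1).
pose F (x : R) := - s^-1 * (x + r) `^ (- s).
have f0 (x : R) : 0 <= x -> 0 <= f x by move=> _; exact: powR_ge0.
have cf (x : R) : 0 <= x -> {for x, continuous f}.
  by move=> x0; exact: is_derive_continuous (is_derive_powR_comp (f := fun x => x + r) _ (P x x0) (d x x0)).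
have dF (x : R) : 0 <= x -> is_derive x 1 F (f x).
  move=> x0; have h := is_derive_powR_comp (f := fun x => x + r) (- s) (P x x0) (d x x0).
  by apply: is_derive_eq; rewrite /f /GRing.scale/=; field; rewrite gt_eqF.
have lF : F x @[x --> +oo] --> (0 : R).
  by rewrite -[X in _ --> X](mulr0 (- s^-1)); apply: cvgM; [exact: cvg_cst|exact: powR_cvgN].
rewrite (even_integral f0 cf dF lF) /F; congr EFin.
by rewrite (add0r r); field; rewrite gt_eqF.
Qed.

(** With G(x) = 1/(x + e) + 1/r the integrand is - G' G^(al - 2), so G^(al - 1) / (1 - al) is a
    primitive. Its limit at infinity gives a bound free of e, once the nonnegative value at 0 is
    dropped. *)
Lemma near_integral (al e r : R) : 0 <= al < 1 -> 0 < e -> 0 < r ->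
  (\int[lebesgue_measure]_x (((`|x| + e) `^ (- 1) + r^-1) `^ (al - 2) * (`|x| + e) `^ (- 2))%:E
    <= (2 * (r `^ (1 - al) / (1 - al)))%:E)%E.
Proof.
move=> /andP[al0 al1] e0 r0.
have d (x : R) : 0 <= x -> is_derive x 1 (fun x : R => x + e) 1.
  by move=> _; apply: is_derive_eq; rewrite addr0.
have P (x : R) : 0 <= x -> 0 < x + e by move=> ?; lra.
have Q (x : R) : 0 <= x -> 0 < (x + e) `^ (-1) + r^-1.
  by move=> ?; rewrite ltr_pwDr ?powR_ge0 ?invr_gt0.
pose G (x : R) := (x + e) `^ (-1) + r^-1.
have dG (x : R) : 0 <= x -> is_derive x 1 G (- (x + e) `^ (- 2)).
  move=> x0; have h := is_derive_powR_comp (f := fun x => x + e) (- 1) (P x x0) (d x x0).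
  apply: is_derive_eq; rewrite addr0 mulr1 mulN1r; congr (- (_ `^ _)); lra.
pose f (x : R) := G x `^ (al - 2) * (x + e) `^ (- 2).
pose F (x : R) := (1 - al)^-1 * G x `^ (al - 1).
have f0 (x : R) : 0 <= x -> 0 <= f x by move=> _; rewrite mulr_ge0 ?powR_ge0.
have cf (x : R) : 0 <= x -> {for x, continuous f}.
  move=> x0; apply: cvgM.
    exact: is_derive_continuous (is_derive_powR_comp (f := G) _ (Q x x0) (dG x x0)).
  exact: is_derive_continuous (is_derive_powR_comp (f := fun x => x + e) _ (P x x0) (d x x0)).
have dF (x : R) : 0 <= x -> is_derive x 1 F (f x).
  move=> x0; have h := is_derive_powR_comp (f := G) (al - 1) (Q x x0) (dG x x0).
  apply: is_derive_eq; rewrite /GRing.scale/=.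
  have -> : al - 1 - 1 = al - 2 by lra.
  by rewrite /f; field; lra.
have lF : F x @[x --> +oo] --> ((1 - al)^-1 * (r^-1) `^ (al - 1)).
  apply: cvgM; first exact: cvg_cst.
  have c : {for r^-1, continuous (fun y : R => y `^ (al - 1))}.
    by apply: is_derive_continuous; apply: is_derive1_powR; rewrite invr_gt0.
  have lG : G x @[x --> +oo] --> r^-1.
    by rewrite -[X in _ --> X]add0r /G; apply: cvgD; [exact: powR_cvgN|exact: cvg_cst].
  exact: (cvg_comp _ _ lG c).
rewrite (even_integral f0 cf dF lF) lee_fin.
have -> : r^-1 `^ (al - 1) = r `^ (1 - al).
  by rewrite -(powR_inv1 (ltW r0)) -powRrM; congr (_ `^ _); lra.
rewrite ler_wpM2l// mulrC lerBlDr lerDl mulr_ge0 ?powR_ge0// invr_ge0; lra.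
Qed.

End Kernel1D.

(** * Tensor-product majorants of the kernel in the plane *)

Section Kernel2D.
Variable R : realType.
Local Notation mR := (measurableTypeR R).
Local Notation l2 := ((@lebesgue_measure R) \x (@lebesgue_measure R))%E.

Lemma integral_prod2 (f g : R -> R) : measurable_fun setT (f : mR -> mR) ->
  measurable_fun setT (g : mR -> mR) -> (forall x, 0 <= f x) -> (forall x, 0 <= g x) ->
  (\int[l2]_z (f z.1 * g z.2)%:E =
   \int[lebesgue_measure]_x (f x)%:E * \int[lebesgue_measure]_x (g x)%:E)%E.
Proof.
move=> mf mg f0 g0.
have mfg : measurable_fun setT (fun z : mR * mR => (f z.1 * g z.2)%:E).
  apply/measurable_EFinP; apply: measurable_funM.
    exact: (measurableT_comp mf measurable_fst).
  exact: (measurableT_comp mg measurable_snd).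
rewrite (fubini_tonelli1 _ mfg); last by move=> z; rewrite lee_fin mulr_ge0.
rewrite /fubini_F /=.
under eq_integral => x _.
  under eq_integral do rewrite EFinM.
  rewrite ge0_integralZl//; last first.
  - by rewrite lee_fin.
  - by move=> y _; rewrite lee_fin.
  - exact/measurable_EFinP.
  over.
rewrite ge0_integralZr//.
- exact/measurable_EFinP.
- by move=> y _; rewrite lee_fin.
- by apply: integral_ge0 => y _; rewrite lee_fin.
Qed.

Lemma enorm2_ge0 (z : R * R) : 0 <= enorm2 z.
Proof. exact: sqrtr_ge0. Qed.

Lemma enorm2_sq (z : R * R) : enorm2 z ^+ 2 = z.1 ^+ 2 + z.2 ^+ 2.
Proof. by rewrite /enorm2 sqr_sqrtr// addr_ge0// sqr_ge0. Qed.

Lemma enorm2_ge1 (z : R * R) : `|z.1| <= enorm2 z.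
Proof. by rewrite -(sqrtr_sqr z.1) ler_sqrt ?addr_ge0 ?sqr_ge0// lerDl sqr_ge0. Qed.

Lemma enorm2_ge2 (z : R * R) : `|z.2| <= enorm2 z.
Proof. by rewrite -(sqrtr_sqr z.2) ler_sqrt ?addr_ge0 ?sqr_ge0// lerDr sqr_ge0. Qed.

Lemma continuous_enorm2 : continuous (@enorm2 R).
Proof.
move=> z; rewrite /enorm2; apply: continuous_comp; last exact: sqrt_continuous.
by apply: cvgD; apply: cvgM; first [exact: cvg_fst|exact: cvg_snd].
Qed.

Lemma powR_le_neg (a b t : R) : 0 < a -> a <= b -> 0 <= t -> b `^ (- t) <= a `^ (- t).
Proof.
move=> a0 ab t0; rewrite !powRN lef_pV2 ?posrE ?powR_gt0//; last exact: lt_le_trans ab.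
by apply: ge0_ler_powR => //; rewrite nnegrE ltW// (lt_le_trans a0).
Qed.

Lemma measurable_powR_comp d (T : measurableType d) (f : T -> R) a :
  measurable_fun setT (f : T -> mR) -> measurable_fun setT (fun x => f x `^ a : mR).
Proof. by move=> mf; apply: (measurableT_comp (measurable_powR a)). Qed.

Lemma measurable_norm_add (e : R) : measurable_fun setT (fun x : mR => `|x| + e : mR).
Proof.
apply: continuous_measurable_fun => x; apply: cvgD; last exact: cvg_cst.
exact: norm_continuous.
Qed.

Lemma measurable_enorm2 : measurable_fun setT (@enorm2 R : mR * mR -> mR).
Proof. exact: continuous_measurable2 continuous_enorm2. Qed.

Lemma measurable_far (e : R) : measurable ([set z : R * R | e < enorm2 z] : set (mR * mR)).
Proof.
apply: open_measurable2.
rewrite (_ : [set z : R * R | _] = @enorm2 R @^-1` `]e, +oo[%classic); last first.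
  by apply/seteqP; split => z; rewrite /= in_itv/= andbT.
by apply: open_comp; [move=> x _; exact: continuous_enorm2|exact: rray_open].
Qed.

(** If r < |z| then |z| is at least (|z_i| + r) / 2 for both coordinates. Giving half of the
    exponent to each coordinate dominates the kernel by a product, which takes the place of polar
    coordinates. *)
Lemma kernel_far (s r : R) : 0 < s -> 0 < r ->
  (\int[l2]_(z in [set z : R * R | (r < enorm2 z)%R]) (enorm2 z `^ (- (2 + 2 * s)))%:E
    <= (2 `^ (2 + 2 * s) * (2 / s) ^+ 2 * r `^ (- (2 * s)))%:E)%E.
Proof.
move=> s0 r0.
pose f (x : R) := (`|x| + r) `^ (- s - 1).
have mf : measurable_fun setT (f : mR -> mR).
  by apply: measurable_powR_comp; exact: measurable_norm_add.
apply: (@le_trans _ _ (\int[l2]_z (2 `^ (2 + 2 * s) * f z.1 * f z.2)%:E)%E).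
  rewrite integral_mkcond; apply: ge0_le_integral => //.
  - by move=> z _; rewrite patchE; case: ifP => // _; rewrite lee_fin powR_ge0.
  - apply/(measurable_restrictT _ (measurable_far r)); apply/measurable_EFinP.
    by apply: measurable_funTS; apply: measurable_powR_comp; exact: measurable_enorm2.
  - apply/measurable_EFinP; apply: measurable_funM.
      by apply: measurable_funM => //; exact: (measurableT_comp mf measurable_fst).
    exact: (measurableT_comp mf measurable_snd).
  - move=> z _; rewrite patchE; case: ifP => [|_]; last first.
      by rewrite lee_fin !mulr_ge0 ?powR_ge0.
    rewrite inE/= => rz; rewrite lee_fin.
    have z0 : 0 < enorm2 z by apply: lt_trans rz.
    have -> : 2 `^ (2 + 2 * s) = (2^-1 `^ (- (1 + s))) ^+ 2 :> R.
      rewrite -powR_mulrn ?powR_ge0// -powRrM -(powR_inv1 (ler0n _ 2)) -powRrM.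
      by congr (_ `^ _); ring.
    have -> : enorm2 z `^ (- (2 + 2 * s)) = enorm2 z `^ (- (1 + s)) * enorm2 z `^ (- (1 + s)).
      by rewrite -powRD ?(gt_eqF z0) ?implybT//; congr (_ `^ _); ring.
    set A := 2^-1 `^ _.
    rewrite (_ : A ^+ 2 * f z.1 * f z.2 = (A * f z.1) * (A * f z.2)); last by ring.
    have H x : `|x| <= enorm2 z -> enorm2 z `^ (- (1 + s)) <= A * f x.
      move=> xz; rewrite /A /f (_ : - s - 1 = - (1 + s)); last by ring.
      rewrite -powRM ?invr_ge0//; last by rewrite addr_ge0// ltW.
      apply: powR_le_neg; first by rewrite mulr_gt0// ltr_wpDl.
        by lra.
      by lra.
    apply: ler_pM; rewrite ?powR_ge0//; apply: H.
      exact: enorm2_ge1.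
    exact: enorm2_ge2.
under eq_integral do rewrite -mulrA EFinM.
rewrite ge0_integralZl//; last first.
- by move=> z _; rewrite lee_fin mulr_ge0 ?powR_ge0.
- apply/measurable_EFinP; apply: measurable_funM.
    exact: (measurableT_comp mf measurable_fst).
  exact: (measurableT_comp mf measurable_snd).
rewrite integral_prod2//; do ?[by move=> x; exact: powR_ge0].
rewrite far_integral// -!EFinM lee_fin.
have -> : r `^ (- (2 * s)) = r `^ (- s) * r `^ (- s).
  by rewrite -powRD ?(gt_eqF r0) ?implybT//; congr (_ `^ _); ring.
by apply: eq_ler; ring.
Qed.

(* Comparable to t^(-al) for t <= r and to t^(-2) beyond, with an explicit primitive in t. *)
Definition nearfun (al r t : R) := (t `^ (-1) + r^-1) `^ (al - 2) * t `^ (- 2).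

Lemma nearfun_ge0 al r t : 0 <= nearfun al r t.
Proof. by rewrite mulr_ge0 ?powR_ge0. Qed.

(** [nearfun al r t] equals t^(-al) (1 + t/r)^(-(2 - al)), which decreases in t. *)
Lemma nearfun_ge al r t w : 0 <= al < 1 -> 0 < r -> 0 < t -> t <= w ->
  w `^ (- al) * (1 + w / r) `^ (- (2 - al)) <= nearfun al r t.
Proof.
move=> /andP[al0 al1] r0 t0 tw.
have w0 : 0 < w by apply: lt_le_trans tw.
have -> : nearfun al r t = t `^ (- al) * (1 + t / r) `^ (- (2 - al)).
  rewrite /nearfun.
  have -> : t `^ (-1) + r^-1 = t `^ (-1) * (1 + t / r).
    by rewrite powR_inv1 ?ltW//; field; rewrite !gt_eqF.
  rewrite powRM ?powR_ge0//; last by rewrite addr_ge0// divr_ge0 ?ltW.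
  rewrite -powRrM mulrAC -powRD ?(gt_eqF t0) ?implybT//.
  by congr (_ `^ _ * _ `^ _); ring.
apply: ler_pM; rewrite ?powR_ge0//; apply: powR_le_neg => //; try lra.
  by rewrite addr_gt0// divr_gt0.
by rewrite lerD2l ler_pM2r ?invr_gt0.
Qed.

Lemma measurable_nearfun al r e : measurable_fun setT (fun x : mR => nearfun al r (`|x| + e) : mR).
Proof.
apply: measurable_funM.
  apply: measurable_powR_comp; apply: measurable_funD => //.
  by apply: measurable_powR_comp; exact: measurable_norm_add.
by apply: measurable_powR_comp; exact: measurable_norm_add.
Qed.

Lemma near_integral2 al e r c : 0 <= al < 1 -> 0 < e -> 0 < r -> 0 <= c ->
  (\int[l2]_z (c * (nearfun al r (`|z.1| + e) * nearfun al r (`|z.2| + e)))%:E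
    <= (c * (2 * (r `^ (1 - al) / (1 - al))) ^+ 2)%:E)%E.
Proof.
move=> al01 e0 r0 c0.
have mf := measurable_nearfun al r e.
under eq_integral do rewrite EFinM.
rewrite ge0_integralZl//; last first.
- by move=> z _; rewrite lee_fin mulr_ge0 ?nearfun_ge0.
- apply/measurable_EFinP; apply: measurable_funM.
    exact: (measurableT_comp mf measurable_fst).
  exact: (measurableT_comp mf measurable_snd).
rewrite (integral_prod2 mf mf); do ?[by move=> x; exact: nearfun_ge0].
rewrite EFinM lee_wpmul2l ?lee_fin// expr2 EFinM.
have h := near_integral al01 e0 r0.
have h0 : (0 <= \int[lebesgue_measure]_x (nearfun al r (`|x| + e))%:E)%E.
  by apply: integral_ge0 => x _; rewrite lee_fin nearfun_ge0.
by apply: lee_pmul.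
Qed.

(** The exponent 2s is shared equally, and s < 1 makes each factor integrable. On the annulus |z_i|
    + e <= 2 |z| and 1 + 2 |z| / r <= 3, whence the powers of 2 and 3. *)
Lemma kernel_near (s e r : R) : 0 <= s < 1 -> 0 < e -> e <= r ->
  (\int[l2]_(z in [set z : R * R | (e < enorm2 z <= r)%R]) (enorm2 z `^ (- (2 * s)))%:E
    <= ((2 `^ s * 3 `^ (2 - s)) ^+ 2 * (2 * (r `^ (1 - s) / (1 - s))) ^+ 2)%:E)%E.
Proof.
move=> s01 e0 er; have /andP[s0 s1] := s01; have r0 : 0 < r by apply: lt_le_trans er.
have mf := measurable_nearfun s r e.
set c := (_ ^+ 2); set D := [set _ | _].
apply: le_trans (near_integral2 s01 e0 r0 (sqr_ge0 _ : 0 <= c)).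
have mD : measurable (D : set (mR * mR)).
  rewrite (_ : D = [set z | e < enorm2 z] `&` ~` [set z | r < enorm2 z]).
    by apply: measurableI; [exact: measurable_far|apply: measurableC; exact: measurable_far].
  apply/seteqP; split => z /=; rewrite /D/=; first by move=> /andP[? ?]; split => //; apply/negP; rewrite -leNgt.
  by move=> [-> /negP]; rewrite -leNgt => ->.
rewrite integral_mkcond; apply: ge0_le_integral => //.
- by move=> z _; rewrite patchE; case: ifP => // _; rewrite lee_fin powR_ge0.
- apply/(measurable_restrictT _ mD); apply/measurable_EFinP.
  by apply: measurable_funTS; apply: measurable_powR_comp; exact: measurable_enorm2.
- apply/measurable_EFinP; apply: measurable_funM => //; apply: measurable_funM.
    exact: (measurableT_comp mf measurable_fst).
  exact: (measurableT_comp mf measurable_snd).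
- move=> z _; rewrite patchE; case: ifP => [|_]; last first.
    by rewrite lee_fin; apply: mulr_ge0; [exact: sqr_ge0|rewrite mulr_ge0 ?nearfun_ge0].
  rewrite inE/= /D/= => /andP[ez zr]; rewrite lee_fin.
  have z0 : 0 < enorm2 z by apply: lt_trans ez.
  have H x : `|x| <= enorm2 z -> enorm2 z `^ (- s) <= 2 `^ s * 3 `^ (2 - s) * nearfun s r (`|x| + e).
    move=> xz; apply: (@le_trans _ _ (2 `^ s * 3 `^ (2 - s) * ((2 * enorm2 z) `^ (- s) * (1 + 2 * enorm2 z / r) `^ (- (2 - s))))).
      have h3 : 3 `^ (- (2 - s)) <= (1 + 2 * enorm2 z / r) `^ (- (2 - s)).
        apply: powR_le_neg; first by rewrite addr_gt0// divr_gt0// mulr_gt0.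
          have : enorm2 z / r <= 1 by rewrite ler_pdivrMr// mul1r.
          by rewrite -mulrA; lra.
        by lra.
      rewrite powRM ?(ltW z0)//.
      rewrite (_ : _ * _ * _ = (2 `^ s * 2 `^ (- s)) * enorm2 z `^ (- s) *
          (3 `^ (2 - s) * (1 + 2 * enorm2 z / r) `^ (- (2 - s)))); last by ring.
      rewrite (powRN 2 s) mulfV ?gt_eqF ?powR_gt0// mul1r ler_peMr ?powR_ge0//.
      apply: le_trans (ler_wpM2l (powR_ge0 3 (2 - s)) h3).
      by rewrite (powRN 3) mulfV// gt_eqF// powR_gt0.
    rewrite ler_wpM2l ?mulr_ge0 ?powR_ge0//; apply: nearfun_ge => //; last by lra.
    by rewrite ltr_wpDl.
  have -> : enorm2 z `^ (- (2 * s)) = enorm2 z `^ (- s) * enorm2 z `^ (- s).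
    by rewrite -powRD ?(gt_eqF z0) ?implybT//; congr (_ `^ _); ring.
  rewrite /c expr2 mulrACA; apply: ler_pM; rewrite ?powR_ge0//; apply: H.
    exact: enorm2_ge1.
  exact: enorm2_ge2.
Qed.

End Kernel2D.

(** * The truncated singular integral *)

Section SingularIntegral.
Variable R : realType.
Local Notation mR := (measurableTypeR R).
Local Notation l2 := ((@lebesgue_measure R) \x (@lebesgue_measure R))%E.
Variable s : R.
Hypothesis s01 : 0 < s < 1.
Let s0 : 0 < s. Proof. by case/andP: s01. Qed.
Let s1 : s < 1. Proof. by case/andP: s01. Qed.

Definition knl (z : R * R) : R := enorm2 z `^ (- (2 + 2 * s)).
Definition outside (e : R) : set (R * R) := [set z | e < enorm2 z].
Definition Ik (e : R) (w : R * R -> R) : R :=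
  \int[l2]_(z in outside e) (w z * knl z).
Definition Kfar : R := 2 `^ (2 + 2 * s) * (2 / s) ^+ 2.
Definition Knear : R := (2 `^ s * 3 `^ (2 - s)) ^+ 2 * (2 / (1 - s)) ^+ 2.

Lemma knl_ge0 z : 0 <= knl z. Proof. exact: powR_ge0. Qed.
Lemma Kfar_ge0 : 0 <= Kfar. Proof. by rewrite mulr_ge0 ?powR_ge0 ?sqr_ge0. Qed.
Lemma Knear_ge0 : 0 <= Knear. Proof. by rewrite mulr_ge0 ?sqr_ge0. Qed.

Lemma measurable_outside (e : R) : measurable (outside e : set (mR * mR)).
Proof. exact: measurable_far. Qed.

Lemma measurable_knl : measurable_fun setT (knl : mR * mR -> mR).
Proof. by apply: measurable_powR_comp; exact: measurable_enorm2. Qed.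

Let measurable_wknl (w : R * R -> R) : measurable_fun setT (w : mR * mR -> mR) ->
  measurable_fun setT (fun z : mR * mR => (w z * knl z)%:E).
Proof.
by move=> mw; apply/measurable_EFinP; apply: measurable_funM => //; exact: measurable_knl.
Qed.

Lemma knl_integrable (e : R) : 0 < e -> l2.-integrable (outside e) (fun z => (knl z)%:E).
Proof.
move=> e0; apply/integrableP; split.
  by apply: measurable_funTS; apply/measurable_EFinP; exact: measurable_knl.
under eq_integral do rewrite gee0_abs ?lee_fin ?knl_ge0//.
exact: le_lt_trans (kernel_far s0 e0) (ltry _).
Qed.

Lemma wknl_integrable (w : R * R -> R) (B e : R) : 0 < e ->
  measurable_fun setT (w : mR * mR -> mR) -> (forall z, `|w z| <= B) ->
  l2.-integrable (outside e) (fun z => (w z * knl z)%:E).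
Proof.
move=> e0 mw wB.
apply: (@le_integrable _ _ _ l2 _ (measurable_outside e) _ (fun z => (B * knl z)%:E)).
- by apply: measurable_funTS; exact: measurable_wknl.
- move=> z _; rewrite !abse_EFin lee_fin !normrM ler_wpM2r//.
  by apply: le_trans (wB z) (ler_norm _).
- have := integrableZl (measurable_outside e) B (knl_integrable e0).
  by apply: eq_integrable; [exact: measurable_outside|move=> z _; rewrite EFinM].
Qed.

Lemma Ik_le_far (w : R * R -> R) (B0 B r : R) : 0 < r -> 0 <= B ->
  measurable_fun setT (w : mR * mR -> mR) -> (forall z, `|w z| <= B0) ->
  (forall z, w z <= B) -> Ik r w <= B * (Kfar * r `^ (- (2 * s))).
Proof.
move=> r0 B_ge0 mw wB0 wB.
have i1 := wknl_integrable r0 mw wB0.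
have i2 : l2.-integrable (outside r) (fun z => (B * knl z)%:E).
  by apply: (@wknl_integrable (fun=> B) B) => // _; rewrite ger0_norm.
apply: (@le_trans _ _ (\int[l2]_(z in outside r) (B * knl z))).
  apply: le_Rintegral => //; first exact: measurable_outside.
  by move=> z _; rewrite ler_wpM2r ?knl_ge0.
rewrite RintegralZl//; [|exact: measurable_outside|exact: knl_integrable].
rewrite ler_wpM2l// -lee_fin /Rintegral fineK; first exact: kernel_far.
apply: integrable_fin_num; [exact: measurable_outside|exact: knl_integrable].
Qed.

Let annulus (e r : R) : set (R * R) := [set z | e < enorm2 z <= r].

Let annulusE (e r : R) : e <= r -> annulus e r = outside e `\` outside r.
Proof.
move=> er; apply/seteqP; split => z; rewrite /annulus/outside/=.
  by move=> /andP[? ?]; split => //; apply/negP; rewrite -leNgt.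
by move=> [-> /negP]; rewrite -leNgt => ->.
Qed.

Let measurable_annulus (e r : R) : e <= r -> measurable (annulus e r : set (mR * mR)).
Proof.
by move=> er; rewrite annulusE//; apply: measurableD; exact: measurable_outside.
Qed.

Let Ik_split (w : R * R -> R) (B0 e r : R) : 0 < e -> e <= r ->
  measurable_fun setT (w : mR * mR -> mR) -> (forall z, `|w z| <= B0) ->
  Ik e w = \int[l2]_(z in annulus e r) (w z * knl z) + Ik r w.
Proof.
move=> e0 er mw wB.
have E : outside e = annulus e r `|` outside r.
  rewrite annulusE// setUC setDUK// => z; rewrite /outside/=; exact: le_lt_trans.
rewrite /Ik E Rintegral_setU//.
- exact: measurable_annulus.
- exact: measurable_outside.
- by rewrite -E; exact: (wknl_integrable e0 mw wB).
- by rewrite annulusE//; apply/disj_setPS => z [[_ h] h']; exact: h.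
Qed.

Let near_le (w : R * R -> R) (A B0 e r : R) : 0 < e -> e <= r -> 0 <= A ->
  measurable_fun setT (w : mR * mR -> mR) -> (forall z, `|w z| <= B0) ->
  (forall z, w z <= A * enorm2 z ^+ 2) ->
  \int[l2]_(z in annulus e r) (w z * knl z) <= A * (Knear * r `^ (2 - 2 * s)).
Proof.
move=> e0 er A0 mw wB wA; have r0 : 0 < r by apply: lt_le_trans er.
have mA := measurable_annulus er.
have sub : annulus e r `<=` outside e by move=> z /andP[].
have k2 z : annulus e r z -> enorm2 z ^+ 2 * knl z = enorm2 z `^ (- (2 * s)).
  move=> /andP[ez _]; have z0 : 0 < enorm2 z by apply: lt_trans ez.
  rewrite -powR_mulrn ?(ltW z0)// -powRD ?(gt_eqF z0) ?implybT//.
  by congr (_ `^ _); ring.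
have s01' : 0 <= s < 1 by rewrite ltW.
have fin := kernel_near s01' e0 er.
have i2 : l2.-integrable (annulus e r) (fun z => (enorm2 z `^ (- (2 * s)))%:E).
  apply/integrableP; split.
    apply: measurable_funTS; apply/measurable_EFinP; apply: measurable_powR_comp.
    exact: measurable_enorm2.
  under eq_integral do rewrite gee0_abs ?lee_fin ?powR_ge0//.
  exact: le_lt_trans fin (ltry _).
have i3 : l2.-integrable (annulus e r) (fun z => (A * enorm2 z `^ (- (2 * s)))%:E).
  have := integrableZl mA A i2.
  by apply: eq_integrable => // z _; rewrite EFinM.
apply: (@le_trans _ _ (\int[l2]_(z in annulus e r) (A * enorm2 z `^ (- (2 * s))))).
  apply: le_Rintegral => //.
    apply: integrableS (wknl_integrable e0 mw wB) => //; exact: measurable_outside.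
  by move=> z az; rewrite -k2// mulrA ler_wpM2r ?knl_ge0.
rewrite RintegralZl// ler_wpM2l// -lee_fin /Rintegral fineK; last exact: integrable_fin_num.
apply: le_trans fin _; rewrite lee_fin /Knear.
have -> : r `^ (2 - 2 * s) = (r `^ (1 - s)) ^+ 2.
  by rewrite -powR_mulrn ?powR_ge0// -powRrM; congr (_ `^ _); ring.
by apply: eq_ler; field; rewrite subr_eq0 gt_eqF.
Qed.

(** The integral is split at radius r: the quadratic bound is integrated inside, the constant one
    outside. Both are bounds from above only, so the estimate applies at a point where a function is
    touched from one side; [B0] serves integrability. *)
Lemma Ik_le (w : R * R -> R) (A B0 B e r : R) : 0 < e -> e <= r -> 0 <= A -> 0 <= B ->
  measurable_fun setT (w : mR * mR -> mR) -> (forall z, `|w z| <= B0) ->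
  (forall z, w z <= A * enorm2 z ^+ 2) -> (forall z, w z <= B) ->
  Ik e w <= A * (Knear * r `^ (2 - 2 * s)) + B * (Kfar * r `^ (- (2 * s))).
Proof.
move=> e0 er A0 B_ge0 mw wB0 wA wB.
rewrite (Ik_split e0 er mw wB0) lerD//; first exact: near_le.
exact: Ik_le_far (lt_le_trans e0 er) _ mw wB0 wB.
Qed.

Lemma IkZ (w : R * R -> R) (B k e : R) : 0 < e ->
  measurable_fun setT (w : mR * mR -> mR) -> (forall z, `|w z| <= B) ->
  Ik e (fun z => k * w z) = k * Ik e w.
Proof.
move=> e0 mw wB; rewrite /Ik.
under eq_Rintegral do rewrite -mulrA.
rewrite RintegralZl//; first exact: measurable_outside.
exact: (wknl_integrable e0 mw wB).
Qed.

Lemma IkD (w w' : R * R -> R) (B B' e : R) : 0 < e ->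
  measurable_fun setT (w : mR * mR -> mR) -> (forall z, `|w z| <= B) ->
  measurable_fun setT (w' : mR * mR -> mR) -> (forall z, `|w' z| <= B') ->
  Ik e (fun z => w z + w' z) = Ik e w + Ik e w'.
Proof.
move=> e0 mw wB mw' wB'; rewrite /Ik.
under eq_Rintegral do rewrite mulrDl.
rewrite RintegralD//; first exact: measurable_outside.
- exact: (wknl_integrable e0 mw wB).
- exact: (wknl_integrable e0 mw' wB').
Qed.

Lemma Ik_abs_le (w : R * R -> R) (A B e r : R) : 0 < e -> e <= r ->
  measurable_fun setT (w : mR * mR -> mR) ->
  (forall z, `|w z| <= A * enorm2 z ^+ 2) -> (forall z, `|w z| <= B) ->
  0 <= A ->
  `|Ik e w| <= A * (Knear * r `^ (2 - 2 * s)) + B * (Kfar * r `^ (- (2 * s))).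
Proof.
move=> e0 er mw wA wB A0; have B0 : 0 <= B by apply: le_trans (wB 0).
rewrite ler_norml -lerNl; apply/andP; split.
  rewrite -mulN1r -(IkZ _ e0 mw wB).
  apply: (Ik_le (B0 := B)) => //.
  - by apply: measurable_funM.
  - by move=> z; rewrite mulN1r normrN.
  - by move=> z; rewrite mulN1r; apply: le_trans (wA z); rewrite -normrN ler_norm.
  - by move=> z; rewrite mulN1r; apply: le_trans (wB z); rewrite -normrN ler_norm.
apply: (Ik_le (B0 := B)) => // z.
- exact: le_trans (ler_norm _) (wA z).
- exact: le_trans (ler_norm _) (wB z).
Qed.

Lemma Ik_diff (w : R * R -> R) (A B e r : R) : 0 < e -> e <= r ->
  measurable_fun setT (w : mR * mR -> mR) ->
  (forall z, `|w z| <= A * enorm2 z ^+ 2) -> (forall z, `|w z| <= B) -> 0 <= A ->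
  `|Ik e w - Ik r w| <= A * (Knear * r `^ (2 - 2 * s)).
Proof.
move=> e0 er mw wA wB A0.
rewrite (Ik_split e0 er mw wB) addrK ler_norml -lerNl; apply/andP; split; last first.
  by apply: near_le mw wB _ => // z; apply: le_trans (ler_norm _) (wA z).
have mA := measurable_annulus er.
have iw : l2.-integrable (annulus e r) (fun z => (w z * knl z)%:E).
  apply: integrableS (wknl_integrable e0 mw wB) => //; first exact: measurable_outside.
  by move=> z /andP[].
rewrite -mulN1r -RintegralZl//.
under eq_Rintegral do rewrite mulrA.
apply: (@near_le (fun z => - 1 * w z) A B) => //.
- by apply: measurable_funM.
- by move=> z; rewrite mulN1r normrN.
- by move=> z; rewrite mulN1r; apply: le_trans (wA z); rewrite -normrN ler_norm.
Qed.

Definition sdiff (f : R * R -> R) (x z : R * R) : R := 2 * f x - f (x + z) - f (x - z).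

Lemma measurable_sdiff f x : continuous f ->
  measurable_fun setT (sdiff f x : mR * mR -> mR).
Proof.
move=> cf; apply: continuous_measurable2 => z.
apply: cvgB; first apply: cvgB; first exact: cvg_cst.
  by apply: (@continuous_comp _ _ _ (fun z => x + z) f z); [apply: cvgD; [exact: cvg_cst|exact: cvg_id]|exact: cf].
apply: (@continuous_comp (R * R)%type (R * R)%type R (fun z => x - z) f z); last exact: cf.
by apply: cvgB; [exact: cvg_cst|exact: cvg_id].
Qed.

Lemma integral2_sigE (b : bool) x (D : set (mR * mR)) (f : mR * mR -> \bar R) :
  measurable D -> measurable_fun setT f ->
  let sg := fun z : R * R => if b then x + z else x - z in
  (\int[l2]_(y in D) f y = \int[l2]_(z in sg @^-1` D) f (sg z))%E.
Proof.
move=> mD mf sg; rewrite integralE [RHS]integralE.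
have -> : sg = fun z => ((if b then x.1 + z.1 else x.1 - z.1), (if b then x.2 + z.2 else x.2 - z.2)).
  by rewrite /sg; case: (b).
congr (_ - _)%E.
  rewrite (integral2_sig b x mD (measurable_funepos mf)); last by move=> y; exact: funepos_ge0.
  by apply: eq_integral => z _; rewrite [in RHS](funepos_comp f).
rewrite (integral2_sig b x mD (measurable_funeneg mf)); last by move=> y; exact: funeneg_ge0.
by apply: eq_integral => z _; rewrite [in RHS](funeneg_comp f).
Qed.

Lemma enorm2N (z : R * R) : enorm2 (- z) = enorm2 z.
Proof. by rewrite /enorm2 /= !sqrrN. Qed.

(** Recentring with y = x + z and with y = x - z gives the same value twice; the half-sum has the
    second difference as its numerator, which is O(|z|^2) for smooth f and so survives the removal
    of the truncation. *)
Lemma fraclap_integral (f : R * R -> R) (M : R) (x : R * R) (e : R) : continuous f ->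
  (forall y, `|f y| <= M) -> 0 < e ->
  let g := fun y => (f x - f y) / (enorm2 (x - y)) `^ (2 + 2 * s) in
  let D := [set y | e < enorm2 (x - y)] in
  (@leb2 R).-integrable D (fun y => (g y)%:E) /\ Rintegral (@leb2 R) D g = 2^-1 * Ik e (sdiff f x).
Proof.
move=> cf fM e0 g D.
have gE : g = fun y => (f x - f y) * knl (x - y).
  by apply/funext => y; rewrite /g /knl powRN.
have csub b : continuous (fun z : R * R => if b then x + z else x - z).
  by case: b => z; [apply: cvgD|apply: cvgB]; first [exact: cvg_cst|exact: cvg_id].
have mfs b : measurable_fun setT (fun z : mR * mR => f x - f (if b then x + z else x - z) : mR).
  apply: (@continuous_measurable2 R (fun z => f x - f (if b then x + z else x - z))) => z.
  apply: cvgB; first exact: cvg_cst.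
  exact: (@continuous_comp (R * R)%type (R * R)%type R _ f z (csub b z) (cf _)).
have mfb b z : `|f x - f (if b then x + z else x - z)| <= M + M.
  by apply: le_trans (ler_normB _ _) _; rewrite lerD.
have mk : measurable_fun setT (fun y : mR * mR => knl (x - y) : mR).
  apply: measurable_powR_comp.
  apply: (@continuous_measurable2 R (fun y => enorm2 (x - y))) => z.
  by apply: (@continuous_comp (R * R)%type (R * R)%type R _ (@enorm2 R) z (csub false z)); exact: continuous_enorm2.
have mg : measurable_fun setT (fun y : mR * mR => (g y)%:E).
  rewrite gE; apply/measurable_EFinP; apply: measurable_funM => //.
  apply: measurable_funB => //; exact: continuous_measurable2.
have mD : measurable (D : set (mR * mR)).
  apply: open_measurable2.
  rewrite (_ : D = (fun y => enorm2 (x - y)) @^-1` `]e, +oo[%classic); last first.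
    by apply/seteqP; split => z; rewrite /D/= in_itv/= andbT.
  apply: open_comp; last exact: rray_open.
  by move=> z _; apply: (@continuous_comp (R * R)%type (R * R)%type R _ (@enorm2 R) z (csub false z)); exact: continuous_enorm2.
have preD b : (fun z => if b then x + z else x - z) @^-1` D = outside e.
  apply/seteqP; split => z; rewrite /D /outside/=; case: b; rewrite ?opprD ?addrA ?opprK ?subrr ?add0r ?enorm2N//.
have gsg b z : g (if b then x + z else x - z) = (f x - f (if b then x + z else x - z)) * knl z.
  by rewrite gE /knl; case: b; rewrite ?opprD ?addrA ?opprK ?subrr ?add0r ?enorm2N.
have isg b : l2.-integrable (outside e)
    (fun z => ((f x - f (if b then x + z else x - z)) * knl z)%:E).
  exact: (wknl_integrable e0 (mfs b) (mfb b)).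
have Rg b : Rintegral l2 D g = Ik e (fun z => f x - f (if b then x + z else x - z)).
  rewrite /Ik /Rintegral; congr fine.
  rewrite (integral2_sigE b x mD mg) preD.
  by apply: eq_integral => z _; rewrite gsg.
split.
  apply/integrableP; split; first exact: measurable_funTS.
  rewrite (integral2_sigE true x mD); last exact: measurableT_comp.
  change (fun z => x + z) with (fun z : R * R => if true then x + z else x - z).
  rewrite (preD true); have /integrableP[_] := isg true.
  by congr (_ < _)%E; apply: eq_integral => z _; rewrite -(gsg true z).
have -> : Ik e (sdiff f x) = Rintegral l2 D g + Rintegral l2 D g.
  rewrite {1}(Rg true) (Rg false) -(IkD e0 (mfs true) (mfb true) (mfs false) (mfb false)).
  by congr Ik; apply/funext => z; rewrite /sdiff; ring.
by rewrite /leb2; field.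
Qed.

End SingularIntegral.

(** * Functions with bounded partial derivatives *)

Section Calculus1D.
Variable R : realType.

Lemma is_derive_cvg (f : R -> R) (t l : R) : is_derive t 1 f l <->
  h^-1 * (f (h + t) - f t) @[h --> 0^'] --> l.
Proof.
have E : (fun h : R => h^-1 *: ((f \o shift t) h%:A - f t)) = (fun h => h^-1 * (f (h + t) - f t)).
  by apply/funext => h; rewrite /= [h%:A]mulr1.
split=> [D|H].
  have := @ex_derive _ _ _ _ _ _ _ D; rewrite /derivable E => /cvg_ex[k Hk].
  have := @derive_val _ _ _ _ _ _ _ D; rewrite /derive E => <-.
  by rewrite (cvg_lim _ Hk).
apply: DeriveDef; first by rewrite /derivable E; apply/cvg_ex; exists l.
by rewrite /derive E; exact: cvg_lim.
Qed.

(** Quadratic remainder estimates survive pointwise limits. Derivatives of limits and of integral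
    operators are therefore always obtained from such estimates, never by exchanging a limit with a
    derivative. *)
Lemma is_derive_quad (f : R -> R) (t l C d : R) : 0 < d ->
  (forall h, `|h| < d -> `|f (t + h) - f t - h * l| <= C * h ^+ 2) ->
  is_derive t 1 f l.
Proof.
move=> d0 H.
apply/is_derive_cvg/cvgrPdist_le => e e0.
near=> h.
have h0 : h != 0 by near: h; exact: nbhs_dnbhs_neq.
have hd : `|h| < d.
  by near: h; exact: dnbhs0_lt.
have he : `|h| < e / (`|C| + 1).
  near: h; apply: dnbhs0_lt.
  by rewrite divr_gt0// ltr_wpDl.
rewrite distrC (_ : _ - l = h^-1 * (f (t + h) - f t - h * l)); last first.
  by rewrite (addrC t); field.
rewrite normrM normfV ler_pdivrMl ?normr_gt0//.
apply: le_trans (H _ hd) _; rewrite -[h ^+ 2]real_normK ?num_real// expr2 mulrCA.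
rewrite ler_wpM2l//.
have C1 : 0 < `|C| + 1 by rewrite ltr_wpDl.
rewrite ltr_pdivlMr// mulrC in he.
apply: le_trans (ltW he); rewrite ler_wpM2r//; apply: le_trans (ler_norm C) _; lra.
Unshelve. all: by end_near. Qed.

Lemma mvt_abs (g dg : R -> R) (M a b : R) : (forall x : R, is_derive x 1 g (dg x)) ->
  (forall x, `|dg x| <= M) -> `|g b - g a| <= M * `|b - a|.
Proof.
move=> Hd HM.
wlog ab : a b / a <= b.
  move=> W; have [|/ltW] := leP a b; first exact: W.
  by move/W; rewrite distrC (distrC b).
have [c _ ->] := @MVT_segment R g dg a b ab (fun x _ => Hd x)
   (continuous_subspaceT (fun x => is_derive_continuous (Hd x))).
by rewrite normrM ler_wpM2r.
Qed.

Lemma taylor1_abs (g dg ddg : R -> R) (M a b : R) : (forall x : R, is_derive x 1 g (dg x)) ->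
  (forall x : R, is_derive x 1 dg (ddg x)) -> (forall x, `|ddg x| <= M) ->
  `|g b - g a - (b - a) * dg a| <= M * (b - a) ^+ 2.
Proof.
move=> Hd Hdd HM.
have M0 : 0 <= M by apply: le_trans (HM 0).
pose k x := g x - (x - a) * dg a.
have dk (x : R) : is_derive x 1 k (dg x - dg a).
  by apply: is_derive_eq; rewrite /GRing.scale/= subr0 mulr0 add0r mulr1.
have -> : g b - g a - (b - a) * dg a = k b - k a by rewrite /k; ring.
wlog ab : / a <= b.
  move=> W; have [|/ltW ba] := leP a b; first exact: W.
  have [c] := @MVT_segment R k _ b a ba (fun x _ => dk x)
     (continuous_subspaceT (fun x => is_derive_continuous (dk x))).
  rewrite in_itv/= => /andP[bc ca] E.
  rewrite distrC E normrM.
  have h := mvt_abs a c Hdd HM.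
  rewrite (_ : (b - a) ^+ 2 = (a - b) * (a - b)); last by ring.
  rewrite (ger0_norm (_ : 0 <= a - b)) ?subr_ge0// mulrA ler_wpM2r ?subr_ge0//.
  by apply: le_trans h _; rewrite ler_wpM2l// ler0_norm; lra.
have [c] := @MVT_segment R k _ a b ab (fun x _ => dk x)
   (continuous_subspaceT (fun x => is_derive_continuous (dk x))).
rewrite in_itv/= => /andP[ac cb] ->.
rewrite normrM.
have h := mvt_abs a c Hdd HM.
rewrite -real_normK ?num_real// expr2 mulrA ler_wpM2r//.
apply: le_trans h _; rewrite ler_wpM2l// !ger0_norm ?subr_ge0//; lra.
Qed.

End Calculus1D.

Section Bnd.
Variable R : realType.
Local Notation e2 := (@e2 R).
Implicit Types (f g : R * R -> R) (M N : R) (k : nat).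

(** One constant for f and all its iterated partial derivatives up to order k, so that estimates
    compose by arithmetic. Derivability is a separate clause because [pd] returns some value even
    where no derivative exists. *)
Fixpoint bnd k f M : Prop :=
  (forall x, `|f x| <= M) /\
  match k with
  | 0 => True
  | k'.+1 => forall i, (forall x, derivable (fun h : R => f (x + h *: e2 i)) 0 1) /\
                       bnd k' (pd (e2 i) f) M
  end.

Lemma ord2_ind (P : 'I_2 -> Prop) : P ord0 -> P (lift ord0 ord0) -> forall i, P i.
Proof.
by move=> P0 P1 [[|[|//]] h]; [move: P0|move: P1]; congr P; exact: val_inj.
Qed.

Lemma e2_shift1 (x : R * R) (h : R) : x + h *: e2 ord0 = (x.1 + h, x.2).
Proof.
case: x => a b; rewrite /e2/=.
have -> : (a, b) + h *: (1, 0) = (a + h * 1, b + h * 0) :> R * R by [].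
by rewrite mulr1 mulr0 addr0.
Qed.

Lemma e2_shift2 (x : R * R) (h : R) : x + h *: e2 (lift ord0 ord0) = (x.1, x.2 + h).
Proof.
case: x => a b; rewrite /e2/=.
have -> : (a, b) + h *: (0, 1) = (a + h * 0, b + h * 1) :> R * R by [].
by rewrite mulr1 mulr0 addr0.
Qed.

Lemma bnd_abs k f M : bnd k f M -> forall x, `|f x| <= M.
Proof. by case: k => [|k] []. Qed.

Lemma bnd_ge0 k f M : bnd k f M -> 0 <= M.
Proof. by move=> /bnd_abs /(_ 0); exact: le_trans. Qed.

Lemma bnd_pd k f M i : bnd k.+1 f M -> bnd k (pd (e2 i) f) M.
Proof. by move=> [_ /(_ i)[]]. Qed.

Lemma bnd_le k k' f M N : (k' <= k)%N -> M <= N -> bnd k f M -> bnd k' f N.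
Proof.
elim: k k' f => [|k IH] [|k'] f //= kk MN [fM H].
- by split => // x; exact: le_trans (fM x) MN.
- by split => // x; exact: le_trans (fM x) MN.
split=> [x|i]; first exact: le_trans (fM x) MN.
by have [? ?] := H i; split => //; exact: IH.
Qed.

Lemma pdE (v : R * R) f (x : R * R) (l : R) :
  is_derive (0 : R) 1 (fun h : R => f (x + h *: v)) l -> pd v f x = l.
Proof. by move=> h; rewrite /pd derive1E; exact: derive_val. Qed.

Lemma pd_derive k f M i : bnd k.+1 f M -> forall (x : R * R) (h : R),
  is_derive h 1 (fun h : R => f (x + h *: e2 i)) (pd (e2 i) f (x + h *: e2 i)).
Proof.
move=> [_ /(_ i)[df _]] x h.
have := df (x + h *: e2 i).
rewrite /pd derive1E.
set F := fun h0 : R => _; set G := fun h0 : R => _ => dF.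
have EG : G = (fun t => F (t - h)).
  apply/funext => t; rewrite /F /G; congr f; rewrite -addrA -scalerDl.
  by congr (_ + _ *: _); rewrite addrC subrK.
have dF' : is_derive (h - h) 1 F ('D_1 F 0) by rewrite subrr; exact: derivableP.
have dS : is_derive h 1 (fun t : R => t - h) 1 by apply: is_derive_eq; rewrite subr0.
have := @is_derive1_comp R F (fun t => t - h) h _ _ dF' dS.
by rewrite EG mulr1.
Qed.

Lemma bnd_pd_derive k f M i (x : R * R) : bnd k.+1 f M ->
  is_derive (0 : R) 1 (fun h : R => f (x + h *: e2 i)) (pd (e2 i) f x).
Proof.
by move=> H; have := pd_derive i H x 0; rewrite scale0r addr0.
Qed.

Lemma bndS k f M (d : 'I_2 -> R * R -> R) : (forall x, `|f x| <= M) ->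
  (forall i (x : R * R), is_derive (0 : R) 1 (fun h : R => f (x + h *: e2 i)) (d i x)) ->
  (forall i, bnd k (d i) M) -> bnd k.+1 f M.
Proof.
move=> fM fd dM; split=> // i; split=> [x|]; first exact: (@ex_derive _ _ _ _ _ _ _ (fd i x)).
have -> : pd (e2 i) f = d i by apply/funext => x; exact: pdE.
exact: dM.
Qed.

Lemma bndD k f g M N : bnd k f M -> bnd k g N -> bnd k (fun x => f x + g x) (M + N).
Proof.
elim: k f g => [|k IH] f g bf bg.
  split=> // x; apply: le_trans (ler_normD _ _) _; apply: lerD; [exact: (bnd_abs bf)|exact: (bnd_abs bg)].
apply: (@bndS _ _ _ (fun i x => pd (e2 i) f x + pd (e2 i) g x)).
- move=> x; apply: le_trans (ler_normD _ _) _; apply: lerD; [exact: (bnd_abs bf)|exact: (bnd_abs bg)].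
- move=> i x; have df := bnd_pd_derive i x bf; have dg := bnd_pd_derive i x bg.
  exact: is_deriveD.
- by move=> i; apply: IH; exact: bnd_pd.
Qed.

Lemma bnd_cst k (c : R) : bnd k (fun=> c) `|c|.
Proof.
have H0 : forall k, bnd k (fun=> 0) 0.
  elim=> [|k' IH]; first by split => // x; rewrite normr0.
  apply: (@bndS _ _ _ (fun _ _ => 0)) => // [x|i x]; first by rewrite normr0.
  exact: is_derive_cst.
case: k => [|k]; first by split.
apply: (@bndS _ _ _ (fun _ _ => 0)) => // [i x|i]; first exact: is_derive_cst.
exact: bnd_le (leqnn k) (normr_ge0 c) (H0 k).
Qed.

(** The Leibniz rule doubles the number of terms with each derivative. *)
Lemma bndM k f g M N : bnd k f M -> bnd k g N -> bnd k (fun x => f x * g x) (2 ^+ k * (M * N)).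
Proof.
elim: k f g M N => [|k IH] f g M N bf bg.
  split=> // x; rewrite mul1r normrM; apply: ler_pM => //; [exact: (bnd_abs bf)|exact: (bnd_abs bg)].
have MN : 0 <= M * N by rewrite mulr_ge0// ?(bnd_ge0 bf)// (bnd_ge0 bg).
apply: (@bndS _ _ _ (fun i x => f x * pd (e2 i) g x + g x * pd (e2 i) f x)).
- move=> x; rewrite normrM; apply: (@le_trans _ _ (M * N)).
    apply: ler_pM => //; [exact: (bnd_abs bf)|exact: (bnd_abs bg)].
  by rewrite ler_peMl// exprn_ege1// ler1n.
- move=> i x; have df := bnd_pd_derive i x bf; have dg := bnd_pd_derive i x bg.
  have H := @is_deriveM R _ (fun h : R => f (x + h *: e2 i)) (fun h : R => g (x + h *: e2 i)) 0 1 _ _ df dg.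
  by apply: (is_derive_eq H); rewrite !scale0r !addr0.
- move=> i; rewrite exprS -mulrA mulr_natl mulr2n.
  have kk : (k <= k.+1)%N by [].
  apply: bndD; first exact: IH (bnd_le kk (lexx _) bf) (bnd_pd i bg).
  by rewrite (mulrC M); apply: IH; [exact: bnd_le kk (lexx _) bg|exact: (bnd_pd i bf)].
Qed.

Lemma bndZ k f M (c : R) : bnd k f M -> bnd k (fun x => c * f x) (`|c| * M).
Proof.
elim: k f => [|k IH] f bf.
  split=> // x; rewrite normrM ler_wpM2l//; exact: (bnd_abs bf).
apply: (@bndS _ _ _ (fun i x => c * pd (e2 i) f x)).
- move=> x; rewrite normrM ler_wpM2l//; exact: (bnd_abs bf).
- move=> i x; have df := bnd_pd_derive i x bf.
  exact: is_deriveZ.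
- by move=> i; apply: IH; exact: bnd_pd.
Qed.

Lemma bndN k f M : bnd k f M -> bnd k (fun x => - f x) M.
Proof.
move=> /(bndZ (-1)); rewrite normrN1 mul1r.
by under eq_fun do rewrite mulN1r.
Qed.

Lemma bndB k f g M N : bnd k f M -> bnd k g N -> bnd k (fun x => f x - g x) (M + N).
Proof. by move=> bf bg; exact: bndD bf (bndN bg). Qed.

Lemma bnd_lip1 f M (x : R * R) (h : R) : bnd 1 f M -> `|f (x.1 + h, x.2) - f x| <= M * `|h|.
Proof.
move=> bf; have H := pd_derive ord0 bf x.
have := mvt_abs 0 h H (fun t => bnd_abs (bnd_pd ord0 bf) _).
by rewrite !e2_shift1 addr0 subr0 -surjective_pairing.
Qed.

Lemma bnd_lip2 f M (x : R * R) (h : R) : bnd 1 f M -> `|f (x.1, x.2 + h) - f x| <= M * `|h|.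
Proof.
move=> bf; have H := pd_derive (lift ord0 ord0) bf x.
have := mvt_abs 0 h H (fun t => bnd_abs (bnd_pd (lift ord0 ord0) bf) _).
by rewrite !e2_shift2 addr0 subr0 -surjective_pairing.
Qed.

Lemma bnd_lip f M (x y : R * R) : bnd 1 f M ->
  `|f y - f x| <= M * (`|y.1 - x.1| + `|y.2 - x.2|).
Proof.
move=> bf; rewrite -(subrKA (f (x.1, y.2))) (le_trans (ler_normD _ _))// mulrDr lerD//.
  have := bnd_lip1 (x.1, y.2) (y.1 - x.1) bf; rewrite /=.
  by rewrite (_ : x.1 + (y.1 - x.1) = y.1) -?surjective_pairing//; ring.
have := bnd_lip2 x (y.2 - x.2) bf.
by rewrite (_ : x.2 + (y.2 - x.2) = y.2)//; ring.
Qed.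

Lemma bnd_cont f M : bnd 1 f M -> continuous f.
Proof.
move=> bf x; apply/cvgrPdist_le => e e0.
have M0 := bnd_ge0 bf.
have d0 : 0 < e / (2 * M + 1) by rewrite divr_gt0//; lra.
apply/(@nbhs_ballP R (R * R)%type); exists (e / (2 * M + 1)) => //= y [/= h1 h2].
rewrite /ball/= in h1 h2.
rewrite distrC (le_trans (bnd_lip x y bf))// !(distrC _ x.1) !(distrC _ x.2).
apply: (@le_trans _ _ (M * (2 * (e / (2 * M + 1))))).
  by rewrite ler_wpM2l// mulr_natl mulr2n lerD// ltW.
rewrite !mulrA ler_pdivrMr; last by lra.
by nra.
Qed.

Lemma bnd_quad f M i (x : R * R) (h : R) : bnd 2 f M ->
  `|f (x + h *: e2 i) - f x - h * pd (e2 i) f x| <= M * h ^+ 2.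
Proof.
move=> b2; have := taylor1_abs 0 h (pd_derive i b2 x) (pd_derive i (bnd_pd i b2) x)
    (fun t => bnd_abs (bnd_pd i (bnd_pd i b2)) _).
by rewrite !scale0r !addr0 !subr0.
Qed.

Definition lin f x (y : R * R) : R :=
  pd (e2 ord0) f x * y.1 + pd (e2 (lift ord0 ord0)) f x * y.2.

Lemma bnd_taylor f M (x y : R * R) : bnd 2 f M ->
  `|f (x + y) - f x - lin f x y| <= 2 * M * enorm2 y ^+ 2.
Proof.
move=> bf; have M0 := bnd_ge0 bf.
have b1 : bnd 1 f M by apply: bnd_le bf.
have T1 := bnd_quad ord0 (x.1, x.2 + y.2) y.1 bf.
have T2 := bnd_quad (lift ord0 ord0) x y.2 bf.
rewrite e2_shift1 /= in T1; rewrite e2_shift2 in T2.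
have L := bnd_lip2 x y.2 (bnd_pd ord0 bf).
have E : x + y = (x.1 + y.1, x.2 + y.2) by [].
rewrite E enorm2_sq /lin.
(* The increment goes along one axis at a time; the last term corrects for the derivative in the
   first direction being taken at the displaced point. *)
have -> : f (x.1 + y.1, x.2 + y.2) - f x - (pd (e2 ord0) f x * y.1 + pd (e2 (lift ord0 ord0)) f x * y.2) =
 (f (x.1 + y.1, x.2 + y.2) - f (x.1, x.2 + y.2) - y.1 * pd (e2 ord0) f (x.1, x.2 + y.2)) +
 (f (x.1, x.2 + y.2) - f x - y.2 * pd (e2 (lift ord0 ord0)) f x) +
 y.1 * (pd (e2 ord0) f (x.1, x.2 + y.2) - pd (e2 ord0) f x) by ring.
apply: le_trans (ler_normD _ _) _.
apply: (@le_trans _ _ (M * y.1 ^+ 2 + M * y.2 ^+ 2 + `|y.1| * (M * `|y.2|))).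
  apply: lerD; first by apply: le_trans (ler_normD _ _) _; exact: lerD.
  by rewrite normrM ler_wpM2l.
rewrite -(real_normK (num_real y.1)) -(real_normK (num_real y.2)).
have := normr_ge0 y.1; have := normr_ge0 y.2.
move: (`|y.1|) (`|y.2|) => a b b0 a0.
have : 0 <= M * (a - b) ^+ 2 by rewrite mulr_ge0// sqr_ge0.
have : 0 <= M * (a + b) ^+ 2 by rewrite mulr_ge0// sqr_ge0.
have : 0 <= M * a ^+ 2 by rewrite mulr_ge0// sqr_ge0.
have : 0 <= M * b ^+ 2 by rewrite mulr_ge0// sqr_ge0.
nra.
Qed.

Lemma enorm2_sq_pair (a b : R) : enorm2 (a, b) ^+ 2 = a ^+ 2 + b ^+ 2.
Proof. exact: enorm2_sq. Qed.

(* The increment of f along the curve is its linear part plus a remainder r(h) with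
   |r(h)| <= 2M |increment|^2; since the increment is O(h), r is differentiable at 0 with derivative 0. *)
Lemma chain2 f M (a b : R -> R) (t da db : R) : bnd 2 f M ->
  is_derive t 1 a da -> is_derive t 1 b db ->
  is_derive t 1 (fun h => f (a h, b h)) (lin f (a t, b t) (da, db)).
Proof.
move=> bf Ha Hb; have M0 := bnd_ge0 bf.
pose p1 := pd (e2 ord0) f (a t, b t); pose p2 := pd (e2 (lift ord0 ord0)) f (a t, b t).
pose r h := f (a h, b h) - f (a t, b t) - (p1 * (a h - a t) + p2 * (b h - b t)).
have r_le h : `|r h| <= 2 * M * ((a h - a t) ^+ 2 + (b h - b t) ^+ 2).
  have := bnd_taylor (a t, b t) (a h - a t, b h - b t) bf.
  rewrite enorm2_sq_pair /r /lin /= (_ : (a t, b t) + _ = (a h, b h))//.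
  by rewrite -[LHS]/(a t + (a h - a t), b t + (b h - b t)) !subrKC.
have dr : is_derive t 1 r 0.
  have ht : (fun h : R => h + t) @ (0 : R)^' --> t.
    rewrite -[X in _ --> X]add0r; apply: cvgD; last exact: cvg_cst.
    exact: nbhs_dnbhs.
  have qa := (is_derive_cvg _ _ _).1 Ha; have qb := (is_derive_cvg _ _ _).1 Hb.
  have ca : (a (h + t) - a t) @[h --> 0^'] --> (0 : R).
    rewrite -[X in _ --> X](subrr (a t)).
    apply: cvgB; last exact: cvg_cst.
    have c0 := is_derive_continuous Ha.
    exact: (cvg_comp (fun h : R => h + t) _ ht c0).
  have cb : (b (h + t) - b t) @[h --> 0^'] --> (0 : R).
    rewrite -[X in _ --> X](subrr (b t)).
    apply: cvgB; last exact: cvg_cst.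
    have c0 := is_derive_continuous Hb.
    exact: (cvg_comp (fun h : R => h + t) _ ht c0).
  apply/is_derive_cvg.
  have rt : r t = 0 by rewrite /r !subrr !mulr0 addr0 subr0.
  apply: norm_cvg0.
  have up : (2 * M * (`|h^-1 * (a (h + t) - a t)| * `|a (h + t) - a t| +
               `|h^-1 * (b (h + t) - b t)| * `|b (h + t) - b t|)) @[h --> 0^'] --> (0 : R).
    rewrite -[X in _ --> X](mulr0 (2 * M)); apply: cvgM; first exact: cvg_cst.
    rewrite -[X in _ --> X](addr0 0); apply: cvgD.
      rewrite -[X in _ --> X](mulr0 (`|da|)); apply: cvgM; first exact: cvg_norm.
      by rewrite -[X in _ --> X](@normr0 _ R); exact: cvg_norm.
    rewrite -[X in _ --> X](mulr0 (`|db|)); apply: cvgM; first exact: cvg_norm.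
    by rewrite -[X in _ --> X](@normr0 _ R); exact: cvg_norm.
  apply: (squeeze_cvgr _ (cvg_cst 0) up); near=> h.
  rewrite normr_ge0 /= rt subr0 normrM.
  apply: le_trans (ler_wpM2l (normr_ge0 _) (r_le _)) _.
  rewrite -[(a _ - _) ^+ 2]real_normK ?num_real// -[(b _ - _) ^+ 2]real_normK ?num_real// !normrM.
  by apply: eq_ler; ring.
have -> : (fun h => f (a h, b h)) = (fun h => r h + (f (a t, b t) + (p1 * (a h - a t) + p2 * (b h - b t)))).
  by apply/funext => h; rewrite /r; ring.
by apply: is_derive_eq; rewrite /lin /GRing.scale/= -/p1 -/p2; ring.
Unshelve. all: by end_near. Qed.

Lemma bnd_iter k f M (w : seq 'I_2) : bnd (size w + k) f M -> bnd k (iter_pd e2 w f) M.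
Proof.
elim: w k => [|i w IH] k //= H.
by apply: bnd_pd; apply: IH; rewrite addnS.
Qed.

(** The space of functions with bounded derivatives of every order. Operators that lose finitely
    many derivatives map it to itself. *)
Definition Cb f := forall k, exists M, bnd k f M.

Lemma Cb_smooth2 f : Cb f -> smooth2 f.
Proof.
move=> Hf w x _; have [M bM] := Hf (size w + 1)%N.
have b1 := bnd_iter bM; split; first exact: bnd_cont b1 x.
by move=> i; apply: (@ex_derive _ _ _ _ _ _ _ (bnd_pd_derive i x b1)).
Qed.

End Bnd.

(* Unfolding iterated derivatives makes unification diverge. *)
Opaque pd.

(** * Symmetry of mixed derivatives *)

Section Schwarz.
Variable R : realType.
Local Notation e2 := (@e2 R).

Let mixed (f : R * R -> R) M i j (x : R * R) (h : R) : bnd 3 f M ->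
  `|f (x + h *: e2 i + h *: e2 j) - f (x + h *: e2 i) - f (x + h *: e2 j) + f x
     - h * (h * pd (e2 j) (pd (e2 i) f) x)| <= 2 * M * `|h| ^+ 3.
Proof.
move=> bf; have M0 := bnd_ge0 bf.
pose g t := f (x + h *: e2 j + t *: e2 i) - f (x + t *: e2 i).
pose dg t := pd (e2 i) f (x + h *: e2 j + t *: e2 i) - pd (e2 i) f (x + t *: e2 i).
pose ddg t := pd (e2 i) (pd (e2 i) f) (x + h *: e2 j + t *: e2 i) - pd (e2 i) (pd (e2 i) f) (x + t *: e2 i).
have Hg (t : R) : is_derive t 1 g (dg t).
  exact: (is_deriveB (pd_derive i bf (x + h *: e2 j) t) (pd_derive i bf x t)).
have Hdg (t : R) : is_derive t 1 dg (ddg t).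
  have d1 := pd_derive i (bnd_pd i bf) (x + h *: e2 j) t.
  have d2 := pd_derive i (bnd_pd i bf) x t.
  exact: is_deriveB.
have lipj (F : R * R -> R) (y : R * R) : bnd 1 F M -> `|F (y + h *: e2 j) - F y| <= M * `|h|.
  move=> bF; have := mvt_abs 0 h (pd_derive j bF y) (fun t => bnd_abs (bnd_pd j bF) _).
  by rewrite scale0r addr0 subr0.
have Bdd t : `|ddg t| <= M * `|h|.
  have := lipj _ (x + t *: e2 i) (bnd_pd i (bnd_pd i bf)).
  by rewrite /ddg -!addrA (addrC (t *: _)).
have T1 := taylor1_abs 0 h Hg Hdg Bdd.
have T2 : `|pd (e2 i) f (x + h *: e2 j) - pd (e2 i) f x - h * pd (e2 j) (pd (e2 i) f) x| <= M * h ^+ 2.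
  exact: bnd_quad (bnd_pd i bf).
have -> : f (x + h *: e2 i + h *: e2 j) - f (x + h *: e2 i) - f (x + h *: e2 j) + f x
     - h * (h * pd (e2 j) (pd (e2 i) f) x) = (g h - g 0 - (h - 0) * dg 0) +
   h * (pd (e2 i) f (x + h *: e2 j) - pd (e2 i) f x - h * pd (e2 j) (pd (e2 i) f) x).
  rewrite /g /dg !scale0r !addr0 subr0 (addrAC x).
  by ring.
apply: le_trans (ler_normD _ _) _.
have -> : 2 * M * `|h| ^+ 3 = M * `|h| * (h - 0) ^+ 2 + `|h| * (M * h ^+ 2).
  by rewrite subr0 -(real_normK (num_real h)); ring.
by apply: lerD => //; rewrite normrM ler_wpM2l.
Qed.

(** The second difference over a square of side h is symmetric in the two directions and lies within
    2 M h^3 of h^2 times either mixed derivative; dividing by h^2 leaves 4 M h. *)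
Lemma schwarz (f : R * R -> R) M i j : bnd 3 f M ->
  pd (e2 j) (pd (e2 i) f) = pd (e2 i) (pd (e2 j) f).
Proof.
move=> bf; apply/funext => x; have M0 := bnd_ge0 bf.
set p := pd _ _ x; set q := pd _ _ x.
apply/eqP; rewrite -subr_eq0 -normr_le0; apply/ler_addgt0Pr => e e0; rewrite add0r.
pose h := e / (4 * M + 1).
have P0 : 0 < 4 * M + 1 by lra.
have h0 : 0 < h by rewrite divr_gt0.
have H1 := mixed i j x h bf; have H2 := mixed j i x h bf.
rewrite -/p -/q (addrAC x) in H1 H2.
have : `|h * (h * p) - h * (h * q)| <= 4 * M * h ^+ 3.
  rewrite (gtr0_norm h0) in H1 H2.
  move: H1 H2; rewrite (addrAC x (h *: e2 j)); set a := f _; set b := f _; set c := f _; set d := f _ => H1 H2.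
  have -> : h * (h * p) - h * (h * q) = (a - c - b + d - h * (h * q)) - (a - b - c + d - h * (h * p)) by ring.
  apply: le_trans (ler_normB _ _) _; apply: le_trans (lerD H2 H1) _.
  by apply: eq_ler; ring.
have -> : h * (h * p) - h * (h * q) = (p - q) * h ^+ 2 by ring.
rewrite normrM (ger0_norm (sqr_ge0 h)) => H'.
have H : `|p - q| <= 4 * M * h.
  rewrite -(ler_pM2r (exprn_gt0 2 h0)); apply: le_trans H' _.
  by apply: eq_ler; ring.
apply: le_trans H _; rewrite /h mulrA ler_pdivrMr//.
by rewrite mulrC ler_wpM2l ?(ltW e0)// lerDl.
Qed.

End Schwarz.

(** * The fractional Laplacian on smooth bounded functions *)

Section Admissible.
Variable R : realType.
Local Notation e2 := (@e2 R).
Implicit Types (f g : R * R -> R) (T : (R * R -> R) -> R * R -> R).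

(* The last clause makes T commute with the partial derivatives. *)
Definition adm T (K : R) : Prop :=
  [/\ (forall f g M N (a : R) x, bnd 2 f M -> bnd 2 g N ->
         T (fun y => f y + a * g y) x = T f x + a * T g x),
      (forall f M x, bnd 2 f M -> `|T f x| <= K * M) &
      (forall f M i x (h : R), bnd 4 f M ->
         `|T f (x + h *: e2 i) - T f x - h * T (pd (e2 i) f) x| <= K * M * h ^+ 2)].

Lemma adm_derive T K f M i (x : R * R) : adm T K -> bnd 4 f M ->
  is_derive (0 : R) 1 (fun h : R => T f (x + h *: e2 i)) (T (pd (e2 i) f) x).
Proof.
move=> [_ _ H] bf; apply: (is_derive_quad (C := K * M) ltr01) => h _.
by rewrite add0r scale0r addr0; exact: H.
Qed.

Lemma adm_pd T K f M i : adm T K -> bnd 4 f M -> pd (e2 i) (T f) = T (pd (e2 i) f).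
Proof. by move=> HT bf; apply/funext => x; apply: pdE; exact: adm_derive HT bf. Qed.

(** Bounding T takes two derivatives of its argument and differentiating T f takes four, so k
    derivatives of T f are controlled by k + 4 of f. *)
Lemma adm_bnd T K k f M : adm T K -> bnd (k + 4) f M -> bnd k (T f) (K * M).
Proof.
move=> HT; elim: k f => [|k IH] f bf.
  by split=> // x; case: HT => _ H _; apply: H; exact: bnd_le bf.
have b4 : bnd 4 f M by apply: bnd_le bf; rewrite ?leq_addl.
apply: (@bndS _ _ _ _ (fun i => T (pd (e2 i) f))).
- by move=> x; case: HT => _ H _; apply: H; exact: bnd_le b4.
- by move=> i x; exact: adm_derive HT b4.
- by move=> i; apply: IH; exact: bnd_pd.
Qed.

Lemma cvg_le_cst (u : nat -> R) (l c : R) : u n @[n --> \oo] --> l ->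
  (forall n, u n <= c) -> l <= c.
Proof.
by move=> ul uc; apply: (cvgr_to_le ul); exact: nearW.
Qed.

(** All three clauses of [adm] are identities or non-strict inequalities between values at finitely
    many points, with the same K for every n, and so pass to pointwise limits. *)
Lemma adm_lim (Tn : nat -> (R * R -> R) -> R * R -> R) T K :
  (forall n, adm (Tn n) K) ->
  (forall f M x, bnd 2 f M -> Tn n f x @[n --> \oo] --> T f x) -> adm T K.
Proof.
move=> HT Hl; split.
- move=> f g M N a x bf bg.
  have bfg : bnd 2 (fun y => f y + a * g y) (M + `|a| * N) by apply: bndD => //; exact: bndZ.
  have := Hl _ _ x bfg; under eq_fun => n do have [/(_ f g M N a x bf bg) -> _ _] := HT n.
  move/cvg_lim => <- //; apply: cvg_lim => //.
  by apply: cvgD; [exact: (Hl _ _ _ bf)|apply: cvgM; [exact: cvg_cst|exact: (Hl _ _ _ bg)]].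
- move=> f M x bf; have l := Hl _ _ x bf.
  apply: (cvg_le_cst (cvg_norm l)) => n.
  by have [_ H _] := HT n; exact: H.
- move=> f M i x h bf.
  have b2 : bnd 2 f M by apply: bnd_le bf.
  have b2' : bnd 2 (pd (e2 i) f) M by apply: bnd_le (bnd_pd i bf).
  have l : Tn n f (x + h *: e2 i) - Tn n f x - h * Tn n (pd (e2 i) f) x @[n --> \oo] -->
     T f (x + h *: e2 i) - T f x - h * T (pd (e2 i) f) x.
    apply: cvgB; first by apply: cvgB; exact: (Hl _ _ _ b2).
    by apply: cvgM; [exact: cvg_cst|exact: (Hl _ _ _ b2')].
  apply: (cvg_le_cst (cvg_norm l)) => n.
  by have [_ _ H] := HT n; exact: H.
Qed.

End Admissible.

(** * The truncated fractional Laplacian as an operator *)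

Section FracOp.
Variable R : realType.
Local Notation e2 := (@e2 R).
Local Notation mR := (measurableTypeR R).
Variable s : R.
Hypothesis s01 : 0 < s < 1.
Let s0 : 0 < s. Proof. by case/andP: s01. Qed.
Let s1 : s < 1. Proof. by case/andP: s01. Qed.
Implicit Types (f g : R * R -> R) (M : R).

Lemma Gamma_ge0 (z : R) : 0 <= Gamma z.
Proof.
apply: Rintegral_ge0 => t _.
by rewrite mulr_ge0 ?powR_ge0 ?expR_ge0.
Qed.

Lemma cfrac_ge0 : 0 <= cfrac s.
Proof.
by rewrite /cfrac divr_ge0// !mulr_ge0 ?powR_ge0 ?Gamma_ge0 ?pi_ge0// ltW.
Qed.

(** The halving is the one produced by symmetrisation in [fraclap_integral]. *)
Definition c0 : R := cfrac s / 2.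
Lemma c0_ge0 : 0 <= c0. Proof. by rewrite divr_ge0// cfrac_ge0. Qed.

Lemma sdiff_quad f M x z : bnd 2 f M -> `|sdiff f x z| <= 4 * M * enorm2 z ^+ 2.
Proof.
move=> bf; have T1 := bnd_taylor x z bf; have T2 := bnd_taylor x (- z) bf.
rewrite enorm2N in T2.
have -> : sdiff f x z = - (f (x + z) - f x - lin f x z) - (f (x - z) - f x - lin f x (- z)).
  by rewrite /sdiff /lin /=; ring.
apply: le_trans (ler_normB _ _) _; rewrite normrN.
by apply: le_trans (lerD T1 T2) _; apply: eq_ler; ring.
Qed.

Lemma sdiff_bnd k f M x z : bnd k f M -> `|sdiff f x z| <= 4 * M.
Proof.
move=> bf; rewrite /sdiff.
have h1 := bnd_abs bf x; have h2 := bnd_abs bf (x + z); have h3 := bnd_abs bf (x - z).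
apply: le_trans (ler_normB _ _) _; have := ler_normB (2 * f x) (f (x + z)).
rewrite normrM ger0_norm// => h4; lra.
Qed.

Lemma measurable_sdiff_bnd f M x : bnd 1 f M ->
  measurable_fun setT (sdiff f x : mR * mR -> mR).
Proof. by move=> bf; apply: measurable_sdiff; exact: bnd_cont bf. Qed.

Definition Le (e : R) f (x : R * R) : R := c0 * Ik s e (sdiff f x).

(** The remainder in h is governed by the second derivative of f along e_i, whose second difference
    in z is both O(|z|^2) and bounded. Integrating against the kernel keeps the factor h^2; this is
    why four derivatives are asked for. *)
Lemma sdiff_taylor f M i (x z : R * R) (h : R) : bnd 4 f M ->
  `|sdiff f (x + h *: e2 i) z - sdiff f x z - h * sdiff (pd (e2 i) f) x z|
    <= 4 * M * h ^+ 2 * enorm2 z ^+ 2 /\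
  `|sdiff f (x + h *: e2 i) z - sdiff f x z - h * sdiff (pd (e2 i) f) x z|
    <= 4 * M * h ^+ 2.
Proof.
move=> bf.
have D (F : R * R -> R) k : bnd k.+1 F M -> forall t : R, is_derive t 1
    (fun t : R => sdiff F (x + t *: e2 i) z) (sdiff (pd (e2 i) F) (x + t *: e2 i) z).
  move=> bF t; rewrite /sdiff.
  have d0 := pd_derive i bF x t.
  have d1 := pd_derive i bF (x + z) t; have d2 := pd_derive i bF (x - z) t.
  have E (w : R * R) (r : R) : x + r *: e2 i + w = x + w + r *: e2 i by rewrite addrAC.
  rewrite !E; under eq_fun do rewrite !E.
  by apply: is_derive_eq; rewrite /GRing.scale/=; ring.
have H := taylor1_abs (M := _) 0 h (D _ _ bf) (D _ _ (bnd_pd i bf)).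
split.
  have := H (4 * M * enorm2 z ^+ 2) (fun t => sdiff_quad _ _ (bnd_pd i (bnd_pd i bf))).
  by rewrite !scale0r !addr0 !subr0 mulrAC.
have := H (4 * M) (fun t => sdiff_bnd _ _ (bnd_pd i (bnd_pd i bf))).
by rewrite !scale0r !addr0 !subr0.
Qed.

Let Wlin f g (a : R) x : sdiff (fun y => f y + a * g y) x = (fun z => sdiff f x z + a * sdiff g x z).
Proof. by apply/funext => z; rewrite /sdiff; ring. Qed.

Lemma Le_lin e f g M N (a : R) x : 0 < e -> bnd 1 f M -> bnd 1 g N ->
  Le e (fun y => f y + a * g y) x = Le e f x + a * Le e g x.
Proof.
move=> e0 bf bg; rewrite /Le Wlin.
have mf := measurable_sdiff_bnd x bf; have mg := measurable_sdiff_bnd x bg.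
have Bf := (fun z => sdiff_bnd x z bf); have Bg := (fun z => sdiff_bnd x z bg).
rewrite (IkD s01 e0 mf Bf (w' := fun z => a * sdiff g x z) (B' := `|a| * (4 * N))).
- by rewrite (IkZ s01 a e0 mg Bg); ring.
- by apply: measurable_funM.
- by move=> z; rewrite normrM ler_wpM2l.
Qed.

(** [KL] results from splitting at radius 1 and bounds all truncations e <= 1 at once. [KD r]
    measures the annulus between two truncation radii e <= r and vanishes with r because s < 1. *)
Definition KL : R := c0 * (4 * Knear s + 4 * Kfar s).
Definition KD (r : R) : R := c0 * (4 * (Knear s * r `^ (2 - 2 * s))).

Lemma KL_ge0 : 0 <= KL.
Proof. by rewrite mulr_ge0 ?c0_ge0// addr_ge0// mulr_ge0// ?Knear_ge0// Kfar_ge0. Qed.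

Let W3 e f M i x (h : R) : 0 < e -> bnd 4 f M ->
  Le e f (x + h *: e2 i) - Le e f x - h * Le e (pd (e2 i) f) x =
  c0 * Ik s e (fun z => sdiff f (x + h *: e2 i) z - sdiff f x z - h * sdiff (pd (e2 i) f) x z)
  /\ measurable_fun setT ((fun z => sdiff f (x + h *: e2 i) z - sdiff f x z - h * sdiff (pd (e2 i) f) x z)
        : mR * mR -> mR).
Proof.
move=> e0 bf.
have b1 : bnd 1 f M by apply: bnd_le bf.
have b1' : bnd 1 (pd (e2 i) f) M by apply: bnd_le (bnd_pd i bf).
set w1 := sdiff f (x + h *: e2 i); set w2 := sdiff f x; set w3 := sdiff (pd (e2 i) f) x.
have m1 := measurable_sdiff_bnd (x + h *: e2 i) b1; have m2 := measurable_sdiff_bnd x b1.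
have m3 := measurable_sdiff_bnd x b1'.
have B1 := (fun z => sdiff_bnd (x + h *: e2 i) z b1); have B2 := (fun z => sdiff_bnd x z b1).
have B3 := (fun z => sdiff_bnd x z b1').
have m2' : measurable_fun setT ((fun z => -1 * w2 z) : mR * mR -> mR) by apply: measurable_funM.
have m3' : measurable_fun setT ((fun z => - h * w3 z) : mR * mR -> mR) by apply: measurable_funM.
have m12 : measurable_fun setT ((fun z => w1 z + -1 * w2 z) : mR * mR -> mR) by apply: measurable_funD.
have B2' z : `|-1 * w2 z| <= 4 * M by rewrite mulN1r normrN.
have B3' z : `|- h * w3 z| <= `|h| * (4 * M) by rewrite normrM normrN ler_wpM2l.
have B12 z : `|w1 z + -1 * w2 z| <= 4 * M + 4 * M by apply: le_trans (ler_normD _ _) _; rewrite lerD.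
have E : (fun z => w1 z - w2 z - h * w3 z) = (fun z => (w1 z + -1 * w2 z) + - h * w3 z).
  by apply/funext => z; ring.
rewrite E; split; last by apply: measurable_funD.
rewrite (IkD s01 e0 m12 B12 m3' B3') (IkD s01 e0 m1 B1 m2' B2') (IkZ s01 _ e0 m2 B2) (IkZ s01 _ e0 m3 B3).
by rewrite /Le -/w1 -/w2 -/w3; ring.
Qed.

Lemma Le_adm e : 0 < e -> e <= 1 -> adm (Le e) KL.
Proof.
move=> e0 e1; split.
- by move=> f g M N a x bf bg; apply: Le_lin => //; [apply: bnd_le bf|apply: bnd_le bg].
- move=> f M x bf; have b1 : bnd 1 f M by apply: bnd_le bf.
  have M0 := bnd_ge0 bf.
  have := Ik_abs_le s01 e0 e1 (measurable_sdiff_bnd x b1) (fun z => sdiff_quad x z bf)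
    (fun z => sdiff_bnd x z b1).
  rewrite !powR1 !mulr1 => /(_ (mulr_ge0 (ler0n _ 4) M0)) H.
  rewrite /Le /KL normrM ger0_norm ?c0_ge0// -mulrA ler_wpM2l ?c0_ge0//.
  by apply: le_trans H _; apply: eq_ler; ring.
- move=> f M i x h bf; have M0 := bnd_ge0 bf.
  have [-> mw] := W3 i x h e0 bf.
  have := Ik_abs_le s01 e0 e1 mw (fun z => (sdiff_taylor i x z h bf).1) (fun z => (sdiff_taylor i x z h bf).2).
  rewrite !powR1 !mulr1 => /(_ (mulr_ge0 (mulr_ge0 (ler0n _ 4) M0) (sqr_ge0 h))) H.
  rewrite normrM (ger0_norm c0_ge0).
  have -> : KL * M * h ^+ 2 = c0 * (4 * M * h ^+ 2 * Knear s + 4 * M * h ^+ 2 * Kfar s) by rewrite /KL; ring.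
  by rewrite ler_wpM2l ?c0_ge0.
Qed.

Lemma LeB_adm e r : 0 < e -> e <= r -> adm (fun f x => Le e f x - Le r f x) (KD r).
Proof.
move=> e0 er; have r0 : 0 < r by apply: lt_le_trans er.
split.
- move=> f g M N a x bf bg.
  have b1 : bnd 1 f M by apply: bnd_le bf.
  have b1' : bnd 1 g N by apply: bnd_le bg.
  by rewrite (Le_lin _ _ e0 b1 b1') (Le_lin _ _ r0 b1 b1'); ring.
- move=> f M x bf; have b1 : bnd 1 f M by apply: bnd_le bf.
  have M0 := bnd_ge0 bf.
  have H := Ik_diff s01 e0 er (measurable_sdiff_bnd x b1) (fun z => sdiff_quad x z bf)
    (fun z => sdiff_bnd x z b1) (mulr_ge0 (ler0n _ 4) M0).
  rewrite /Le -mulrBr normrM ger0_norm ?c0_ge0// /KD -mulrA ler_wpM2l ?c0_ge0//.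
  by apply: le_trans H _; apply: eq_ler; ring.
- move=> f M i x h bf; have M0 := bnd_ge0 bf.
  have [E1 mw] := W3 i x h e0 bf; have [E2 _] := W3 i x h r0 bf.
  have -> : Le e f (x + h *: e2 i) - Le r f (x + h *: e2 i) - (Le e f x - Le r f x) -
     h * (Le e (pd (e2 i) f) x - Le r (pd (e2 i) f) x) =
   (Le e f (x + h *: e2 i) - Le e f x - h * Le e (pd (e2 i) f) x) -
   (Le r f (x + h *: e2 i) - Le r f x - h * Le r (pd (e2 i) f) x) by ring.
  rewrite E1 E2 -mulrBr normrM (ger0_norm c0_ge0).
  have -> : KD r * M * h ^+ 2 = c0 * (4 * M * h ^+ 2 * (Knear s * r `^ (2 - 2 * s))) by rewrite /KD; ring.
  rewrite ler_wpM2l ?c0_ge0//.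
  have H := Ik_diff s01 e0 er mw (fun z => (sdiff_taylor i x z h bf).1) (fun z => (sdiff_taylor i x z h bf).2)
    (mulr_ge0 (mulr_ge0 (ler0n _ 4) M0) (sqr_ge0 h)).
  exact: H.
Qed.

End FracOp.

Section Limits.
Variable R : realType.

Lemma cauchy_bound (u ep : nat -> R) : ep n @[n --> \oo] --> (0 : R) ->
  (forall n m, (n <= m)%N -> `|u m - u n| <= ep n) ->
  cvg (u n @[n --> \oo]) /\ forall n, `|lim (u n @[n --> \oo]) - u n| <= ep n.
Proof.
move=> ep0 H.
have C : cvg (u n @[n --> \oo]).
  apply/cauchy_cvgP; apply: cauchy_exP => e e0.
  have [n _ Hn] := cvgr_lt _ ep0 _ e0.
  exists (u n); exists n => // m /= nm.
  by rewrite /ball/= distrC (le_lt_trans (H _ _ nm))// Hn/=.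
split=> // n.
have L : `|u m - u n| @[m --> \oo] --> `|lim (u n @[n --> \oo]) - u n|.
  by apply: cvg_norm; apply: cvgB => //; exact: cvg_cst.
apply: (cvgr_to_le L); exists n => // m /= nm; exact: H.
Qed.

End Limits.

Section CbTheory.
Variable R : realType.
Local Notation e2 := (@e2 R).
Implicit Types (f g : R * R -> R) (M : R).

Lemma Cb_pd f i : Cb f -> Cb (pd (e2 i) f).
Proof. by move=> H k; have [M bM] := H k.+1; exists M; exact: bnd_pd. Qed.

Lemma CbD f g : Cb f -> Cb g -> Cb (fun x => f x + g x).
Proof. by move=> Hf Hg k; have [M bf] := Hf k; have [N bg] := Hg k; exists (M + N); exact: bndD. Qed.

Lemma CbM f g : Cb f -> Cb g -> Cb (fun x => f x * g x).
Proof. by move=> Hf Hg k; have [M bf] := Hf k; have [N bg] := Hg k; eexists; exact: bndM bf bg. Qed.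

Lemma Cb_cst (c : R) : Cb (fun=> c).
Proof. by move=> k; exists `|c|; exact: bnd_cst. Qed.

Lemma CbZ f (c : R) : Cb f -> Cb (fun x => c * f x).
Proof. by move=> Hf; exact: (CbM (Cb_cst c) Hf). Qed.

Lemma CbB f g : Cb f -> Cb g -> Cb (fun x => f x - g x).
Proof.
move=> Hf Hg; have := CbD Hf (CbZ (-1) Hg).
by under eq_fun do rewrite mulN1r.
Qed.

Lemma Cb_derive f i (x : R * R) : Cb f ->
  is_derive (0 : R) 1 (fun h : R => f (x + h *: e2 i)) (pd (e2 i) f x).
Proof. by move=> /(_ 1%N)[M bf]; exact: bnd_pd_derive bf. Qed.

Lemma pdD f g i : Cb f -> Cb g -> pd (e2 i) (fun x => f x + g x) = (fun x => pd (e2 i) f x + pd (e2 i) g x).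
Proof.
move=> Hf Hg; apply/funext => x; apply: pdE.
by have df := Cb_derive i x Hf; have dg := Cb_derive i x Hg; exact: is_deriveD.
Qed.

Lemma pdZ f (c : R) i : Cb f -> pd (e2 i) (fun x => c * f x) = (fun x => c * pd (e2 i) f x).
Proof.
move=> Hf; apply/funext => x; apply: pdE.
by have df := Cb_derive i x Hf; exact: is_deriveZ.
Qed.

Lemma pdB f g i : Cb f -> Cb g -> pd (e2 i) (fun x => f x - g x) = (fun x => pd (e2 i) f x - pd (e2 i) g x).
Proof.
move=> Hf Hg; apply/funext => x; apply: pdE.
by have df := Cb_derive i x Hf; have dg := Cb_derive i x Hg; exact: is_deriveB.
Qed.

Lemma pdM f g i : Cb f -> Cb g ->
  pd (e2 i) (fun x => f x * g x) = (fun x => f x * pd (e2 i) g x + g x * pd (e2 i) f x).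
Proof.
move=> Hf Hg; apply/funext => x; apply: pdE.
have df := Cb_derive i x Hf; have dg := Cb_derive i x Hg.
have H := @is_deriveM R _ (fun h : R => f (x + h *: e2 i)) (fun h : R => g (x + h *: e2 i)) 0 1 _ _ df dg.
by apply: (is_derive_eq H); rewrite !scale0r !addr0.
Qed.

Lemma bnd_step k f M : Cb f -> (forall x, `|f x| <= M) ->
  (forall i, bnd k (pd (e2 i) f) M) -> bnd k.+1 f M.
Proof.
move=> Hf H0 H; apply: (@bndS _ _ _ _ (fun i => pd (e2 i) f)); [exact: H0| |exact: H].
by move=> i x; exact: Cb_derive.
Qed.

Lemma adm_Cb T K f : adm T K -> Cb f -> Cb (T f).
Proof. by move=> HT Hf k; have [M bf] := Hf (k + 4)%N; eexists; exact: adm_bnd HT bf. Qed.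

End CbTheory.

(** * Removing the truncation; diffusion steps *)

Section FracLap.
Variable R : realType.
Local Notation e2 := (@e2 R).
Local Notation mR := (measurableTypeR R).
Variable s : R.
Hypothesis s01 : 0 < s < 1.
Let s0 : 0 < s. Proof. by case/andP: s01. Qed.
Let s1 : s < 1. Proof. by case/andP: s01. Qed.
Implicit Types (f g : R * R -> R) (M : R).

Let ee (n : nat) : R := n.+1%:R^-1.
Let ee0 n : 0 < ee n. Proof. by rewrite invr_gt0. Qed.
Let ee1 n : ee n <= 1. Proof. by rewrite invf_le1// ler1n. Qed.
Let ee_le n m : (n <= m)%N -> ee m <= ee n.
Proof. by move=> nm; rewrite lef_pV2 ?posrE// ler_nat. Qed.

Definition Lop f (x : R * R) : R := lim (Le s (ee n) f x @[n --> \oo]).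

Lemma KD_cvg0 : KD s r @[r --> 0^'+] --> (0 : R).
Proof.
rewrite /KD -[X in _ --> X](mulr0 (c0 s)); apply: cvgM; first exact: cvg_cst.
rewrite -[X in _ --> X](mulr0 4); apply: cvgM; first exact: cvg_cst.
rewrite -[X in _ --> X](mulr0 (Knear s)); apply: cvgM; first exact: cvg_cst.
by apply: powR_cvg0; have := s1; lra.
Qed.

Let KDee : KD s (ee n) @[n --> \oo] --> (0 : R).
Proof.
apply: ((cvg_at_rightP (KD s) 0 0).1 KD_cvg0); split; first exact: ee0.
exact: cvg_harmonic.
Qed.

Let Lop_spec f M x : bnd 2 f M -> cvg (Le s (ee n) f x @[n --> \oo]) /\
  forall n, `|Lop f x - Le s (ee n) f x| <= KD s (ee n) * M.
Proof.
move=> bf; apply: (@cauchy_bound R (fun n => Le s (ee n) f x) (fun n => KD s (ee n) * M)).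
  by rewrite -[X in _ --> X](mul0r M); apply: cvgM; [exact: KDee|exact: cvg_cst].
by move=> n m nm; have [_ H _] := LeB_adm s01 (ee0 m) (ee_le nm); exact: H.
Qed.

Lemma Lop_adm : adm Lop (KL s).
Proof.
apply: (@adm_lim R (fun n => Le s (ee n))); first by move=> n; exact: Le_adm.
by move=> f M x bf; have [] := Lop_spec x bf.
Qed.

Lemma LopB_adm r : 0 < r -> adm (fun f x => Lop f x - Le s r f x) (KD s r).
Proof.
move=> r0.
(* The minimum keeps every radius below r, as [LeB_adm] requires, and equals [ee n] for large n. *)
apply: (@adm_lim R (fun n f x => Le s (Num.min (ee n) r) f x - Le s r f x)) => [n|f M x bf].
  by apply: LeB_adm => //; [rewrite lt_min ee0 r0|rewrite ge_min lexx orbT].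
apply: cvgB; last exact: cvg_cst.
have [C _] := Lop_spec x bf; apply: cvg_trans C; apply: near_eq_cvg.
have h : (ee n @[n --> \oo] --> (0 : R)) by exact: cvg_harmonic.
near=> n; rewrite min_l//; apply: ltW; near: n; exact: (cvgr_lt _ h _ r0).
Unshelve. all: by end_near. Qed.

(** [Lop] is a limit along the radii 1/(n+1) only; the error bound [KD s eps] of [LopB_adm] holds
    for every radius and upgrades it to a limit in eps. *)
Lemma fraclap_Lop f M x : bnd 2 f M -> fraclap_at s f x (Lop f x).
Proof.
move=> bf; have b1 : bnd 1 f M by apply: bnd_le bf.
have FI eps (e0 : 0 < eps) := @fraclap_integral R s s01 f M x eps (bnd_cont b1) (bnd_abs bf) e0.
split; first by move=> eps e0; have [] := FI eps e0.
have H (eps : R) : 0 < eps -> `|Lop f x - Le s eps f x| <= KD s eps * M.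
  by move=> e0; have [_ + _] := LopB_adm e0; exact.
apply/cvgrPdist_le => d d0.
have KM : KD s eps * M @[eps --> 0^'+] --> (0 : R).
  by rewrite -[X in _ --> X](mul0r M); apply: cvgM; [exact: KD_cvg0|exact: cvg_cst].
near=> eps.
have e0 : 0 < eps by near: eps; exact: nbhs_right_gt.
have [_ ->] := FI eps e0.
have := H eps e0; rewrite /Le /c0 -mulrA => h; apply: le_trans h _.
by apply: ltW; near: eps; exact: (cvgr_lt _ KM _ d0).
Unshelve. all: by end_near. Qed.

(* When t times the total jump rate is at most 1, this is a convex average of translates of f. *)
Definition Qop (t e : R) f (x : R * R) : R := f x - t * Le s e f x.

Lemma Qop_abs t e f M k : 0 < e -> 0 <= t -> 2 * c0 s * t * (Kfar s * e `^ (- (2 * s))) <= 1 ->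
  bnd 1 f k -> (forall x, `|f x| <= M) -> forall x, `|Qop t e f x| <= M.
Proof.
move=> e_gt0 t0 H bf fM x.
have mw := measurable_sdiff_bnd x bf; have Bw := (fun z => sdiff_bnd x z bf).
have fM1 y : f y <= M by apply: le_trans (fM y); exact: ler_norm.
have fM2 y : - M <= f y by rewrite lerNl; apply: le_trans (fM y); rewrite -normrN ler_norm.
have c := c0_ge0 s01.
set nu := Kfar s * e `^ (- (2 * s)) in H *.
have nu0 : 0 <= nu by rewrite mulr_ge0 ?powR_ge0// Kfar_ge0.
have U : Ik s e (sdiff f x) <= 2 * (f x + M) * nu.
  apply: (Ik_le_far s01 e_gt0 _ mw Bw).
    by rewrite mulr_ge0//; have := fM2 x; lra.
  by move=> z; rewrite /sdiff; have := fM2 (x + z); have := fM2 (x - z); lra.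
have V : - Ik s e (sdiff f x) <= 2 * (M - f x) * nu.
  rewrite -mulN1r -(IkZ s01 (-1) e_gt0 mw Bw).
  apply: (Ik_le_far (B0 := 4 * k) s01 e_gt0).
  - by rewrite mulr_ge0//; have := fM1 x; lra.
  - by apply: measurable_funM.
  - by move=> z; rewrite mulN1r normrN.
  - by move=> z; rewrite /sdiff; have := fM1 (x + z); have := fM1 (x - z); lra.
have tc : 0 <= t * c0 s by rewrite mulr_ge0.
have U' := ler_wpM2l tc U; have V' := ler_wpM2l tc V.
(* After U and V are inserted, these products are lower bounds for the distances of [Qop t e f x]
   from - M and from M. *)
have h1 : (1 - 2 * c0 s * t * nu) * (f x + M) >= 0.
  by rewrite mulr_ge0//; [lra|have := fM2 x; lra].
have h2 : (1 - 2 * c0 s * t * nu) * (M - f x) >= 0.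
  by rewrite mulr_ge0//; [lra|have := fM1 x; lra].
rewrite /Qop /Le ler_norml; apply/andP; split; nra.
Qed.

Lemma Qop_Cb t e f : 0 < e -> e <= 1 -> Cb f -> Cb (Qop t e f).
Proof. by move=> ? ? Hf; apply: CbB => //; apply: CbZ; apply: adm_Cb Hf; exact: Le_adm. Qed.

Lemma Qop_pd t e f i : 0 < e -> e <= 1 -> Cb f -> pd (e2 i) (Qop t e f) = Qop t e (pd (e2 i) f).
Proof.
move=> e_gt0 e1 Hf; have HL := Le_adm s01 e_gt0 e1; have HCL := adm_Cb HL Hf.
have [N bf] := Hf 4%N.
by rewrite /Qop pdB//; [rewrite pdZ// (adm_pd i HL bf)|exact: CbZ].
Qed.

Lemma Qop_bnd t e k f M : 0 < e -> e <= 1 -> 0 <= t ->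
  2 * c0 s * t * (Kfar s * e `^ (- (2 * s))) <= 1 -> Cb f -> bnd k f M ->
  bnd k (Qop t e f) M.
Proof.
move=> e_gt0 e1 t0 H.
elim: k f => [|k IH] f Hf bf; have [N b1] := Hf 1%N.
  by split=> // x; apply: (Qop_abs e_gt0 t0 H b1); exact: bnd_abs bf.
apply: bnd_step; first exact: Qop_Cb.
  by apply: (Qop_abs e_gt0 t0 H b1); exact: bnd_abs bf.
by move=> i; rewrite Qop_pd//; apply: IH; [exact: Cb_pd|exact: bnd_pd].
Qed.

Lemma Qop_step t e k f M : 0 < e -> e <= 1 -> 0 <= t -> bnd (k + 4) f M ->
  bnd k (fun x => Qop t e f x - f x) (t * (KL s * M)).
Proof.
move=> e_gt0 e1 t0 bf.
have := bndZ (- t) (adm_bnd (Le_adm s01 e_gt0 e1) bf).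
rewrite normrN ger0_norm//.
by rewrite (_ : (fun x => _) = (fun x => Qop t e f x - f x))//; apply/funext => x; rewrite /Qop; ring.
Qed.

Lemma Qop_consistent t e k f M : 0 < e -> e <= 1 -> 0 <= t -> bnd (k + 4) f M ->
  bnd k (fun x => Qop t e f x - f x + t * Lop f x) (t * (KD s e * M)).
Proof.
move=> e_gt0 e1 t0 bf.
have := bndZ t (adm_bnd (LopB_adm e_gt0) bf).
rewrite ger0_norm//.
by rewrite (_ : (fun x => _) = (fun x => Qop t e f x - f x + t * Lop f x))//; apply/funext => x; rewrite /Qop; ring.
Qed.

End FracLap.

(** * Transport steps *)

Section Transport.
Variable R : realType.
Local Notation e2 := (@e2 R).
Local Notation i0 := (ord0 : 'I_2).
Local Notation i1 := (lift ord0 ord0 : 'I_2).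
Implicit Types (f g : R * R -> R) (M t : R).
Variables v1 v2 : R * R -> R.
Hypotheses (Cv1 : Cb v1) (Cv2 : Cb v2).

(** Composition with one Euler step along the backward characteristic instead of the exact flow; it
    cannot increase the supremum of |f|. *)
Definition Aop t f (x : R * R) : R := f (x.1 - t * v1 x, x.2 - t * v2 x).
Definition Bop f (x : R * R) : R := v1 x * pd (e2 i0) f x + v2 x * pd (e2 i1) f x.

Let dA t f i (x : R * R) : R := Aop t (pd (e2 i) f) x -
   t * (pd (e2 i) v1 x * Aop t (pd (e2 i0) f) x + pd (e2 i) v2 x * Aop t (pd (e2 i1) f) x).

Lemma Aop_derive t f i (x : R * R) : Cb f ->
  is_derive (0 : R) 1 (fun h : R => Aop t f (x + h *: e2 i)) (dA t f i x).
Proof.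
move=> Hf; have [M bf] := Hf 2%N.
have d1 := Cb_derive i x Cv1; have d2 := Cb_derive i x Cv2.
pose a (h : R) := x.1 + h * (e2 i).1 - t * v1 (x + h *: e2 i).
pose b (h : R) := x.2 + h * (e2 i).2 - t * v2 (x + h *: e2 i).
have da : is_derive (0 : R) 1 a ((e2 i).1 - t * pd (e2 i) v1 x).
  by apply: is_derive_eq; rewrite /GRing.scale/=; ring.
have db : is_derive (0 : R) 1 b ((e2 i).2 - t * pd (e2 i) v2 x).
  by apply: is_derive_eq; rewrite /GRing.scale/=; ring.
have H := chain2 bf da db; apply: (is_derive_eq H).
rewrite /a /b scale0r addr0 /lin /dA /Aop !mul0r !addr0 /=.
by move: i {d1 d2 a b da db H}; apply: ord2_ind => /=; ring.
Qed.

Lemma Aop_abs t f M : (forall x, `|f x| <= M) -> forall x, `|Aop t f x| <= M.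
Proof. by move=> H x; exact: H. Qed.

Let bound_pd k : exists N, 0 <= N /\ forall i, bnd k (pd (e2 i) v1) N /\ bnd k (pd (e2 i) v2) N.
Proof.
have [N1 b1] := Cv1 k.+1; have [N2 b2] := Cv2 k.+1.
have n1 := bnd_ge0 b1; have n2 := bnd_ge0 b2.
exists (N1 + N2); split; first exact: addr_ge0.
by move=> i; split; [apply: bnd_le (bnd_pd i b1)|apply: bnd_le (bnd_pd i b2)] => //;
  rewrite ?lerDl ?lerDr.
Qed.

Let bound_v k : exists N, 0 <= N /\ bnd k v1 N /\ bnd k v2 N.
Proof.
have [N1 b1] := Cv1 k; have [N2 b2] := Cv2 k.
have n1 := bnd_ge0 b1; have n2 := bnd_ge0 b2.
exists (N1 + N2); split; first exact: addr_ge0.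
by split; [apply: bnd_le b1|apply: bnd_le b2] => //; rewrite ?lerDl ?lerDr.
Qed.

(** A derivative of [Aop t f] is [Aop t] of a derivative plus t times bounded terms, so each order
    adds O(t) to the growth factor. A factor 1 + C t per step stays bounded over about 1/t steps. *)
Lemma Aop_bnd k : exists C, 0 <= C /\ forall f M t, Cb f -> 0 <= t <= 1 ->
  bnd k f M -> bnd k (Aop t f) ((1 + C * t) * M).
Proof.
elim: k => [|k [C [C0 IH]]].
  exists 0; split=> // f M t _ _ bf; rewrite mul0r addr0 mul1r; split=> // x.
  by apply: Aop_abs; exact: bnd_abs bf.
have [N [N0 HN]] := bound_pd k.
exists (C + 2 * (2 ^+ k * (N * (1 + C)))); split.
  by rewrite addr_ge0// !mulr_ge0// ?exprn_ge0// addr_ge0.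
move=> f M t Hf /[dup] t01 /andP[t0 t1] bf; have M0 := bnd_ge0 bf.
have X0 : 0 <= 2 ^+ k * (N * (1 + C)) by rewrite !mulr_ge0// ?exprn_ge0// addr_ge0.
apply: (@bndS _ _ _ _ (dA t f)).
- apply: Aop_abs => x; apply: le_trans (bnd_abs bf x) _.
  by rewrite ler_peMl// lerDl mulr_ge0// addr_ge0// mulr_ge0.
- by move=> i x; exact: Aop_derive.
- move=> i; have bA j : bnd k (Aop t (pd (e2 j) f)) ((1 + C * t) * M).
    by apply: IH => //; [exact: Cb_pd|exact: bnd_pd].
  have [h1 h2] := HN i.
  have := bndB (bA i) (bndZ t (bndD (bndM h1 (bA i0)) (bndM h2 (bA i1)))).
  apply: (bnd_le (leqnn k)); rewrite (ger0_norm t0).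
  have Y : 2 ^+ k * (N * ((1 + C * t) * M)) <= 2 ^+ k * (N * (1 + C)) * M.
    rewrite -!mulrA ler_wpM2l ?exprn_ge0// ler_wpM2l// ler_wpM2r// lerD2l.
    by rewrite ler_piMr.
  set X := 2 ^+ k * _ in Y *; set Z := 2 ^+ k * _ in Y *.
  have -> : (1 + (C + 2 * Z) * t) * M = (1 + C * t) * M + (t * (Z * M) + t * (Z * M)) by ring.
  by rewrite lerD2l mulrDr; apply: lerD; rewrite ler_wpM2l.
Qed.

Lemma Aop_Cb t f : 0 <= t <= 1 -> Cb f -> Cb (Aop t f).
Proof.
move=> t01 Hf k; have [C [_ H]] := Aop_bnd k; have [M bf] := Hf k.
by exists ((1 + C * t) * M); exact: H.
Qed.

Lemma Aop_pd t f i : Cb f -> pd (e2 i) (Aop t f) = dA t f i.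
Proof. by move=> Hf; apply/funext => x; apply: pdE; exact: Aop_derive. Qed.

Lemma Aop_step k : exists C, 0 <= C /\ forall f M t, Cb f -> 0 <= t <= 1 ->
  bnd k.+1 f M -> bnd k (fun x => Aop t f x - f x) (C * t * M).
Proof.
elim: k => [|k [C [C0 IH]]].
  have [U [U0 [h1 h2]]] := bound_v 0; exists (2 * U); split; first exact: mulr_ge0.
  move=> f M t _ /andP[t0 _] bf; split=> // x; have M0 := bnd_ge0 bf.
  have := bnd_lip x (x.1 - t * v1 x, x.2 - t * v2 x) bf => /=.
  have E (c d : R) : c - d - c = - d by ring.
  rewrite !E !normrN !normrM (ger0_norm t0) => h; apply: le_trans h _.
  have -> : 2 * U * t * M = M * (t * U + t * U) by ring.
  by rewrite ler_wpM2l// lerD// ler_wpM2l//; [exact: bnd_abs h1 x|exact: bnd_abs h2 x].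
have [N [N0 HN]] := bound_pd k; have [C1 [C10 HA]] := Aop_bnd k.
exists (C + 2 * (2 ^+ k * (N * (1 + C1)))); split.
  by rewrite addr_ge0// !mulr_ge0// ?exprn_ge0// addr_ge0.
move=> f M t Hf /[dup] t01 /andP[t0 t1] bf; have M0 := bnd_ge0 bf.
have HA' := Aop_Cb t01 Hf.
have X0 : 0 <= 2 ^+ k * (N * (1 + C1)) by rewrite !mulr_ge0// ?exprn_ge0// addr_ge0.
have tM : 0 <= t * M by rewrite mulr_ge0.
have bA j : bnd k (Aop t (pd (e2 j) f)) ((1 + C1 * t) * M).
  apply: HA => //; first exact: Cb_pd.
  by apply: bnd_le (bnd_pd j bf).
have CM : C * t * M <= (C + 2 * (2 ^+ k * (N * (1 + C1)))) * t * M.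
  by rewrite ler_wpM2r// ler_wpM2r ?sqr_ge0// lerDl mulr_ge0.
have b' : bnd k.+1 f M by apply: bnd_le bf.
apply: bnd_step; first exact: CbB.
  by move=> x; apply: le_trans CM; exact: (bnd_abs (IH f M t Hf t01 b')).
move=> i; rewrite pdB// Aop_pd//.
have [h1 h2] := HN i.
have H1 := IH _ _ t (Cb_pd i Hf) t01 (bnd_pd i bf).
have H2 := bndZ (- t) (bndD (bndM h1 (bA i0)) (bndM h2 (bA i1))).
have := bndD H1 H2.
rewrite (_ : (fun x => _) = (fun x => dA t f i x - pd (e2 i) f x)); last first.
  by apply/funext => x; rewrite /dA; ring.
apply: (bnd_le (leqnn k)); rewrite normrN (ger0_norm t0).
have Y : 2 ^+ k * (N * ((1 + C1 * t) * M)) <= 2 ^+ k * (N * (1 + C1)) * M.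
  rewrite -!mulrA ler_wpM2l ?exprn_ge0// ler_wpM2l// ler_wpM2r// lerD2l.
  by rewrite ler_piMr.
set X := 2 ^+ k * _ in Y *; set Z := 2 ^+ k * _ in Y *.
have -> : (C + 2 * Z) * t * M = C * t * M + (t * (Z * M) + t * (Z * M)) by ring.
by rewrite lerD2l mulrDr; apply: lerD; rewrite ler_wpM2l.
Qed.

Lemma Bop_bnd k : exists C, 0 <= C /\ forall f M, bnd k.+1 f M -> bnd k (Bop f) (C * M).
Proof.
have [U [U0 [h1 h2]]] := bound_v k.
exists (2 * (2 ^+ k * U)); split; first by rewrite !mulr_ge0// exprn_ge0.
move=> f M bf; have := bndD (bndM h1 (bnd_pd i0 bf)) (bndM h2 (bnd_pd i1 bf)).
by apply: (bnd_le (leqnn k)); apply: eq_ler; ring.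
Qed.

Lemma Bop_Cb f : Cb f -> Cb (Bop f).
Proof. by move=> Hf; apply: CbD; apply: CbM => //; exact: Cb_pd. Qed.

Lemma Bop_pd f i : Cb f -> pd (e2 i) (Bop f) = (fun x => Bop (pd (e2 i) f) x +
   (pd (e2 i) v1 x * pd (e2 i0) f x + pd (e2 i) v2 x * pd (e2 i1) f x)).
Proof.
move=> Hf; have [M b3] := Hf 3%N.
have C0 := Cb_pd i0 Hf; have C1 := Cb_pd i1 Hf.
rewrite /Bop pdD ?pdM//; do ?exact: CbM.
have S0 := schwarz i0 i b3; have S1 := schwarz i1 i b3.
apply/funext => x.
have : pd (e2 i) (pd (e2 i0) f) x = pd (e2 i0) (pd (e2 i) f) x by rewrite S0.
have : pd (e2 i) (pd (e2 i1) f) x = pd (e2 i1) (pd (e2 i) f) x by rewrite S1.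
generalize (pd (e2 i) (pd (e2 i0) f) x) (pd (e2 i0) (pd (e2 i) f) x)
  (pd (e2 i) (pd (e2 i1) f) x) (pd (e2 i1) (pd (e2 i) f) x) (pd (e2 i0) f x) (pd (e2 i1) f x).
generalize (pd (e2 i) v1 x) (pd (e2 i) v2 x) => p q a b c d a' b' -> ->.
ring.
Qed.

(** Differentiating the remainder gives the remainder for the derivative of f plus t times gradients
    of v against increments of derivatives of f; [Aop_step] supplies the second factor t for the
    latter. *)
Lemma Aop_taylor k : exists C, 0 <= C /\ forall f M t, Cb f -> 0 <= t <= 1 ->
  bnd k.+2 f M -> bnd k (fun x => Aop t f x - f x + t * Bop f x) (C * t ^+ 2 * M).
Proof.
elim: k => [|k [C [C0 IH]]].
  have [U [U0 [h1 h2]]] := bound_v 0; exists (4 * U ^+ 2); split.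
    by rewrite mulr_ge0// sqr_ge0.
  move=> f M t _ /andP[t0 _] bf; split=> // x; have M0 := bnd_ge0 bf.
  have := bnd_taylor x (- t * v1 x, - t * v2 x) bf.
  rewrite enorm2_sq_pair (_ : x + _ = (x.1 - t * v1 x, x.2 - t * v2 x)); last first.
    by rewrite !mulNr.
  rewrite (_ : _ - lin _ _ _ = Aop t f x - f x + t * Bop f x); last first.
    by rewrite /lin /Aop /Bop /=; ring.
  move=> h; apply: le_trans h _.
  have q1 : v1 x ^+ 2 <= U ^+ 2.
    by rewrite -(real_normK (num_real (v1 x))) lerXn2r ?nnegrE//; exact: bnd_abs h1 x.
  have q2 : v2 x ^+ 2 <= U ^+ 2.
    by rewrite -(real_normK (num_real (v2 x))) lerXn2r ?nnegrE//; exact: bnd_abs h2 x.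
  have -> : 4 * U ^+ 2 * t ^+ 2 * M = 2 * M * (t ^+ 2 * (U ^+ 2 + U ^+ 2)) by ring.
  rewrite ler_wpM2l ?mulr_ge0//.
  have -> : (- t * v1 x) ^+ 2 + (- t * v2 x) ^+ 2 = t ^+ 2 * (v1 x ^+ 2 + v2 x ^+ 2) by ring.
  by rewrite ler_wpM2l ?sqr_ge0// lerD.
have [N [N0 HN]] := bound_pd k; have [C1 [C10 HA]] := Aop_step k.
exists (C + 2 * (2 ^+ k * (N * C1))); split.
  by rewrite addr_ge0// !mulr_ge0// exprn_ge0.
move=> f M t Hf /[dup] t01 /andP[t0 t1] bf; have M0 := bnd_ge0 bf.
have HA' := Aop_Cb t01 Hf; have HB := Bop_Cb Hf.
have X0 : 0 <= 2 ^+ k * (N * C1) by rewrite !mulr_ge0// exprn_ge0.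
have tM : 0 <= t ^+ 2 * M by rewrite mulr_ge0// sqr_ge0.
have bA j : bnd k (fun x => Aop t (pd (e2 j) f) x - pd (e2 j) f x) (C1 * t * M).
  apply: HA => //; first exact: Cb_pd.
  by apply: bnd_le (bnd_pd j bf).
have CM : C * t ^+ 2 * M <= (C + 2 * (2 ^+ k * (N * C1))) * t ^+ 2 * M.
  by rewrite ler_wpM2r// ler_wpM2r ?sqr_ge0// lerDl mulr_ge0.
have b' : bnd k.+2 f M by apply: bnd_le bf.
apply: bnd_step; first by apply: CbD; [exact: CbB|exact: CbZ].
  by move=> x; apply: le_trans CM; exact: (bnd_abs (IH f M t Hf t01 b')).
move=> i; rewrite pdD; [|exact: CbB|exact: CbZ].
rewrite pdB// pdZ// Aop_pd// Bop_pd//.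
have [h1 h2] := HN i.
have H1 := IH _ _ t (Cb_pd i Hf) t01 (bnd_pd i bf).
have H2 := bndZ (- t) (bndD (bndM h1 (bA i0)) (bndM h2 (bA i1))).
have := bndD H1 H2.
rewrite (_ : (fun x => _) = (fun x => dA t f i x - pd (e2 i) f x + t * (Bop (pd (e2 i) f) x +
   (pd (e2 i) v1 x * pd (e2 i0) f x + pd (e2 i) v2 x * pd (e2 i1) f x)))); last first.
  by apply/funext => x; rewrite /dA; ring.
apply: (bnd_le (leqnn k)); rewrite normrN (ger0_norm t0).
by apply: eq_ler; ring.
Qed.

End Transport.

(** * Convergence of the splitting scheme *)

Section LimBnd.
Variable R : realType.
Local Notation e2 := (@e2 R).

Definition limf (u : nat -> R * R -> R) (x : R * R) : R := lim (u n x @[n --> \oo]).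

(** Two spare derivatives give the [u n] a common quadratic remainder; in the limit this identifies
    the derivative of the limit with the limit of the derivatives. *)
Lemma bnd_limf k (u : nat -> R * R -> R) (M : R) (ep : nat -> R) :
  (forall n, Cb (u n)) -> ep n @[n --> \oo] --> (0 : R) ->
  (forall n, bnd k.+2 (u n) M) ->
  (forall n m, (n <= m)%N -> bnd k (fun x => u m x - u n x) (ep n)) ->
  bnd k (limf u) M /\ forall n, bnd k (fun x => limf u x - u n x) (ep n).
Proof.
move=> + ep0; elim: k u => [|k IH] u Hu bu du.
  have C x := @cauchy_bound R (fun n => u n x) ep ep0 (fun n m nm => bnd_abs (du n m nm) x).
  split; last by move=> n; split=> // x; have [_ +] := C x; exact.
  split=> // x; have [c _] := C x.
  by apply: (cvg_le_cst (cvg_norm c)) => n; exact: bnd_abs (bu n) x.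
have C x := @cauchy_bound R (fun n => u n x) ep ep0 (fun n m nm => bnd_abs (du n m nm) x).
have dpu i n m : (n <= m)%N -> bnd k (fun x => pd (e2 i) (u m) x - pd (e2 i) (u n) x) (ep n).
  by move=> nm; have := bnd_pd i (du n m nm); rewrite pdB.
have I i := IH (fun n => pd (e2 i) (u n)) (fun n => Cb_pd i (Hu n)) (fun n => bnd_pd i (bu n)) (dpu i).
have Cp i x := @cauchy_bound R (fun n => pd (e2 i) (u n) x) ep ep0 (fun n m nm => bnd_abs (dpu i n m nm) x).
have D i (x : R * R) : is_derive (0 : R) 1 (fun h : R => limf u (x + h *: e2 i)) (limf (fun n => pd (e2 i) (u n)) x).
  apply: (is_derive_quad (C := M) ltr01) => h _.
  rewrite add0r scale0r addr0.
  have l : u n (x + h *: e2 i) - u n x - h * pd (e2 i) (u n) x @[n --> \oo] -->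
     limf u (x + h *: e2 i) - limf u x - h * limf (fun n => pd (e2 i) (u n)) x.
    apply: cvgB; first by apply: cvgB; [have [] := C (x + h *: e2 i)|have [] := C x].
    by apply: cvgM; [exact: cvg_cst|have [] := Cp i x].
  apply: (cvg_le_cst (cvg_norm l)) => n.
  have b2 : bnd 2 (u n) M by apply: bnd_le (bu n).
  exact: bnd_quad.
split.
  apply: (bndS _ D) => [x|i]; last by have [] := I i.
  have [c _] := C x.
  by apply: (cvg_le_cst (cvg_norm c)) => n; exact: bnd_abs (bu n) x.
move=> n.
apply: (@bndS _ _ _ _ (fun i x => limf (fun n => pd (e2 i) (u n)) x - pd (e2 i) (u n) x)).
- by move=> x; have [_ +] := C x; exact.
- move=> i x; have d1 := D i x; have d2 := Cb_derive i x (Hu n); exact: is_deriveB.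
- by move=> i; have [_ +] := I i; exact.
Qed.

Lemma bnd_eps k (f : R * R -> R) (a b : R) (ep : nat -> R) : ep n @[n --> \oo] --> (0 : R) ->
  (forall n, bnd k f (a + b * ep n)) -> bnd k f a.
Proof.
move=> ep0.
have l : a + b * ep n @[n --> \oo] --> a.
  rewrite -[X in _ --> X]addr0; apply: cvgD; first exact: cvg_cst.
  by rewrite -(mulr0 b); apply: cvgM => //; exact: cvg_cst.
elim: k f => [|k IH] f H.
  split=> // x; apply: (cvgr_to_ge l); exists 0%N => // n _; exact: bnd_abs (H n) x.
split=> [x|i].
  apply: (cvgr_to_ge l); exists 0%N => // n _; exact: bnd_abs (H n) x.
split; first by have [_ /(_ i)[]] := H 0%N.
by apply: IH => n; exact: bnd_pd (H n).
Qed.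

End LimBnd.

Section Scheme.
Variable R : realType.
Local Notation e2 := (@e2 R).
Variables (P : nat -> (R * R -> R) -> R * R -> R) (G : (R * R -> R) -> R * R -> R).
Variables (t0 q : R) (f0 : R * R -> R).
Hypotheses (t00 : 0 < t0) (t01 : t0 <= 1) (q0 : 2^-1 <= q) (q1 : q < 1).
(** Dyadic steps: two steps of level n+1 cover one step of level n, so successive levels can be
    compared step by step. The condition 1/2 <= q gives ta n <= q^n, which lets errors of order (ta
    n)^2 be absorbed into ta n q^n. *)
Let ta (n : nat) : R := t0 * 2^-1 ^+ n.
Hypothesis P_Cb : forall n f, Cb f -> Cb (P n f).
Hypothesis P_sub : forall n f g x, Cb f -> Cb g -> P n (fun y => f y - g y) x = P n f x - P n g x.
Hypothesis P_bnd : forall k, exists C, 0 <= C /\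
  forall n f M, Cb f -> bnd k f M -> bnd k (P n f) ((1 + C * ta n) * M).
Hypothesis P_step : forall k, exists C, 0 <= C /\
  forall n f M, Cb f -> bnd (k + 5) f M -> bnd k (fun x => P n f x - f x) (C * ta n * M).
Hypothesis P_cons : forall k, exists C, 0 <= C /\
  forall n f M, Cb f -> bnd (k + 5) f M ->
   bnd k (fun x => P n f x - f x - ta n * G f x) (C * (ta n * q ^+ n) * M).
Hypothesis G_sub : forall f g x, Cb f -> Cb g -> G (fun y => f y - g y) x = G f x - G g x.
Hypothesis G_bnd : forall k, exists C, 0 <= C /\
  forall f M, Cb f -> bnd (k + 5) f M -> bnd k (G f) (C * M).
Hypothesis Cb_f0 : Cb f0.

Let q_gt0 : 0 < q. Proof. by apply: lt_le_trans q0; rewrite invr_gt0. Qed.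
Let ta0 n : 0 < ta n. Proof. by rewrite mulr_gt0// exprn_gt0// invr_gt0. Qed.
Let ta_q n : ta n <= q ^+ n.
Proof.
rewrite /ta -[leRHS]mul1r; apply: ler_pM; [exact: ltW|by rewrite exprn_ge0 ?invr_ge0|exact: t01|].
by rewrite lerXn2r ?nnegrE ?invr_ge0// ltW.
Qed.
Let taS n : ta n = ta n.+1 + ta n.+1.
Proof. by rewrite /ta exprS; field. Qed.
Let q_le1 n : q ^+ n <= 1. Proof. by rewrite exprn_ile1// ltW. Qed.
Let qS n : q ^+ n.+1 <= q ^+ n. Proof. by rewrite exprS ler_piMl ?exprn_ge0 ?ltW. Qed.
Let qcvg : q ^+ n @[n --> \oo] --> (0 : R).
Proof. by apply: cvg_expr; rewrite ger0_norm// ltW. Qed.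

Let It n N := iter N (P n) f0.

Let It_Cb n N : Cb (It n N). Proof. by elim: N => //= N IH; exact: P_Cb. Qed.

Let It_bnd k T : exists K, 0 <= K /\ forall n N, N%:R * ta n <= T -> bnd k (It n N) K.
Proof.
have [C [C0 H]] := P_bnd k; have [M bM] := Cb_f0 k.
have M0 := bnd_ge0 bM.
exists (expR (C * T) * M); split; first by rewrite mulr_ge0 ?expR_ge0.
move=> n N NT.
have K : bnd k (It n N) (expR (C * (N%:R * ta n)) * M).
  elim: N {NT} => [|N IH]; first by rewrite mul0r mulr0 expR0 mul1r.
  apply: (bnd_le (leqnn k) _ (H n _ _ (It_Cb n N) IH)).
  rewrite mulrA ler_wpM2r//.
  have -> : C * (N.+1%:R * ta n) = C * ta n + C * (N%:R * ta n).
    by rewrite -addn1 natrD; ring.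
  by rewrite expRD ler_wpM2r ?expR_ge0// expR_ge1Dx.
apply: (bnd_le (leqnn k) _ K); rewrite ler_wpM2r// ler_expR.
by rewrite ler_wpM2l.
Qed.

Let It_le n N m T : (N + m)%:R * ta n <= T -> N%:R * ta n <= T.
Proof. by apply: le_trans; apply: ler_wpM2r; [exact: ltW|rewrite ler_nat leq_addr]. Qed.

Let It_inc k T : exists K, 0 <= K /\ forall n N m, (N + m)%:R * ta n <= T ->
  bnd k (fun x => It n (N + m) x - It n N x) (K * (m%:R * ta n)).
Proof.
have [C [C0 H]] := P_step k; have [K [K0 HK]] := It_bnd (k + 5) T.
exists (C * K); split; first by rewrite mulr_ge0.
move=> n N; elim=> [_|m IH NT].
  rewrite mul0r mulr0 addn0; under eq_fun do rewrite subrr.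
  by have := bnd_cst k (0 : R); rewrite normr0.
have NT' : (N + m)%:R * ta n <= T by apply: (It_le (m := 1)); rewrite -addnA addn1.
have := bndD (H n _ _ (It_Cb n (N + m)) (HK n _ NT')) (IH NT').
rewrite (_ : (fun x => _) = (fun x => It n (N + m.+1) x - It n N x)); last first.
  by apply/funext => x; rewrite addnS /It /=; ring.
by apply: (bnd_le (leqnn k)); rewrite -(natr1 m) le_eqVlt; apply/orP; left; apply/eqP; ring.
Qed.

(** Write E for the increment over m steps. One more step adds (P - 1) E, of order m (ta n)^2 by
    [It_inc], and the consistency error at the start of the block. Keeping the generator at the
    starting iterate makes the sum quadratic in m ta n. *)
Let It_exp k T : exists K, 0 <= K /\ forall n N m, (N + m)%:R * ta n <= T ->
  bnd k (fun x => It n (N + m) x - It n N x - m%:R * ta n * G (It n N) x)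
    (K * ((m%:R * ta n) ^+ 2 + m%:R * ta n * q ^+ n)).
Proof.
have [C [C0 H]] := P_step k; have [D [D0 HD]] := P_cons k.
have [K [K0 HK]] := It_bnd (k + 5) T; have [L [L0 HL]] := It_inc (k + 5) T.
exists (C * L + D * K); split; first by rewrite addr_ge0// mulr_ge0.
move=> n N; elim=> [_|m IH NT].
  rewrite !mul0r expr0n/= add0r mulr0 addn0; under eq_fun do rewrite subrr mul0r subr0.
  by have := bnd_cst k (0 : R); rewrite normr0.
have NT' : (N + m)%:R * ta n <= T by apply: (It_le (m := 1)); rewrite -addnA addn1.
have B1 := H n _ _ (CbB (It_Cb n (N + m)) (It_Cb n N)) (HL n N m NT').
have B3 := HD n _ _ (It_Cb n N) (HK n N (It_le NT')).
have := bndD (bndD B1 (IH NT')) B3.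
rewrite (_ : (fun x => _) = (fun x => It n (N + m.+1) x - It n N x - m.+1%:R * ta n * G (It n N) x)); last first.
  apply/funext => x; rewrite (P_sub _ _ (It_Cb n (N + m)) (It_Cb n N)) addnS /It /= -(natr1 m); ring.
apply: (bnd_le (leqnn k)); rewrite -(natr1 m).
have h1 := ta0 n; have m0 : 0 <= m%:R :> R by [].
have hq : 0 <= q ^+ n by rewrite exprn_ge0// ltW.
rewrite -subr_ge0; set Q := q ^+ n in hq *; set a := ta n in h1 *; set mm := m%:R in m0 *.
have -> : (C * L + D * K) * (((mm + 1) * a) ^+ 2 + (mm + 1) * a * Q) -
   (C * a * (L * (mm * a)) + (C * L + D * K) * ((mm * a) ^+ 2 + mm * a * Q) + D * (a * Q) * K) =
   (C * L) * ((mm + 1) * a ^+ 2) + (D * K) * ((2 * mm + 1) * a ^+ 2) + C * L * (a * Q) by ring.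
by rewrite !addr_ge0// !mulr_ge0// ?sqr_ge0// ?addr_ge0// ?mulr_ge0// ltW.
Qed.

(** Two half steps minus one full step is (P' - 1)^2 f, plus twice the consistency error of the half
    step, minus that of the full step; the generator terms cancel because the step lengths add
    up. *)
Let two_step k T : exists K, 0 <= K /\ forall n N, N%:R * ta n <= T ->
  bnd k (fun x => P n.+1 (P n.+1 (It n N)) x - P n (It n N) x) (K * (ta n * q ^+ n)).
Proof.
have [C [C0 H]] := P_step k; have [C' [C'0 H']] := P_step (k + 5).
have [D [D0 HD]] := P_cons k; have [K [K0 HK]] := It_bnd (k + 5 + 5) T.
exists (C * C' * K + 2 * D * K); split; first by rewrite addr_ge0// !mulr_ge0.
move=> n N NT; set f := It n N; have Cf : Cb f := It_Cb n N.
have bf := HK n N NT; rewrite -/f in bf.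
have bf5 : bnd (k + 5) f K by apply: bnd_le bf; rewrite // leq_addr.
have B1 := H n.+1 _ _ (CbB (P_Cb n.+1 Cf) Cf) (H' n.+1 _ _ Cf bf).
have B2 := HD n.+1 _ _ Cf bf5; have B3 := HD n _ _ Cf bf5.
have := bndB (bndD B1 (bndD B2 B2)) B3.
rewrite (_ : (fun x => _) = (fun x => P n.+1 (P n.+1 f) x - P n f x)); last first.
  by apply/funext => x; rewrite (P_sub _ _ (P_Cb n.+1 Cf) Cf) (taS n); ring.
apply: (bnd_le (leqnn k)).
have h1 := ta0 n.+1; have hq : 0 <= q ^+ n by rewrite exprn_ge0// ltW.
have h2 : ta n.+1 * ta n.+1 <= ta n * q ^+ n.
  rewrite ler_pM ?ltW//; first by rewrite (taS n) ltrDl.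
  by apply: le_lt_trans (ta_q _) _; rewrite exprS gtr_pMl// exprn_gt0.
have h3 : ta n.+1 * q ^+ n.+1 <= ta n.+1 * q ^+ n by apply: ler_wpM2l; [exact: ltW|exact: qS].
have E1 := ler_wpM2l (mulr_ge0 (mulr_ge0 C0 C'0) K0) h2.
have E2 := ler_wpM2l (mulr_ge0 D0 K0) h3.
rewrite (taS n) in E1 *; move: E1 E2; set a := ta n.+1; set b := q ^+ n.+1; set c := q ^+ n => E1 E2.
have -> : C * a * (C' * a * K) + (D * (a * b) * K + D * (a * b) * K) + D * ((a + a) * c) * K =
  C * C' * K * (a * a) + 2 * (D * K * (a * b)) + 2 * (D * K * (a * c)) by ring.
have -> : (C * C' * K + 2 * D * K) * ((a + a) * c) =
  C * C' * K * ((a + a) * c) + 2 * (D * K * (a * c)) + 2 * (D * K * (a * c)) by ring.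
by rewrite lerD2r lerD// ler_wpM2l.
Qed.

(** The gap between the levels is propagated by two stable half steps and receives the local error
    of [two_step]; summing N of these costs the exponential factor and N ta n <= T. *)
Let It_double k T : exists K, 0 <= K /\ forall n N, N%:R * ta n <= T ->
  bnd k (fun x => It n.+1 (N + N) x - It n N x) (K * q ^+ n).
Proof.
have [C [C0 H]] := P_bnd k; have [D [D0 HD]] := two_step k T.
exists (expR (C * `|T|) * (`|T| * D)); split; first by rewrite !mulr_ge0// expR_ge0.
move=> n N NT.
have hq : 0 <= q ^+ n by rewrite exprn_ge0// ltW.
have K : bnd k (fun x => It n.+1 (N + N) x - It n N x)
   (expR (C * (N%:R * ta n)) * (N%:R * ta n * (D * q ^+ n))).
  elim: N NT => [_|N IH NT].
    rewrite !mul0r mulr0; under eq_fun do rewrite subrr.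
    by have := bnd_cst k (0 : R); rewrite normr0.
  have NT' : N%:R * ta n <= T by apply: (It_le (m := 1)); rewrite addn1.
  have CE := CbB (It_Cb n.+1 (N + N)) (It_Cb n N).
  have B1 := H n.+1 _ _ (P_Cb n.+1 CE) (H n.+1 _ _ CE (IH NT')).
  have := bndD B1 (HD n N NT').
  rewrite (_ : (fun x => _) = (fun x => It n.+1 (N.+1 + N.+1) x - It n N.+1 x)); last first.
    apply/funext => x.
    have E : P n.+1 (fun x => It n.+1 (N + N) x - It n N x) =
       (fun x => P n.+1 (It n.+1 (N + N)) x - P n.+1 (It n N) x).
      by apply/funext => y; rewrite P_sub.
    rewrite E P_sub; [|exact: P_Cb|exact: P_Cb].
    by rewrite addSn addnS /It /=; ring.
  apply: (bnd_le (leqnn k)).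
  have e1 : 1 + C * ta n.+1 <= expR (C * ta n.+1) by exact: expR_ge1Dx.
  have p1 : 0 <= 1 + C * ta n.+1 by rewrite addr_ge0// mulr_ge0// ltW.
  have -> : C * (N.+1%:R * ta n) = C * ta n.+1 + C * ta n.+1 + C * (N%:R * ta n).
    by rewrite -natr1 (taS n); ring.
  rewrite !expRD.
  have X0 : 0 <= expR (C * (N%:R * ta n)) * (N%:R * ta n * (D * q ^+ n)).
    by rewrite !mulr_ge0 ?expR_ge0// ltW.
  have Y0 : 0 <= D * (ta n * q ^+ n) by rewrite !mulr_ge0// ltW.
  set E := expR (C * ta n.+1); set F := expR (C * (N%:R * ta n)) in X0 *.
  have E1 : 1 <= E by apply: le_trans e1; rewrite lerDl mulr_ge0// ltW.
  have F1 : 1 <= F by rewrite /F -[leLHS]expR0 ler_expR mulr_ge0// mulr_ge0// ltW.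
  have -> : E * E * F * (N.+1%:R * ta n * (D * q ^+ n)) =
     E * (E * (F * (N%:R * ta n * (D * q ^+ n)))) + E * E * F * (D * (ta n * q ^+ n)).
    by rewrite -natr1; ring.
  apply: lerD.
    by apply: ler_pM => //; [rewrite mulr_ge0|apply: ler_pM].
  rewrite ler_peMl//.
  by rewrite mulr_ege1// mulr_ege1.
apply: (bnd_le (leqnn k) _ K).
have NT1 : N%:R * ta n <= `|T| by apply: le_trans NT (ler_norm _).
have N0 : 0 <= N%:R * ta n by rewrite mulr_ge0// ltW.
have -> : expR (C * `|T|) * (`|T| * D) * q ^+ n = expR (C * `|T|) * (`|T| * (D * q ^+ n)) by ring.
apply: ler_pM; first exact: expR_ge0.
- by rewrite mulr_ge0// mulr_ge0.
- by rewrite ler_expR ler_wpM2l.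
- by rewrite ler_wpM2r// mulr_ge0.
Qed.

Let Nn (t : R) n : nat := Num.truncn (t / ta n).

Let Nn_le t n : 0 <= t -> (Nn t n)%:R * ta n <= t.
Proof.
move=> t_ge0; rewrite -ler_pdivlMr//.
by have /andP[] := Num.Theory.truncn_itv (divr_ge0 t_ge0 (ltW (ta0 n))).
Qed.

Let Nn_gt t n : 0 <= t -> t < (Nn t n)%:R * ta n + ta n.
Proof.
move=> t_ge0; rewrite -[X in _ + X]mul1r -mulrDl natr1 -ltr_pdivrMr//.
by have /andP[] := Num.Theory.truncn_itv (divr_ge0 t_ge0 (ltW (ta0 n))).
Qed.

(** Halving the step doubles the number of steps that fit into [0, t], with one extra if the
    remainder still holds a half step. *)
Let NnS t n : 0 <= t -> Nn t n.+1 = (Nn t n + Nn t n)%N \/ Nn t n.+1 = (Nn t n + Nn t n + 1)%N.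
Proof.
move=> t_ge0.
have a1 := Nn_le n t_ge0; have a2 := Nn_gt n t_ge0.
have b1 := Nn_le n.+1 t_ge0; have b2 := Nn_gt n.+1 t_ge0.
have p := ta0 n.+1; rewrite (taS n) in a1 a2.
have h1 : (Nn t n + Nn t n < Nn t n.+1 + 1)%N.
  rewrite -(ltr_nat R) !natrD -(ltr_pM2r p); move: a1 b2.
  by rewrite !mulrDl mulrDr mul1r => u v; apply: le_lt_trans u v.
have h2 : (Nn t n.+1 < Nn t n + Nn t n + 2)%N.
  rewrite -(ltr_nat R) !natrD -(ltr_pM2r p); apply: le_lt_trans b1 _.
  by apply: lt_le_trans a2 _; apply: eq_ler; ring.
rewrite addn1 ltnS in h1; rewrite addn2 ltnS leq_eqVlt ltnS in h2.
by case/orP: h2 => [/eqP->|h2]; [right; rewrite addn1|left; apply/eqP; rewrite eqn_leq h2].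
Qed.

Let ut t n := It n (Nn t n).

Let ut_step k T : exists K, 0 <= K /\ forall t n, 0 <= t <= T ->
  bnd k (fun x => ut t n.+1 x - ut t n x) (K * q ^+ n).
Proof.
have [C [C0 H]] := It_double k T; have [D [D0 HD]] := It_inc k T.
exists (C + D); split; first exact: addr_ge0.
move=> t n /andP[t_ge0 tT].
have NT : (Nn t n)%:R * ta n <= T by apply: le_trans tT; exact: Nn_le.
have B1 := H n _ NT; have hq : 0 <= q ^+ n by rewrite exprn_ge0// ltW.
have [E|E] := NnS n t_ge0; rewrite /ut E.
  by apply: (bnd_le (leqnn k) _ B1); rewrite ler_wpM2r// lerDl.
have NT2 : (Nn t n + Nn t n + 1)%:R * ta n.+1 <= T by rewrite -E; apply: le_trans tT; exact: Nn_le.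
have := bndD B1 (HD n.+1 _ _ NT2).
rewrite (_ : (fun x => _) = (fun x => It n.+1 (Nn t n + Nn t n + 1) x - It n (Nn t n) x)); last first.
  by apply/funext => x; ring.
apply: (bnd_le (leqnn k)); rewrite mulrDl lerD2l ler_wpM2l// mul1r.
by apply: le_trans (ta_q _) (qS n).
Qed.

Let ut_cauchy k T : exists K, 0 <= K /\ forall t n m, 0 <= t <= T -> (n <= m)%N ->
  bnd k (fun x => ut t m x - ut t n x) (K * q ^+ n).
Proof.
have [C [C0 H]] := ut_step k T.
have p : 0 < 1 - q by rewrite subr_gt0.
exists (C / (1 - q)); split; first by rewrite divr_ge0// ltW.
move=> t n m t0T nm.
(* This form of the geometric sum is reproduced exactly by the induction on m - n. *)
have : bnd k (fun x => ut t m x - ut t n x) (C / (1 - q) * (q ^+ n - q ^+ m)).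
  rewrite -(subnKC nm); elim: (m - n)%N => [|j IH].
    rewrite addn0 subrr mulr0; under eq_fun do rewrite subrr.
    by have := bnd_cst k (0 : R); rewrite normr0.
  have := bndD (H t (n + j)%N t0T) IH.
  rewrite (_ : (fun x => _) = (fun x => ut t (n + j.+1) x - ut t n x)); last first.
    by apply/funext => x; rewrite addnS; ring.
  apply: (bnd_le (leqnn k)); rewrite addnS exprS le_eqVlt; apply/orP; left; apply/eqP.
  by field; rewrite gt_eqF.
apply: (bnd_le (leqnn k)); apply: ler_wpM2l; first by rewrite divr_ge0// ltW.
by rewrite gerBl exprn_ge0// ltW.
Qed.

Let Cq (K : R) : K * q ^+ n @[n --> \oo] --> (0 : R).
Proof. by rewrite -[X in _ --> X](mulr0 K); apply: cvgM => //; exact: cvg_cst. Qed.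

Definition Sol (t : R) : R * R -> R := limf (ut t).

Lemma Sol0 : Sol 0 = f0.
Proof.
apply/funext => x; rewrite /Sol /limf.
rewrite (_ : (fun n => _) = fun=> f0 x); first exact: lim_cst.
by apply/funext => n; rewrite /ut /Nn mul0r Num.Theory.truncn0.
Qed.

Lemma Sol_bnd k T : exists K, 0 <= K /\ forall t, 0 <= t <= T -> bnd k (Sol t) K.
Proof.
have [M [M0 H]] := It_bnd k.+2 T; have [C [C0 HC]] := ut_cauchy k T.
exists M; split=> // t t0T.
have B n : bnd k.+2 (ut t n) M.
  by apply: H; case/andP: t0T => a b; apply: le_trans b; exact: Nn_le.
by have [] := bnd_limf (fun n => It_Cb n _) (Cq C) B (fun n m => HC t n m t0T).
Qed.

Let Sol_lim k T : exists K, 0 <= K /\ forall t n, 0 <= t <= T ->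
  bnd k (fun x => Sol t x - ut t n x) (K * q ^+ n).
Proof.
have [M [M0 H]] := It_bnd k.+2 T; have [C [C0 HC]] := ut_cauchy k T.
exists C; split=> // t n t0T.
have B n' : bnd k.+2 (ut t n') M.
  by apply: H; case/andP: t0T => a b; apply: le_trans b; exact: Nn_le.
by have [_] := bnd_limf (fun n => It_Cb n _) (Cq C) B (fun n m => HC t n m t0T); exact.
Qed.

Lemma Sol_Cb t : 0 <= t -> Cb (Sol t).
Proof.
by move=> t_ge0 k; have [K [_ H]] := Sol_bnd k t; exists K; apply: H; rewrite t_ge0 lexx.
Qed.

Lemma Sol_abs M t : 0 <= t -> (forall n f, Cb f -> (forall x, `|f x| <= M) -> forall x, `|P n f x| <= M) ->
  (forall x, `|f0 x| <= M) -> forall x, `|Sol t x| <= M.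
Proof.
move=> t_ge0 HP H0 x.
have [C [C_ge0 HC]] := ut_cauchy 0 t.
have t0T : 0 <= t <= t by rewrite t_ge0 lexx.
have [c _] := @cauchy_bound R (fun n => ut t n x) _ (Cq C) (fun n m nm => bnd_abs (HC t n m t0T nm) x).
apply: (cvg_le_cst (cvg_norm c)) => n {c}; rewrite /ut.
by elim: (Nn t n) x => [|N IH] x //=; apply: HP => //; exact: It_Cb.
Qed.

Lemma Sol_expansion k T : exists K, 0 <= K /\ forall t h, 0 <= t -> 0 <= h -> t + h <= T ->
  bnd k (fun x => Sol (t + h) x - Sol t x - h * G (Sol t) x) (K * h ^+ 2).
Proof.
have [C [C0 H]] := It_exp k T; have [D [D0 HD]] := Sol_lim k T.
have [E [E0 HE]] := Sol_lim (k + 5) T; have [g [g0 Hg]] := G_bnd k.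
have [K [K0 HK]] := It_bnd (k + 5) T.
exists C; split=> // t h t_ge0 h_ge0 thT.
have t0T : 0 <= t <= T by rewrite t_ge0 (le_trans _ thT)// lerDl.
have th0T : 0 <= t + h <= T by rewrite addr_ge0.
have tT : t <= T by case/andP: t0T.
(* The coefficients of q^n: solutions replaced by iterates (D), the same under the generator (h g
   E), the block expansion (C), and rounding h to a multiple of the step (g K). Letting n tend to
   infinity leaves only C h^2. *)
pose b := C * (3 * h + 2) + 2 * D + h * g * E + g * K.
apply: (@bnd_eps R k _ _ b (fun n => q ^+ n) qcvg) => n.
have hq : 0 <= q ^+ n by rewrite exprn_ge0// ltW.
have [m Em] : exists m, Nn (t + h) n = (Nn t n + m)%N.
  exists (Nn (t + h) n - Nn t n)%N; rewrite subnKC//.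
  apply: Num.Theory.le_truncn; rewrite ler_pM2r ?invr_gt0// lerDl//.
have L1 := Nn_le n t_ge0; have L2 := Nn_gt n t_ge0.
have L3 := Nn_le n (addr_ge0 t_ge0 h_ge0); have L4 := Nn_gt n (addr_ge0 t_ge0 h_ge0).
rewrite Em natrD mulrDl in L3 L4.
set mu := m%:R * ta n in L3 L4.
have NT : (Nn t n + m)%:R * ta n <= T.
  by rewrite -Em; apply: le_trans thT; exact: (Nn_le n (addr_ge0 t_ge0 h_ge0)).
have taq := ta_q n.
have mu0 : 0 <= mu by rewrite mulr_ge0// ltW.
have mu1 : `|mu - h| <= q ^+ n by rewrite ler_norml; apply/andP; split; lra.
have mu2 : mu <= h + q ^+ n by lra.
have CbS := Sol_Cb t_ge0.
have B1 := HD (t + h) n th0T; have B2 := HD t n t0T.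
have B3 := bndZ h (Hg _ _ (CbB CbS (It_Cb n (Nn t n))) (HE t n t0T)).
have B4 := H n _ _ NT.
have B5 := bndZ (mu - h) (Hg _ _ (It_Cb n (Nn t n)) (HK n _ (le_trans L1 tT))).
have := bndD (bndD (bndB (bndB B1 B2) B3) B4) B5.
rewrite (_ : (fun x => _) = (fun x => Sol (t + h) x - Sol t x - h * G (Sol t) x)); last first.
  by apply/funext => x; rewrite (G_sub _ CbS (It_Cb n (Nn t n))) /ut Em -/mu; ring.
apply: (bnd_le (leqnn k)).
rewrite -/mu (ger0_norm h_ge0).
have F1 : C * (mu ^+ 2 + mu * q ^+ n) <= C * (h ^+ 2 + (3 * h + 2) * q ^+ n).
  rewrite ler_wpM2l//; have Q1 := q_le1 n.
  have A1 : mu ^+ 2 <= (h + q ^+ n) ^+ 2 by rewrite lerXn2r ?nnegrE// addr_ge0.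
  have A2 : mu * q ^+ n <= (h + q ^+ n) * q ^+ n by rewrite ler_wpM2r.
  have A3 : q ^+ n * q ^+ n <= q ^+ n by rewrite ler_piMl.
  apply: le_trans (lerD A1 A2) _; rewrite -subr_ge0; set Q := q ^+ n in A3 *.
  rewrite (_ : _ - _ = 2 * (Q - Q * Q)); last by ring.
  by rewrite mulr_ge0// subr_ge0.
have F2 : `|mu - h| * (g * K) <= q ^+ n * (g * K) by rewrite ler_wpM2r// mulr_ge0.
have -> : C * h ^+ 2 + b * q ^+ n = D * q ^+ n + D * q ^+ n + h * (g * (E * q ^+ n)) +
   C * (h ^+ 2 + (3 * h + 2) * q ^+ n) + q ^+ n * (g * K) by rewrite /b; ring.
by rewrite lerD// lerD2l.
Qed.

End Scheme.

(** * Smoothness in time from expansions in all C^k *)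

Section Smooth.
Variable R : realType.
Local Notation e2 := (@e2 R).
Local Notation e3 := (@e3 R).
Implicit Types (f g : R * R -> R).
Variables (G : (R * R -> R) -> R * R -> R) (S : R -> R * R -> R).

(** Closed under composition and containing G and the partial derivatives, so that every mixed
    space-time derivative of S at positive times has the form O (S t) for such an O. Linearity is
    stated on the combination occurring in the expansion in h. *)
Definition smooth_op (O : (R * R -> R) -> R * R -> R) : Prop :=
  [/\ (forall f, Cb f -> Cb (O f)),
      (forall f g k (h : R), Cb f -> Cb g -> Cb k ->
         O (fun x => f x - g x - h * k x) = (fun x => O f x - O g x - h * O k x)) &
      (forall k, exists j C, forall f M, Cb f -> bnd j f M -> bnd k (O f) (C * M))].

Lemma smooth_op_id : smooth_op id.
Proof. by split=> // k; exists k, 1 => f M _; rewrite mul1r. Qed.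

Lemma smooth_op_comp O O' : smooth_op O -> smooth_op O' -> smooth_op (O \o O').
Proof.
move=> [c l b] [c' l' b']; split.
- by move=> f Hf; apply: c; exact: c'.
- by move=> f g k h Hf Hg Hk /=; rewrite l'// l//; exact: c'.
- move=> k; have [j [C H]] := b k; have [j' [C' H']] := b' j.
  exists j', (C * C') => f M Hf bf /=.
  by rewrite -mulrA; apply: H; [exact: c'|exact: H'].
Qed.

Lemma smooth_op_pd i : smooth_op (pd (e2 i)).
Proof.
split.
- by move=> f; exact: Cb_pd.
- move=> f g k h Hf Hg Hk; rewrite pdB ?pdB ?pdZ//; first exact: CbB.
  exact: CbZ.
- by move=> k; exists k.+1, 1 => f M _ bf; rewrite mul1r; exact: bnd_pd.
Qed.

Hypothesis G_op : smooth_op G.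
Hypothesis S_Cb : forall t : R, 0 <= t -> Cb (S t).
Hypothesis S_bnd : forall k (T : R), exists K : R, 0 <= K /\ forall t, 0 <= t <= T -> bnd k (S t) K.
Hypothesis S_exp : forall k (T : R), exists K : R, 0 <= K /\ forall t h : R, 0 <= t -> 0 <= h -> t + h <= T ->
  bnd k (fun x => S (t + h) x - S t x - h * G (S t) x) (K * h ^+ 2).

Lemma op_bound O k T : smooth_op O -> exists K, 0 <= K /\ forall t, 0 <= t <= T -> bnd k (O (S t)) K.
Proof.
move=> [c l b]; have [j [C H]] := b k; have [K [K0 HK]] := S_bnd j T.
exists (`|C| * K); split; first by rewrite mulr_ge0.
move=> t t0T; have Ct : Cb (S t) by apply: S_Cb; case/andP: t0T.
apply: (bnd_le (leqnn k) _ (H _ _ Ct (HK t t0T))).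
by rewrite ler_wpM2r// ler_norm.
Qed.

Lemma op_expansion O T : smooth_op O -> exists K, 0 <= K /\ forall t h x, 0 <= t -> 0 <= h -> t + h <= T ->
  `|O (S (t + h)) x - O (S t) x - h * O (G (S t)) x| <= K * h ^+ 2.
Proof.
move=> [c l b]; have [j [C H]] := b 0%N; have [K [K0 HK]] := S_exp j T.
have [cG lG bG] := G_op.
exists (`|C| * K); split; first by rewrite mulr_ge0.
move=> t h x t0 h0 thT.
have C1 : Cb (S (t + h)) by apply: S_Cb; rewrite addr_ge0.
have C2 := S_Cb t0; have C3 := cG _ C2.
have CC : Cb (fun x => S (t + h) x - S t x - h * G (S t) x) by apply: CbB; [exact: CbB|exact: CbZ].
have := bnd_abs (H _ _ CC (HK t h t0 h0 thT)) x.
rewrite l// => B; apply: le_trans B _.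
by rewrite mulrA ler_wpM2r ?sqr_ge0// ler_wpM2r// ler_norm.
Qed.

Lemma op_lip O T : smooth_op O -> exists K, 0 <= K /\ forall t t' x, 0 <= t <= T -> 0 <= t' <= T ->
  `|O (S t') x - O (S t) x| <= K * `|t' - t|.
Proof.
move=> HO; have [K [K0 HK]] := op_expansion T HO.
have [L [L0 HL]] := op_bound 0 T (smooth_op_comp HO G_op).
exists (L + K * `|T|); split; first by rewrite addr_ge0// mulr_ge0.
move=> t t' x tT t'T.
wlog tt : t t' tT t'T / t <= t'.
  move=> W; have [|/ltW] := leP t t'; first exact: W.
  by move/(W _ _ t'T tT); rewrite distrC (distrC t).
have /andP[a b] := tT; have /andP[c d] := t'T.
have h0 : 0 <= t' - t by rewrite subr_ge0.
have := HK t (t' - t) x a h0; rewrite subrKC => /(_ d) B.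
have B2 := bnd_abs (HL t tT) x; rewrite /= in B2.
rewrite (ger0_norm h0).
rewrite -(subrK ((t' - t) * O (G (S t)) x) (O (S t') x - O (S t) x)).
apply: le_trans (ler_normD _ _) _; rewrite (mulrDl L) [leLHS]addrC; apply: lerD.
  by rewrite normrM (ger0_norm h0) mulrC ler_wpM2r.
apply: le_trans B _; rewrite expr2 mulrA ler_wpM2r// ler_wpM2l//.
by apply: le_trans (ler_norm T); lra.
Qed.

(** [op_expansion] only looks forward. For h < 0 it is started at t + h, and [op_lip] moves the
    generator term back to t at the cost of another h^2; the restriction |h| < t keeps t + h in
    range. *)
Lemma op_time_quad O t x : smooth_op O -> 0 < t -> exists K, forall h, `|h| < Num.min t 1 ->
  `|O (S (t + h)) x - O (S t) x - h * O (G (S t)) x| <= K * h ^+ 2.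
Proof.
move=> HO t0; have [K [K0 HK]] := op_expansion (t + 1) HO.
have [L [L0 HL]] := op_lip (t + 1) (smooth_op_comp HO G_op).
exists (K + L) => h; rewrite lt_min => /andP[ht h1].
have [h0|h0] := leP 0 h.
  rewrite ger0_norm// in ht h1.
  have h1' : t + h <= t + 1 by rewrite lerD2l ltW.
  by apply: le_trans (HK t h x (ltW t0) h0 h1') _; rewrite ler_wpM2r ?sqr_ge0// lerDl.
rewrite ltr0_norm// in ht h1.
have th0 : 0 <= t + h by lra.
have nh0 : 0 <= - h by lra.
have := HK (t + h) (- h) x th0 nh0; rewrite addrK => /(_ _)/wrap[|B]; first by lra.
have := HL t (t + h) x; rewrite addrAC subrr add0r => /(_ _ _)/wrap[||B2]; [by lra|by lra|].
rewrite /= in B2; rewrite (ltr0_norm h0) in B2.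
have -> : O (S (t + h)) x - O (S t) x - h * O (G (S t)) x =
  - (O (S t) x - O (S (t + h)) x - (- h) * O (G (S (t + h))) x) + h * (O (G (S (t + h))) x - O (G (S t)) x) by ring.
apply: le_trans (ler_normD _ _) _; rewrite normrN mulrDl lerD//.
  by rewrite sqrrN in B.
rewrite normrM ltr0_norm//.
have -> : L * h ^+ 2 = (- h) * (L * (- h)) by ring.
by rewrite ler_wpM2l.
Qed.

Lemma e3_shift0 (q : R * (R * R)) (h : R) : q + h *: e3 ord0 = (q.1 + h, q.2).
Proof.
case: q => a [b c]; rewrite /e3/=.
have -> : (a, (b, c)) + h *: (1, (0, 0)) = (a + h * 1, (b + h * 0, c + h * 0)) :> R * (R * R) by [].
by rewrite mulr1 !mulr0 !addr0.
Qed.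

Lemma e3_shift (q : R * (R * R)) (h : R) (i : 'I_2) : q + h *: e3 (lift ord0 i) = (q.1, q.2 + h *: e2 i).
Proof.
case: q => a x; have -> : e3 (lift ord0 i) = (0, e2 i).
  by move: i; apply: ord2_ind.
have -> : (a, x) + h *: (0, e2 i) = (a + h * 0, x + h *: e2 i) :> R * (R * R) by [].
by rewrite mulr0 addr0.
Qed.

(** The operator that represents one more derivative: [unlift] separates the time direction, where
    the evolution contributes G, from the two space directions. *)
Definition opd (O : (R * R -> R) -> R * R -> R) (i : 'I_3) : (R * R -> R) -> R * R -> R :=
  if unlift ord0 i is Some j then pd (e2 j) \o O else O \o G.

Lemma opd_smooth O i : smooth_op O -> smooth_op (opd O i).
Proof.
move=> HO; rewrite /opd; case: unliftP => [j _|_].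
  exact: smooth_op_comp (smooth_op_pd j) HO.
exact: smooth_op_comp HO G_op.
Qed.

Lemma opd_derive O i (F : R * (R * R) -> R) q : smooth_op O ->
  (forall q, 0 < q.1 -> F q = O (S q.1) q.2) -> 0 < q.1 ->
  is_derive (0 : R) 1 (fun h : R => F (q + h *: e3 i)) (opd O i (S q.1) q.2).
Proof.
move=> HO HF q0; rewrite /opd; case: unliftP => [j ->|->].
  have [c _ _] := HO; have CO := c _ (S_Cb (ltW q0)); have [M bM] := CO 2%N.
  apply: (is_derive_quad (C := M) ltr01) => h _.
  rewrite add0r scale0r addr0 e3_shift !HF//=; exact: bnd_quad.
have [K HK] := op_time_quad q.2 HO q0.
have m0 : 0 < Num.min q.1 1 by rewrite lt_min q0 ltr01.
apply: (is_derive_quad (C := K) m0) => h hm.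
rewrite add0r scale0r addr0 e3_shift0 !HF//=; first exact: HK.
by move: hm; rewrite lt_min ltr_norml => /andP[/andP[? ?] _]; lra.
Qed.

Lemma op_continuous O T : smooth_op O -> forall q : R * (R * R), 0 <= q.1 < T ->
  (fun q : R * (R * R) => O (S q.1) q.2) @ (within [set q : R * (R * R) | 0 <= q.1] (nbhs q)) --> O (S q.1) q.2.
Proof.
move=> HO q /andP[q0 qT].
have [K [K0 HK]] := op_lip T HO; have [M [M0 HM]] := op_bound 1 T HO.
apply/cvgrPdist_le => e e0.
pose d := e / (K + 2 * M + 1).
have p : 0 < K + 2 * M + 1 by lra.
have d0 : 0 < d by rewrite divr_gt0.
have m0 : 0 < Num.min d (T - q.1) by rewrite lt_min d0 subr_gt0.
apply/(@nbhs_ballP R (R * (R * R))%type); exists (Num.min d (T - q.1)) => //= r [/= h1 [/= h2 h3]] r0.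
rewrite /ball/= !lt_min in h1 h2 h3.
have /andP[a1 b1] := h1; have /andP[a2 _] := h2; have /andP[a3 _] := h3.
have rT : 0 <= r.1 <= T.
  rewrite r0/=; move: b1; rewrite ltr_norml => /andP[? _]; lra.
have qT' : 0 <= q.1 <= T by rewrite q0 ltW.
rewrite -(subrKA (O (S q.1) r.2)) (le_trans (ler_normD _ _))//.
have B1 := HK r.1 q.1 r.2 rT qT'.
have B2 := bnd_lip r.2 q.2 (HM q.1 qT').
apply: le_trans (lerD B2 B1) _.
apply: (@le_trans _ _ (M * (d + d) + K * d)).
  by apply: lerD; rewrite ler_wpM2l//; [apply: lerD; exact: ltW|exact: ltW].
rewrite (_ : _ + _ = (K + 2 * M) * d); last by ring.
rewrite /d mulrA ler_pdivrMr//.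
by rewrite mulrC ler_wpM2l ?(ltW e0)// lerDl.
Qed.

Lemma op_continuous_at O (F : R * (R * R) -> R) q : smooth_op O ->
  (forall q, 0 < q.1 -> F q = O (S q.1) q.2) -> 0 < q.1 -> {for q, continuous F}.
Proof.
move=> HO HF q0; have q1 : 0 <= q.1 < q.1 + 1 by rewrite ltW// ltrDl ltr01.
have C := op_continuous HO q1.
have nq : nbhs q [set q : R * (R * R) | 0 < q.1].
  apply/(@nbhs_ballP R (R * (R * R))%type); exists q.1 => //= r [/= h1 _].
  by move: h1; rewrite /ball/= ltr_norml => /andP[_ ?]; lra.
suff : F x @[x --> q] --> O (S q.1) q.2 by rewrite -(HF q q0).
apply: cvg_trans C => A /= HA.
have : nbhs q (fun r => 0 <= r.1 -> A (O (S r.1) r.2)) by exact: HA.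
move=> HA'; change (nbhs q (fun r => A (F r))).
by apply: filterS2 nq HA' => r r0 Hr; rewrite HF//; apply: Hr; exact: ltW.
Qed.

Lemma iter_smooth w : exists O, smooth_op O /\
  forall q, 0 < q.1 -> iter_pd e3 w (fun q : R * (R * R) => S q.1 q.2) q = O (S q.1) q.2.
Proof.
elim: w => [|i w [ O [HO H]]]; first by exists id; split=> //; exact: smooth_op_id.
exists (opd O i); split; first exact: opd_smooth.
move=> q q0 /=.
Transparent pd.
rewrite /pd derive1E; have := opd_derive i HO H q0 => h; exact: derive_val.
Opaque pd.
Qed.

Lemma family_smooth : smooth_on e3 [set q | 0 < q.1] (fun q : R * (R * R) => S q.1 q.2).
Proof.
move=> w q /= q0; have [ O [HO H]] := iter_smooth w.
split; first exact: op_continuous_at HO H q0.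
by move=> i; apply: (@ex_derive _ _ _ _ _ _ _ (opd_derive i HO H q0)).
Qed.

Lemma family_continuous : {within [set q : R * (R * R) | 0 <= q.1],
  continuous (fun q : R * (R * R) => S q.1 q.2)}.
Proof.
apply/subspace_continuousP => q /= q0.
have q1 : 0 <= q.1 < q.1 + 1 by rewrite q0 ltrDl ltr01.
exact: (op_continuous smooth_op_id q1).
Qed.

Lemma family_derive1 t x : 0 < t -> derive1 (fun tau => S tau x) t = G (S t) x.
Proof.
move=> t0; have [K HK] := op_time_quad x smooth_op_id t0.
have m0 : 0 < Num.min t 1 by rewrite lt_min t0 ltr01.
have h : is_derive t 1 (fun tau => S tau x) (G (S t) x) by apply: (is_derive_quad (C := K) m0).
by rewrite derive1E; exact: derive_val.
Qed.

End Smooth.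

(** * Existence of smooth solutions *)

Section Existence.
Variable R : realType.
Local Notation e2 := (@e2 R).
Local Notation i0 := (ord0 : 'I_2).
Local Notation i1 := (lift ord0 ord0 : 'I_2).
Implicit Types (f g : R * R -> R).
Variable s : R.
Hypotheses (s_ge : 1 / 2 <= s) (s_lt : s < 1).
Variables v1 v2 : R * R -> R.
Hypotheses (Cv1 : Cb v1) (Cv2 : Cb v2).

Let s01 : 0 < s < 1. Proof. by rewrite s_lt andbT; move: s_ge; lra. Qed.
Let s0 : 0 < s. Proof. by case/andP: s01. Qed.

Let gen f (x : R * R) : R := - (Bop v1 v2 f x + Lop s f x).

(** With en n = (2^-n)^(1/(2s)) the total jump rate is 2^n times 2 c0 Kfar, so this initial step
    meets the convex-average condition on every level. *)
Let t0 : R := (2 * c0 s * Kfar s + 1)^-1.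
Let cK : 0 <= 2 * c0 s * Kfar s.
Proof. by rewrite mulr_ge0 ?Kfar_ge0// mulr_ge0// c0_ge0. Qed.
Let t00 : 0 < t0. Proof. by rewrite invr_gt0 ltr_wpDl. Qed.
Let t01 : t0 <= 1. Proof. by rewrite invf_le1 ?ltr_wpDl// lerDr. Qed.
Let ta (n : nat) : R := t0 * 2^-1 ^+ n.
(** The truncation error en^(2 - 2s) is exactly q^n. The scheme asks for q >= 1/2, which is (1 -
    s)/s <= 1, that is s >= 1/2; and q < 1 because s < 1. *)
Let q : R := 2^-1 `^ ((1 - s) / s).
Let en (n : nat) : R := (2^-1 ^+ n) `^ (2 * s)^-1.

Let h01 : 0 < (2^-1 : R) <= 1. Proof. by apply/andP; split; lra. Qed.

Let half0 : 0 < (2^-1 : R). Proof. by rewrite invr_gt0. Qed.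

Let q0 : 2^-1 <= q.
Proof.
rewrite -[leLHS]powRr1//; apply: ger_powR => //.
by rewrite ler_pdivrMr// mul1r; move: s_ge; lra.
Qed.

Let q1 : q < 1.
Proof.
have r0 : 0 < (1 - s) / s by rewrite divr_gt0// subr_gt0.
have /andP[h0 _] := h01.
have := @gt0_ltr_powR R _ r0 2^-1 1; rewrite powR1; apply; rewrite ?nnegrE//.
by lra.
Qed.

Let q_gt0 : 0 < q. Proof. exact: powR_gt0. Qed.

Let ta0 n : 0 < ta n. Proof. by rewrite mulr_gt0// exprn_gt0. Qed.
Let half1 n : 2^-1 ^+ n <= 1 :> R. Proof. by have /andP[/ltW ? ?] := h01; exact: exprn_ile1. Qed.
Let ta01 n : 0 <= ta n <= 1.
Proof. by rewrite (ltW (ta0 n))/= mulr_ile1// ltW. Qed.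
Let ta_q n : ta n <= q ^+ n.
Proof.
rewrite /ta -[leRHS]mul1r; apply: ler_pM; [exact: ltW|by rewrite exprn_ge0 ?invr_ge0|exact: t01|].
by rewrite lerXn2r ?nnegrE ?invr_ge0// ltW.
Qed.

Let en0 n : 0 < en n. Proof. by apply: powR_gt0; rewrite exprn_gt0. Qed.
Let en1 n : en n <= 1.
Proof.
have r0 : 0 <= (2 * s)^-1 by rewrite invr_ge0 mulr_ge0// ltW.
have := @ge0_ler_powR R _ r0 (2^-1 ^+ n) 1; rewrite powR1; by apply; rewrite ?nnegrE.
Qed.

Let en_rate n : 2 * c0 s * ta n * (Kfar s * en n `^ (- (2 * s))) <= 1.
Proof.
have -> : en n `^ (- (2 * s)) = (2^-1 ^+ n)^-1.
  rewrite /en powRN -powRrM mulVf ?powRr1 ?exprn_ge0//.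
  by rewrite mulf_neq0// gt_eqF.
have -> : 2 * c0 s * ta n * (Kfar s * (2^-1 ^+ n)^-1) = (2 * c0 s * Kfar s) * t0.
  rewrite /ta; have : (2^-1 : R) ^+ n != 0 by rewrite gt_eqF// exprn_gt0.
  by move=> h; field.
by rewrite /t0 ler_pdivrMr ?ltr_wpDl// mul1r lerDl.
Qed.

Let en_q n : KD s (en n) = c0 s * (4 * Knear s) * q ^+ n.
Proof.
rewrite /KD; have -> : en n `^ (2 - 2 * s) = q ^+ n.
  rewrite /en /q -powRrM -[(2^-1) ^+ n](powR_mulrn n (ltW half0)) -powRrM.
  rewrite -[RHS](powR_mulrn n (powR_ge0 _ _)) -powRrM; congr (_ `^ _).
  by field; rewrite gt_eqF.
by ring.
Qed.

Let stp n f : R * R -> R := Aop v1 v2 (ta n) (Qop s (ta n) (en n) f).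

Let Q_Cb n f : Cb f -> Cb (Qop s (ta n) (en n) f).
Proof. by move=> Hf; apply: (Qop_Cb s01). Qed.

Let Q_bnd n k f M : Cb f -> bnd k f M -> bnd k (Qop s (ta n) (en n) f) M.
Proof. by move=> Hf bf; exact: (Qop_bnd s01 (en0 n) (en1 n) (ltW (ta0 n)) (en_rate n) Hf bf). Qed.

Let stp_Cb n f : Cb f -> Cb (stp n f).
Proof. by move=> Hf; apply: Aop_Cb => //; exact: Q_Cb. Qed.

Let Q_sub n f g : Cb f -> Cb g ->
  Qop s (ta n) (en n) (fun y => f y - g y) = (fun x => Qop s (ta n) (en n) f x - Qop s (ta n) (en n) g x).
Proof.
move=> Hf Hg; apply/funext => x; have [M bf] := Hf 1%N; have [N bg] := Hg 1%N.
rewrite /Qop; have := Le_lin s01 (-1) x (en0 n) bf bg.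
rewrite (_ : (fun y => f y + -1 * g y) = (fun y => f y - g y)); last by apply/funext => y; rewrite mulN1r.
by move=> ->; ring.
Qed.

Let stp_sub n f g x : Cb f -> Cb g -> stp n (fun y => f y - g y) x = stp n f x - stp n g x.
Proof. by move=> Hf Hg; rewrite /stp Q_sub. Qed.

Let stp_abs (M : R) n f : Cb f -> (forall x, `|f x| <= M) -> forall x, `|stp n f x| <= M.
Proof.
move=> Hf HM x; apply: Aop_abs; have [N b1] := Hf 1%N.
by apply: (Qop_abs s01 (en0 n) (ltW (ta0 n)) (en_rate n) b1).
Qed.

Let stp_bnd k : exists C, 0 <= C /\
  forall n f M, Cb f -> bnd k f M -> bnd k (stp n f) ((1 + C * ta n) * M).
Proof.
have [C [C0 H]] := Aop_bnd Cv1 Cv2 k; exists C; split=> // n f M Hf bf.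
by apply: H => //; [exact: Q_Cb|exact: Q_bnd].
Qed.

Let stp_step k : exists C, 0 <= C /\
  forall n f M, Cb f -> bnd (k + 5) f M -> bnd k (fun x => stp n f x - f x) (C * ta n * M).
Proof.
have [C [C0 H]] := Aop_step Cv1 Cv2 k.
exists (C + KL s); split; first by rewrite addr_ge0// KL_ge0.
move=> n f M Hf bf.
have b1 : bnd k.+1 f M by apply: bnd_le bf; rewrite // -addn1 leq_add2l.
have b4 : bnd (k + 4) f M by apply: bnd_le bf; rewrite // leq_add2l.
have B1 := H _ M (ta n) (Q_Cb n Hf) (ta01 n) (Q_bnd n Hf b1).
have B2 := Qop_step s01 (en0 n) (en1 n) (ltW (ta0 n)) b4.
have := bndD B1 B2.
rewrite (_ : (fun x => _) = (fun x => stp n f x - f x)); last first.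
  by apply/funext => x; rewrite /stp; ring.
by apply: (bnd_le (leqnn k)); apply: eq_ler; ring.
Qed.

Let Bop_sub f g : Cb f -> Cb g -> Bop v1 v2 (fun y => f y - g y) = (fun x => Bop v1 v2 f x - Bop v1 v2 g x).
Proof. by move=> Hf Hg; apply/funext => x; rewrite /Bop !pdB//; ring. Qed.

(** Three errors add up: the Taylor error of the transport step, the truncation error of the
    diffusion step, and transport acting on [Qop f - f]. The first and the last are O((ta n)^2),
    absorbed by ta n <= q^n. *)
Let stp_cons k : exists C, 0 <= C /\
  forall n f M, Cb f -> bnd (k + 5) f M ->
   bnd k (fun x => stp n f x - f x - ta n * gen f x) (C * (ta n * q ^+ n) * M).
Proof.
have [C [C_ge0 H]] := Aop_taylor Cv1 Cv2 k; have [D [D0 HD]] := Bop_bnd Cv1 Cv2 k.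
have KN : 0 <= c0 s * (4 * Knear s) by rewrite mulr_ge0 ?c0_ge0// mulr_ge0// Knear_ge0.
exists (C + c0 s * (4 * Knear s) + D * KL s); split.
  by apply: addr_ge0; [exact: addr_ge0|rewrite mulr_ge0// KL_ge0].
move=> n f M Hf bf; have M0 := bnd_ge0 bf.
have b2 : bnd k.+2 f M by apply: bnd_le bf; rewrite // -addn2 leq_add2l.
have b4 : bnd (k + 4) f M by apply: bnd_le bf; rewrite // leq_add2l.
have b5 : bnd (k.+1 + 4) f M by rewrite addSnnS.
have B1 := H _ M (ta n) (Q_Cb n Hf) (ta01 n) (Q_bnd n Hf b2).
have B2 := Qop_consistent s01 (en0 n) (en1 n) (ltW (ta0 n)) b4.
have B3 := bndZ (ta n) (HD _ _ (Qop_step s01 (en0 n) (en1 n) (ltW (ta0 n)) b5)).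
have := bndB (bndD B1 B2) B3.
rewrite (_ : (fun x => _) = (fun x => stp n f x - f x - ta n * gen f x)); last first.
  by apply/funext => x; rewrite (Bop_sub (Q_Cb n Hf) Hf) /stp /gen; ring.
apply: (bnd_le (leqnn k)); rewrite (ger0_norm (ltW (ta0 n))) en_q.
have T : ta n * ta n <= ta n * q ^+ n by apply: ler_wpM2l; [exact: ltW|exact: ta_q].
have E1 := ler_wpM2l (mulr_ge0 C_ge0 M0) T.
have E2 := ler_wpM2l (mulr_ge0 (mulr_ge0 D0 (KL_ge0 s01)) M0) T.
have -> : (C + c0 s * (4 * Knear s) + D * KL s) * (ta n * q ^+ n) * M =
  C * M * (ta n * q ^+ n) + ta n * (c0 s * (4 * Knear s) * q ^+ n * M) + D * KL s * M * (ta n * q ^+ n) by ring.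
have -> : C * ta n ^+ 2 * M = C * M * (ta n * ta n) by ring.
have -> : ta n * (D * (ta n * (KL s * M))) = D * KL s * M * (ta n * ta n) by ring.
by rewrite lerD// lerD2r.
Qed.

Let gen_op : smooth_op gen.
Proof.
have LA := Lop_adm s01; split.
- move=> f Hf; have := CbZ (-1) (CbD (Bop_Cb Cv1 Cv2 Hf) (adm_Cb LA Hf)).
  by under eq_fun do rewrite mulN1r.
- move=> f g k h Hf Hg Hk; apply/funext => x.
  have [M bf] := Hf 2%N; have [N bg] := Hg 2%N; have [K bk] := Hk 2%N.
  have [L _ _] := LA.
  have E1 := L _ _ _ _ (- h) x (bndD bf (bndZ (-1) bg)) bk.
  have E2 := L _ _ _ _ (-1) x bf bg.
  rewrite E2 in E1.
  rewrite /gen (_ : (fun x => f x - g x - h * k x) = (fun y => f y + -1 * g y + - h * k y)); last first.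
    by apply/funext => y; ring.
  rewrite E1.
  have -> : Bop v1 v2 (fun y => f y + -1 * g y + - h * k y) x =
     Bop v1 v2 f x - Bop v1 v2 g x - h * Bop v1 v2 k x.
    rewrite /Bop !pdD ?pdZ//; do ?[exact: CbZ|by apply: CbD => //; exact: CbZ].
    by ring.
  move: (Bop v1 v2 f x) (Bop v1 v2 g x) (Bop v1 v2 k x) (Lop s f x) (Lop s g x) (Lop s k x) => *.
  by ring.
- move=> k; have [D [D0 HD]] := Bop_bnd Cv1 Cv2 k.
  exists (k + 4)%N, (D + KL s) => f M Hf bf.
  have b1 : bnd k.+1 f M by apply: bnd_le bf; rewrite // -addn1 leq_add2l.
  have := bndN (bndD (HD _ _ b1) (adm_bnd LA bf)).
  by apply: (bnd_le (leqnn k)); rewrite mulrDl.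
Qed.

Let gen_sub f g x : Cb f -> Cb g -> gen (fun y => f y - g y) x = gen f x - gen g x.
Proof.
move=> Hf Hg; have [_ L _] := gen_op; have := L f g f 0 Hf Hg Hf.
rewrite (_ : (fun x => f x - g x - 0 * f x) = (fun x => f x - g x)); last first.
  by apply/funext => y; rewrite mul0r subr0.
by move=> ->; rewrite mul0r subr0.
Qed.

Let gen_bnd k : exists C, 0 <= C /\
  forall f M, Cb f -> bnd (k + 5) f M -> bnd k (gen f) (C * M).
Proof.
have LA := Lop_adm s01; have [D [D0 HD]] := Bop_bnd Cv1 Cv2 k.
exists (D + KL s); split; first by rewrite addr_ge0// KL_ge0.
move=> f M Hf bf.
have b1 : bnd k.+1 f M by apply: bnd_le bf; rewrite // -addn1 leq_add2l.
have b4 : bnd (k + 4) f M by apply: bnd_le bf; rewrite // leq_add2l.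
have := bndN (bndD (HD _ _ b1) (adm_bnd LA b4)).
by apply: (bnd_le (leqnn k)); rewrite mulrDl.
Qed.

Theorem exists_smooth_solution (theta0 : R * R -> R) : Cb theta0 ->
  exists theta, is_smooth_solution s (fun x => (v1 x, v2 x)) theta0 theta.
Proof.
move=> C0; have [gC _ _] := gen_op.
pose S := Sol stp t0 theta0.
have SC t : 0 <= t -> Cb (S t).
  exact: (Sol_Cb t00 t01 q0 q1 stp_Cb stp_sub stp_bnd stp_step stp_cons C0).
have SB := Sol_bnd t00 t01 q0 q1 stp_Cb stp_sub stp_bnd stp_step stp_cons C0.
have SE := Sol_expansion t00 t01 q0 q1 stp_Cb stp_sub stp_bnd stp_step stp_cons gen_sub gen_bnd C0.
exists S; split; [|split; [|split; [|split]]].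
- exact: (family_smooth gen_op SC SB SE).
- exact: (family_continuous gen_op SC SB SE).
- exact: Sol0.
- have [M b0] := C0 0%N; exists M => t x t_ge0.
  apply: (Sol_abs t00 t01 q0 q1 stp_Cb stp_sub stp_bnd stp_step stp_cons C0 t_ge0).
    by move=> n f; exact: stp_abs.
  exact: bnd_abs b0.
- move=> t x t_gt0; have [M b2] := SC t (ltW t_gt0) 2%N.
  exists (Lop s (S t) x); split; first exact: fraclap_Lop b2.
  rewrite (family_derive1 gen_op SC SB SE x t_gt0) /gen /Bop /dx1 /dx2 /=.
  by rewrite -addrA addNr.
Qed.

End Existence.

(** * Comparison *)

Section OneSided.
Variable R : realType.

Lemma derive_ge_right (g : R -> R) (t d l A del : R) : is_derive t 1 g d -> 0 < del ->
  (forall h, 0 < h < del -> l * h - A * h ^+ 2 <= g (t + h) - g t) -> l <= d.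
Proof.
move=> Hg del0 H.
have L1 := cvg_dnbhs_at_right ((is_derive_cvg _ _ _).1 Hg).
have L2 : l - A * h @[h --> (0 : R)^'+] --> l.
  rewrite -[X in _ --> X]subr0; apply: cvgB; first exact: cvg_cst.
  rewrite -[X in _ --> X](mulr0 A); apply: cvgM; first exact: cvg_cst.
  by apply: cvg_at_right_filter; exact: cvg_id.
apply: (ler_cvg_to L2 L1); near=> h.
have h0 : 0 < h by near: h; exact: nbhs_right_gt.
have hd : h < del by near: h; exact: nbhs_right_lt.
rewrite ler_pdivlMl// (addrC h); apply: le_trans (H h _); last by rewrite h0 hd.
by apply: eq_ler; ring.
Unshelve. all: by end_near. Qed.

Lemma derive_le_left (g : R -> R) (t d l A del : R) : is_derive t 1 g d -> 0 < del ->
  (forall h, 0 < h < del -> l * h - A * h ^+ 2 <= g (t - h) - g t) -> d <= - l.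
Proof.
move=> Hg del0 H.
have dN : is_derive (- t) 1 (fun x : R => g (- x)) (- d).
  have dn : is_derive (- t) 1 (-%R : R -> R) (- 1) by exact: is_deriveNid.
  have Hg' : is_derive (- (- t)) 1 g d by rewrite opprK.
  have := @is_derive1_comp R g -%R (- t) _ _ Hg' dn.
  by rewrite mulrN1.
rewrite lerNr; apply: (derive_ge_right dN del0) => h h0.
by rewrite opprD opprK; exact: H.
Qed.

Lemma derive_touch (g : R -> R) (t d l A : R) : is_derive t 1 g d ->
  (forall h, l * h - A * h ^+ 2 <= g (t + h) - g t) -> d = l.
Proof.
move=> Hg H; apply/eqP; rewrite eq_le; apply/andP; split.
  rewrite -[l]opprK; apply: (derive_le_left (A := A) Hg ltr01) => h _.
  by rewrite mulNr -mulrN -sqrrN; exact: H.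
by apply: (derive_ge_right (A := A) Hg ltr01) => h _; exact: H.
Qed.

End OneSided.

Section Comparison.
Variable R : realType.
Local Notation e2 := (@e2 R).
Local Notation l2 := ((@lebesgue_measure R) \x (@lebesgue_measure R))%E.
Variable s : R.
Hypotheses (s_ge : 1 / 2 <= s) (s_lt : s < 1).
Let s01 : 0 < s < 1. Proof. by rewrite s_lt andbT; move: s_ge; lra. Qed.
Variables v1 v2 : R * R -> R.

(** Touching by a paraboloid from below bounds the second difference by 2 A |z|^2, the linear parts
    cancelling between z and - z; far away it is at most 2 B. The resulting bound does not see the
    truncation radius. *)
Lemma fraclap_touch (f : R * R -> R) (M : R) (x : R * R) (L l1 l2 A B r : R) :
  continuous f -> (forall y, `|f y| <= M) -> fraclap_at s f x L ->
  0 <= A -> 0 <= B -> 0 < r ->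
  (forall z, l1 * z.1 + l2 * z.2 - A * enorm2 z ^+ 2 <= f (x + z) - f x) ->
  (forall y, f x - f y <= B) ->
  L <= c0 s * (2 * A * (Knear s * r `^ (2 - 2 * s)) + 2 * B * (Kfar s * r `^ (- (2 * s)))).
Proof.
move=> cf fM [_ HL] A0 B0 r0 Hz Hy.
apply: (cvgr_to_le HL); near=> e.
have e0 : 0 < e by near: e; exact: nbhs_right_gt.
have er : e <= r by near: e; exact: nbhs_right_le.
have [_ E] := fraclap_integral s01 x cf fM e0.
suff : c0 s * Ik s e (sdiff f x) <=
    c0 s * (2 * A * (Knear s * r `^ (2 - 2 * s)) + 2 * B * (Kfar s * r `^ (- (2 * s)))).
  by rewrite {1}/c0 -mulrA -E.
rewrite ler_wpM2l ?c0_ge0//.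
have M0 : 0 <= M by apply: le_trans (fM 0).
apply: (Ik_le (B0 := 4 * M) s01 e0 er); rewrite ?mulr_ge0//.
- exact: measurable_sdiff.
- move=> z; rewrite /sdiff; have h1 := fM x; have h2 := fM (x + z); have h3 := fM (x - z).
  apply: le_trans (ler_normB _ _) _; have := ler_normB (2 * f x) (f (x + z)).
  rewrite normrM ger0_norm// => h4; lra.
- move=> z; have h1 := Hz z; have h2 := Hz (- z).
  rewrite enorm2N /= !mulrN in h2; rewrite /sdiff; lra.
- by move=> z; rewrite /sdiff; have h1 := Hy (x + z); have h2 := Hy (x - z); lra.
Unshelve. all: by end_near. Qed.

(* All that comparison needs of a solution: pointwise first derivatives instead of smoothness. *)
Definition wsol (th : R -> R * R -> R) : Prop :=
  [/\ {within [set q : R * (R * R) | 0 <= q.1], continuous (fun q : R * (R * R) => th q.1 q.2)},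
      (exists M : R, forall t x, 0 <= t -> `|th t x| <= M) &
      (forall (t : R) x, 0 < t -> exists L dt d1 d2 : R,
        [/\ fraclap_at s (th t) x L, is_derive t 1 (th ^~ x) dt,
            is_derive (0 : R) 1 (fun h : R => th t (x + h *: e2 ord0)) d1,
            is_derive (0 : R) 1 (fun h : R => th t (x + h *: e2 (lift ord0 ord0))) d2 &
            dt + (v1 x * d1 + v2 x * d2) + L = 0])].

Lemma wsol_slice th t : wsol th -> 0 <= t -> continuous (th t).
Proof.
move=> [+ _ _] t0 => /subspace_continuousP cw x.
have := cw (t, x) t0; rewrite /from_subspace/=.
move=> C A HA; have := C A HA.
move=> /= H; have {}H : nbhs (t, x) (fun q : R * (R * R) => 0 <= q.1 -> A (th q.1 q.2)) by exact: H.
have P : (fun y : R * R => (t, y)) @ x --> (t, x).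
  exact: (cvg_pair (cvg_cst t) cvg_id).
have := P _ H; rewrite /nbhs/=; apply: filterS => y /=; exact.
Qed.

Lemma wsol_touch th t x (M l1 l2 A B r : R) : wsol th -> 0 < t ->
  (forall y, `|th t y| <= M) -> 0 <= A -> 0 <= B -> 0 < r ->
  (forall z, l1 * z.1 + l2 * z.2 - A * enorm2 z ^+ 2 <= th t (x + z) - th t x) ->
  (forall y, th t x - th t y <= B) ->
  exists dt, is_derive t 1 (th ^~ x) dt /\
    - (v1 x * l1 + v2 x * l2) -
     c0 s * (2 * A * (Knear s * r `^ (2 - 2 * s)) + 2 * B * (Kfar s * r `^ (- (2 * s)))) <= dt.
Proof.
move=> Hw t0 HM A0 B0 r0 Hz Hy; have [_ _ /(_ t x t0)[L [dt [d1 [d2 [HL Hdt Hd1 Hd2 E]]]]]] := Hw.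
have HL' := fraclap_touch (wsol_slice Hw (ltW t0)) HM HL A0 B0 r0 Hz Hy.
have E1 : d1 = l1.
  apply: (derive_touch (A := A) Hd1) => h; have := Hz (h *: e2 ord0).
  by rewrite scale0r addr0 add0r enorm2_sq /e2/= /GRing.scale/= mulr1 !mulr0 expr0n/= !addr0.
have E2 : d2 = l2.
  apply: (derive_touch (A := A) Hd2) => h; have := Hz (h *: e2 (lift ord0 ord0)).
  by rewrite scale0r addr0 add0r enorm2_sq /e2/= /GRing.scale/= mulr1 !mulr0 expr0n/= !add0r.
exists dt; split=> //; rewrite -E1 -E2.
have -> : dt = - (v1 x * d1 + v2 x * d2) - L by lra.
by rewrite lerD2l lerN2.
Qed.

Lemma fraclapN (f : R * R -> R) x L : fraclap_at s f x L -> fraclap_at s (fun y => - f y) x (- L).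
Proof.
move=> [H1 H2].
have E : (fun y => (- f x - - f y) / (enorm2 (x - y)) `^ (2 + 2 * s)) =
   (fun y => - ((f x - f y) / (enorm2 (x - y)) `^ (2 + 2 * s))).
  by apply/funext => y; rewrite -mulNr; congr (_ / _); ring.
have mD e : measurable ([set y | e < enorm2 (x - y)] : set (measurableTypeR R * measurableTypeR R)).
  apply: open_measurable2.
  rewrite (_ : [set y | _] = (fun y => enorm2 (x - y)) @^-1` `]e, +oo[%classic); last first.
    by apply/seteqP; split => z; rewrite /= in_itv/= andbT.
  apply: open_comp; last exact: rray_open.
  move=> z _; apply: (@continuous_comp (R * R)%type (R * R)%type R (fun y => x - y) (@enorm2 R) z).
    by apply: cvgB; [exact: cvg_cst|exact: cvg_id].
  exact: continuous_enorm2.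
split.
  move=> e e0; have := integrableN (H1 e e0 : l2.-integrable _ _).
  apply: eq_integrable; first exact: mD.
  by move=> y _; have /= -> := congr1 (@^~ y) E.
rewrite E; apply: cvg_trans (cvgN H2); apply: near_eq_cvg; near=> e.
have e0 : 0 < e by near: e; exact: nbhs_right_gt.
rewrite /= -mulrN; congr (_ * _).
rewrite -mulN1r; have I := RintegralZl (-1) (mD e) (H1 e e0 : l2.-integrable _ _).
apply: esym; apply: etrans I; apply: eq_Rintegral => y _; rewrite mulN1r.
by [].
Unshelve. all: by end_near. Qed.

Lemma wsolN th : wsol th -> wsol (fun t x => - th t x).
Proof.
move=> [c [M HM] H]; split.
- by move=> q; apply: cvgN; exact: c.
- by exists M => t x t0; rewrite normrN; exact: HM.
- move=> t x t0; have [L [dt [d1 [d2 [HL Hdt Hd1 Hd2 E]]]]] := H t x t0.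
  exists (- L), (- dt), (- d1), (- d2); split.
  + exact: fraclapN.
  + exact: is_deriveN.
  + exact: is_deriveN.
  + exact: is_deriveN.
  + by rewrite !mulrN -!opprD E oppr0.
Qed.

Lemma box_compact (a b c : R) : compact (`[a, b]%classic `*` (`[- c, c]%classic `*` `[- c, c]%classic) : set (R * (R * R))).
Proof. by apply: compact_setX; [|apply: compact_setX]; exact: segment_compact. Qed.

(* Concavity of n |-> n / (r^2 + n) keeps bump below a paraboloid that touches it at any given point. *)
Definition bump (r : R) (y : R * R) : R := enorm2 y ^+ 2 / (r ^+ 2 + enorm2 y ^+ 2).

Lemma bump_touch (r d : R) (x z : R * R) : 0 < r -> d = r ^+ 2 + enorm2 x ^+ 2 ->
  bump r (x + z) - bump r x <= 2 * r ^+ 2 * x.1 / d ^+ 2 * z.1 + 2 * r ^+ 2 * x.2 / d ^+ 2 * z.2 + enorm2 z ^+ 2 / r ^+ 2.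
Proof.
move=> r0 dE; have r2 : 0 < r ^+ 2 by rewrite exprn_gt0.
have d0 : 0 < d by rewrite dE ltr_wpDr ?sqr_ge0.
set n := enorm2 (x + z) ^+ 2; have n0 : 0 <= n by rewrite sqr_ge0.
have En : n - enorm2 x ^+ 2 = 2 * (x.1 * z.1 + x.2 * z.2) + enorm2 z ^+ 2.
  by rewrite /n !enorm2_sq /=; ring.
set e := r ^+ 2 + n; have e0 : 0 < e by rewrite ltr_wpDr.
set D := n - enorm2 x ^+ 2 in En.
have eE : e = d + D by rewrite /e dE /D; ring.
have -> : bump r (x + z) - bump r x = r ^+ 2 * D / (e * d).
  rewrite /bump -/n -dE -/e.
  have -> : n = e - r ^+ 2 by rewrite /e; ring.
  have -> : enorm2 x ^+ 2 = d - r ^+ 2 by rewrite dE; ring.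
  rewrite eE; field; rewrite -eE; apply/andP; split; exact: lt0r_neq0.
have S1 : r ^+ 2 * D / (e * d) <= r ^+ 2 * D / d ^+ 2.
  rewrite -subr_ge0.
  have -> : r ^+ 2 * D / d ^+ 2 - r ^+ 2 * D / (e * d) = r ^+ 2 * D ^+ 2 / (d ^+ 2 * e).
    rewrite eE; field; rewrite -eE; apply/andP; split; exact: lt0r_neq0.
  by apply: divr_ge0; rewrite mulr_ge0 ?sqr_ge0// ltW.
apply: le_trans S1 _; rewrite En.
have -> : r ^+ 2 * (2 * (x.1 * z.1 + x.2 * z.2) + enorm2 z ^+ 2) / d ^+ 2 =
  2 * r ^+ 2 * x.1 / d ^+ 2 * z.1 + 2 * r ^+ 2 * x.2 / d ^+ 2 * z.2 + enorm2 z ^+ 2 * (r ^+ 2 / d ^+ 2).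
  by field; rewrite lt0r_neq0.
rewrite lerD2l ler_wpM2l ?sqr_ge0//.
rewrite ler_pdivrMr ?exprn_gt0// mulrC ler_pdivlMr//.
have rd : r ^+ 2 <= d by rewrite dE lerDl sqr_ge0.
by rewrite -expr2 lerXn2r ?nnegrE ?(ltW r2) ?(ltW d0).
Qed.

Lemma bump_ge_half (r : R) (x : R * R) : 0 < r -> r ^+ 2 <= enorm2 x ^+ 2 ->
  1 / 2 <= enorm2 x ^+ 2 / (r ^+ 2 + enorm2 x ^+ 2).
Proof.
move=> r0 h; have r2 : 0 < r ^+ 2 by rewrite exprn_gt0.
rewrite ler_pdivlMr; last by rewrite ltr_wpDr ?sqr_ge0.
by lra.
Qed.

Lemma far_bump (r : R) (x : R * R) : 0 < r -> r < `|x.1| \/ r < `|x.2| -> r ^+ 2 <= enorm2 x ^+ 2.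
Proof.
move=> r0; rewrite enorm2_sq => -[] /ltW h.
  by rewrite -(real_normK (num_real x.1)) ler_wpDr ?sqr_ge0// lerXn2r ?nnegrE// ltW.
by rewrite -(real_normK (num_real x.2)) ler_wpDl ?sqr_ge0// lerXn2r ?nnegrE// ltW.
Qed.

(** Minimum principle on the unbounded plane. If the bound failed, th + m + del t + K bump would be
    negative somewhere, though nonnegative outside a large square, so it would have a negative
    minimum at a positive time. There the time derivative is at most - del, while a wide bump makes
    the drift and fractional terms at most Z / r < del. *)
Lemma wsol_ge th (V m : R) : wsol th -> (forall x, `|v1 x| <= V) -> (forall x, `|v2 x| <= V) ->
  (forall x, - m <= th 0 x) -> forall t x, 0 <= t -> - m <= th t x.
Proof.
move=> Hw HV1 HV2 H0 t1 x1 t1_ge0; rewrite leNgt; apply/negP => Hlt.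
have [cw [M HM] _] := Hw.
have M0 : 0 <= M by apply: le_trans (HM 0 0 (lexx _)).
have V0 : 0 <= V by apply: le_trans (HV1 0).
have t1_gt0 : 0 < t1.
  rewrite lt_neqAle t1_ge0 andbT; apply/eqP => E; move: Hlt; rewrite -E.
  by move=> h; have := H0 x1; rewrite leNgt h.
pose g := - m - th t1 x1; have g0 : 0 < g by rewrite subr_gt0.
pose del := g / (3 * t1); have del0 : 0 < del by rewrite divr_gt0// mulr_gt0.
(* Outside the square the bump is at least 1/2, so K times it outweighs - M - |m|. *)
pose K := 2 * (M + `|m|) + 1; have K0 : 0 < K by rewrite /K; have := normr_ge0 m; lra.
pose Z := 4 * V * K + c0 s * (2 * K * Knear s + 4 * M * Kfar s).
have c1 : 0 <= 2 * K * Knear s + 4 * M * Kfar s.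
  by apply: addr_ge0; apply: mulr_ge0; rewrite ?Knear_ge0 ?Kfar_ge0 ?mulr_ge0 ?(ltW K0).
have Z0 : 0 <= Z.
  apply: addr_ge0; first by rewrite !mulr_ge0// ltW.
  by apply: mulr_ge0 => //; exact: c0_ge0.
pose n1 := enorm2 x1 ^+ 2; have n10 : 0 <= n1 by rewrite sqr_ge0.
(* In order: r >= 1 gives r <= r^2; the square contains x1; Z / r < del; and the bump adds at most g
   / 3 at x1, as does del t1. *)
pose r := 1 + (`|x1.1| + `|x1.2|) + (Z + 1) / del + 3 * K * n1 / g.
have q1 : 0 <= (Z + 1) / del by exact: divr_ge0 (addr_ge0 Z0 ler01) (ltW del0).
have q2 : 0 <= 3 * K * n1 / g by exact: divr_ge0 (mulr_ge0 (mulr_ge0 (ler0n _ 3) (ltW K0)) n10) (ltW g0).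
have q3 := normr_ge0 x1.1; have q4 := normr_ge0 x1.2.
have r1 : 1 <= r by rewrite /r; lra.
have r0 : 0 < r by lra.
have r_le : r <= r ^+ 2 by rewrite expr2 ler_peMl// ltW.
pose h (y : R * R) := bump r y.
have h_ge0 y : 0 <= h y by rewrite divr_ge0 ?addr_ge0 ?sqr_ge0.
pose W (q : R * (R * R)) := th q.1 q.2 + m + del * q.1 + K * h q.2.
have Wfar t x : 0 <= t -> r < `|x.1| \/ r < `|x.2| -> 0 <= W (t, x).
  move=> t0 /(far_bump r0)/(bump_ge_half r0) hh; rewrite /W /=.
  have := HM t x t0; rewrite ler_norml => /andP[a _].
  have b : K * (1 / 2) <= K * h x by rewrite ler_wpM2l// ltW.
  have c : 0 <= del * t by rewrite mulr_ge0// ltW.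
  have := ler_norm (- m); rewrite normrN => d.
  by move: b; rewrite {1}/K; lra.
pose A := `[0, t1]%classic `*` (`[- r, r]%classic `*` `[- r, r]%classic) : set (R * (R * R)).
have cA : compact A by exact: box_compact.
have inA t x : 0 <= t <= t1 -> `|x.1| <= r -> `|x.2| <= r -> A (t, x).
  by move=> t01 h1 h2; split => /=; [|split]; rewrite /= in_itv/= ?t01// -ler_norml.
have A1 : A (t1, x1).
  by apply: inA; [rewrite t1_ge0 lexx|rewrite /r; lra|rewrite /r; lra].
have ch : continuous h.
  move=> y; apply: cvgM; first by apply: cvgM; exact: continuous_enorm2.
  apply: cvgV; first by rewrite gt_eqF// ltr_wpDr ?sqr_ge0// exprn_gt0.
  by apply: cvgD; [exact: cvg_cst|apply: cvgM; exact: continuous_enorm2].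
have cW : {within A, continuous W}.
  apply/subspace_continuousP => q Aq.
  have q10 : 0 <= q.1 by move: Aq => [/=]; rewrite in_itv/= => /andP[].
  rewrite /W; apply: cvgD; first apply: cvgD; first apply: cvgD.
  - move/subspace_continuousP : cw => /(_ q q10); apply: cvg_trans.
    apply: cvg_app; apply: within_subset => //.
    by move=> p [/=]; rewrite in_itv/= => /andP[].
  - exact: cvg_cst.
  - apply: cvgM; first exact: cvg_cst.
    by apply: cvg_within_filter; exact: cvg_fst.
  - apply: cvgM; first exact: cvg_cst.
    apply: cvg_within_filter.
    by apply: (@continuous_comp _ _ _ (fun q : R * (R * R) => q.2) h q); [exact: cvg_snd|exact: ch].
have A0 : A !=set0 by exists (t1, x1).
have [[ts xs] /[!inE] As Hmin] := compact_EVT_min A0 cA cW.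
have W1 : W (t1, x1) < 0.
  rewrite /W /=.
  have e1 : del * t1 = g / 3 by rewrite /del; field; rewrite gt_eqF.
  have e2 : K * h x1 <= g / 3.
    have r20 : 0 < r ^+ 2 by rewrite exprn_gt0.
    have p : h x1 <= n1 / r ^+ 2.
      by rewrite /h /bump -/n1 ler_wpM2l// lef_pV2 ?posrE ?ltr_wpDr// lerDl.
    apply: le_trans (ler_wpM2l (ltW K0) p) _.
    rewrite mulrA ler_pdivrMr//.
    have : 3 * K * n1 / g <= r ^+ 2 by apply: le_trans r_le; rewrite /r; lra.
    by rewrite ler_pdivrMr//; lra.
  by move: e1 e2; rewrite /g; lra.
have Ws : W (ts, xs) < 0 by apply: le_lt_trans W1; apply: Hmin; rewrite inE.
have [/= ts01 [xs1 xs2]] := As.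
rewrite in_itv/= in ts01; rewrite /= !in_itv/= -!ler_norml in xs1 xs2.
have /andP[ts_ge0 ts_le] := ts01.
have Wmin t y : 0 <= t <= t1 -> W (ts, xs) <= W (t, y).
  move=> t01; have t0 : 0 <= t by case/andP: t01.
  have [h1|h1] := leP `|y.1| r; last by apply: ltW; apply: lt_le_trans Ws _; apply: Wfar => //; left.
  have [h2|h2] := leP `|y.2| r; last by apply: ltW; apply: lt_le_trans Ws _; apply: Wfar => //; right.
  by apply: Hmin; rewrite inE; exact: inA.
have ts_gt0 : 0 < ts.
  rewrite lt_neqAle ts_ge0 andbT; apply/eqP => E; move: Ws; rewrite /W -E /= mulr0 addr0.
  have := H0 xs; have := mulr_ge0 (ltW K0) (h_ge0 xs); lra.
pose d := r ^+ 2 + enorm2 xs ^+ 2.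
pose l1 := - (K * (2 * r ^+ 2 * xs.1 / d ^+ 2)); pose l2 := - (K * (2 * r ^+ 2 * xs.2 / d ^+ 2)).
have Kr : 0 <= K / r ^+ 2 by rewrite divr_ge0 ?sqr_ge0// ltW.
have tz z : l1 * z.1 + l2 * z.2 - (K / r ^+ 2) * enorm2 z ^+ 2 <= th ts (xs + z) - th ts xs.
  have := Wmin ts (xs + z) ts01; rewrite /W /= => w.
  have b := bump_touch z r0 (erefl d); rewrite -/(h xs) -/(h (xs + z)) in b.
  have kb := ler_wpM2l (ltW K0) b.
  rewrite /l1 /l2; set X1 := 2 * r ^+ 2 * xs.1 / d ^+ 2 in kb *; set X2 := 2 * r ^+ 2 * xs.2 / d ^+ 2 in kb *.
  have -> : - (K * X1) * z.1 + - (K * X2) * z.2 - K / r ^+ 2 * enorm2 z ^+ 2 =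
     - (K * (X1 * z.1 + X2 * z.2 + enorm2 z ^+ 2 / r ^+ 2)) by ring.
  have kb' : - (K * (X1 * z.1 + X2 * z.2 + enorm2 z ^+ 2 / r ^+ 2)) <= - (K * (h (xs + z) - h xs)) by rewrite lerN2.
  by apply: le_trans kb' _; move: w; rewrite mulrBr; lra.
have ty y : th ts xs - th ts y <= 2 * M.
  have := HM ts xs ts_ge0; have := HM ts y ts_ge0; rewrite !ler_norml => /andP[a b] /andP[c e]; lra.
have [dt [Hdt lo]] := wsol_touch Hw ts_gt0 (fun y => HM ts y ts_ge0) Kr (mulr_ge0 (ler0n _ 2) M0) r0 tz ty.
(* The minimum may sit at the final time t1, so only earlier times are compared. *)
have up : dt <= - del.
  have del1 : 0 < ts by [].
  apply: (derive_le_left (A := 0) Hdt ts_gt0) => k /andP[k0 k1].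
  have tk : 0 <= ts - k <= t1 by apply/andP; split; lra.
  have := Wmin (ts - k) xs tk; rewrite /W /= mul0r subr0 mulrBr; lra.
have r2s : r `^ (- (2 * s)) <= r^-1.
  rewrite -powR_inv1 ?(ltW r0)//; apply: ler_powR => //.
  by rewrite lerN2; move: s_ge; lra.
have r22 : r ^+ 2 * r `^ (- (2 * s)) = r `^ (2 - 2 * s).
  by rewrite -powR_mulrn ?(ltW r0)// -powRD ?(gt_eqF r0) ?implybT.
have T1 : 2 * (K / r ^+ 2) * (Knear s * r `^ (2 - 2 * s)) + 2 * (2 * M) * (Kfar s * r `^ (- (2 * s))) =
   (2 * K * Knear s + 4 * M * Kfar s) * r `^ (- (2 * s)).
  by rewrite -r22; field; rewrite gt_eqF.
rewrite T1 in lo.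
have T2 : c0 s * ((2 * K * Knear s + 4 * M * Kfar s) * r `^ (- (2 * s))) <=
   c0 s * (2 * K * Knear s + 4 * M * Kfar s) / r.
  by rewrite -(mulrA (c0 s)) ler_wpM2l ?c0_ge0// ler_wpM2l.
have d_ge : r ^+ 2 <= d by rewrite lerDl sqr_ge0.
have d0 : 0 < d by apply: lt_le_trans d_ge; rewrite exprn_gt0.
have T3 (w c : R) : `|w| <= V -> `|c| <= r -> w * - (K * (2 * r ^+ 2 * c / d ^+ 2)) <= 2 * V * K / r.
  move=> hw hc; apply: le_trans (ler_norm _) _.
  have -> : w * - (K * (2 * r ^+ 2 * c / d ^+ 2)) = - (2 * K * (w * c)) * (r ^+ 2 / d ^+ 2).
    by field; rewrite gt_eqF.
  have p : 0 <= r ^+ 2 / d ^+ 2 by rewrite divr_ge0 ?sqr_ge0.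
  have p2 : 0 <= 2 * K by rewrite mulr_ge0// ltW.
  rewrite normrM (ger0_norm p) normrN normrM (ger0_norm p2) normrM.
  have -> : 2 * V * K / r = 2 * K * (V * r) * (r ^+ 2)^-1 by field; rewrite gt_eqF.
  apply: ler_pM => //; first by apply: mulr_ge0 => //; exact: mulr_ge0.
    by rewrite ler_wpM2l// ler_pM.
  rewrite ler_pdivrMr ?exprn_gt0// mulrC ler_pdivlMr ?exprn_gt0//.
  by rewrite -expr2 lerXn2r ?nnegrE ?sqr_ge0 ?(ltW d0).
have T4 := T3 _ _ (HV1 xs) xs1; have T5 := T3 _ _ (HV2 xs) xs2.
rewrite -/l1 in T4; rewrite -/l2 in T5.
have fin : del <= Z / r.
  have -> : Z / r = 2 * V * K / r + 2 * V * K / r + c0 s * (2 * K * Knear s + 4 * M * Kfar s) / r.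
    by rewrite /Z; field; rewrite gt_eqF.
  lra.
rewrite ler_pdivlMr// in fin.
have : (Z + 1) / del <= r by rewrite /r; lra.
rewrite ler_pdivrMr// mulrC; lra.
Qed.

End Comparison.

(** * A cap travelling with the drift *)

Section Barrier.
Variable R : realType.
Local Notation e2 := (@e2 R).
Variable s : R.
Hypotheses (s_ge : 1 / 2 <= s) (s_lt : s < 1).
Let s01 : 0 < s < 1. Proof. by rewrite s_lt andbT; move: s_ge; lra. Qed.
Variables v1 v2 : R * R -> R.
Variable th : R -> R * R -> R.
Variables (m kap eps h0 sg : R) (tau w a a' : R -> R).
Hypotheses (Hw : wsol s v1 v2 th) (m0 : 0 < m) (Hm : forall t x, 0 <= t -> `|th t x| <= m).
Hypotheses (kap0 : 0 < kap) (eps0 : 0 < eps) (eps_h0 : eps < h0).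
Hypothesis w_gt0 : forall h, eps <= h <= h0 -> 0 < w h.
Hypothesis dtau : forall h : R, eps <= h <= h0 -> is_derive h 1 tau (- (w h)^-1).
Hypothesis tau_gt0 : forall h, eps <= h -> h < h0 -> 0 < tau h.
Hypothesis tau_h0 : tau h0 = 0.
Hypothesis da : forall h : R, eps <= h <= h0 -> is_derive h 1 a (a' h).
Hypothesis a_le1 : forall h, eps <= h <= h0 -> a h <= 1.
Hypothesis a'_gt : forall h, eps <= h <= h0 -> KL s * (kap * h) `^ (- (2 * s)) < 2 * a' h * w h.
Hypothesis drift : forall h (y : R * R), eps <= h <= h0 -> enorm2 y ^+ 2 <= (kap * h) ^+ 2 ->
  0 <= v1 (y.1, sg * h + y.2) * y.1 + v2 (y.1, sg * h + y.2) * y.2 + w h * sg * y.2 + w h / h * enorm2 y ^+ 2.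
Hypothesis init : forall x : R * R, enorm2 (x.1, x.2 - sg * h0) ^+ 2 <= (kap * h0) ^+ 2 ->
  - m + 2 * m * (a h0 - enorm2 (x.1, x.2 - sg * h0) ^+ 2 / (kap * h0) ^+ 2) <= th 0 x.

(** Height replaces time: the cap is centred at (0, sg h) at time [tau h], and [Wx h x] is the
    excess of the solution over it. Where N > 1 the cap is below - m because a <= 1, so a negative
    excess can only occur inside. *)
Let N (h : R) (x : R * R) : R := (x.1 ^+ 2 + (x.2 - sg * h) ^+ 2) / (kap * h) ^+ 2.
Let Wx (h : R) (x : R * R) : R := th (tau h) x + m - 2 * m * (a h - N h x).
(** Coordinates rescaled to the cap: a fixed box covers all caps, which makes the search for a
    minimum compact. *)
Let X (q : R * (R * R)) : R * R := (kap * q.1 * q.2.1, sg * q.1 + kap * q.1 * q.2.2).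

Let h_gt0 h : eps <= h <= h0 -> 0 < h.
Proof. by move=> /andP[? _]; exact: lt_le_trans eps0 _. Qed.

Let kh0 h : eps <= h <= h0 -> 0 < kap * h.
Proof. by move=> H; rewrite mulr_gt0// h_gt0. Qed.

Let tau_ge0 h : eps <= h <= h0 -> 0 <= tau h.
Proof.
move=> /andP[e1]; rewrite le_eqVlt => /orP[/eqP->|e2]; first by rewrite tau_h0.
by apply: ltW; exact: tau_gt0.
Qed.

Let Wx_far h x : eps <= h <= h0 -> 1 < N h x -> 0 <= Wx h x.
Proof.
move=> H N1; have := Hm x (tau_ge0 H); rewrite ler_norml => /andP[b _].
have c : 0 <= 2 * m * (N h x - a h).
  by apply: mulr_ge0; [rewrite mulr_ge0// ltW|have := a_le1 H; lra].
rewrite /Wx; have -> : th (tau h) x + m - 2 * m * (a h - N h x) = (th (tau h) x + m) + 2 * m * (N h x - a h) by ring.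
by rewrite addr_ge0//; lra.
Qed.

Let A := `[eps, h0]%classic `*` (`[-1, 1]%classic `*` `[-1, 1]%classic) : set (R * (R * R)).

Let W (q : R * (R * R)) : R := Wx q.1 (X q).

Let NX q : eps <= q.1 <= h0 -> N q.1 (X q) = q.2.1 ^+ 2 + q.2.2 ^+ 2.
Proof.
move=> H; have := kh0 H => k; rewrite /N /X /=.
have -> : sg * q.1 + kap * q.1 * q.2.2 - sg * q.1 = kap * q.1 * q.2.2 by ring.
by field; rewrite !gt_eqF// h_gt0.
Qed.

Let cts (f : R -> R) (df : R -> R) : (forall h : R, eps <= h <= h0 -> is_derive h 1 f (df h)) ->
  forall q, A q -> f q.1 @[q --> q] --> f q.1.
Proof.
move=> H q [/= q1 _]; rewrite in_itv/= in q1.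
have c := is_derive_continuous (H _ q1).
by apply: (@continuous_comp _ _ _ (fun q : R * (R * R) => q.1) f q); [exact: cvg_fst|exact: c].
Qed.

Let cX : continuous X.
Proof.
move=> q.
have c1 : (fun q : R * (R * R) => q.1) @ q --> q.1 by exact: cvg_fst.
have c2 : (fun q : R * (R * R) => q.2) @ q --> q.2 by exact: cvg_snd.
have c21 : (fun q : R * (R * R) => q.2.1) @ q --> q.2.1.
  by apply: cvg_comp c2 _; exact: cvg_fst.
have c22 : (fun q : R * (R * R) => q.2.2) @ q --> q.2.2.
  by apply: cvg_comp c2 _; exact: cvg_snd.
have k1 : (fun q : R * (R * R) => kap * q.1) @ q --> kap * q.1 by apply: cvgM => //; exact: cvg_cst.
have p1 : (fun q : R * (R * R) => kap * q.1 * q.2.1) @ q --> kap * q.1 * q.2.1 by exact: cvgM.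
have p2 : (fun q : R * (R * R) => sg * q.1 + kap * q.1 * q.2.2) @ q --> sg * q.1 + kap * q.1 * q.2.2.
  by apply: cvgD; [apply: cvgM => //; exact: cvg_cst|exact: cvgM].
exact: (cvg_pair p1 p2).
Qed.

Let cW : {within A, continuous W}.
Proof.
apply/subspace_continuousP => q Aq; have [/= q1 _] := Aq; rewrite in_itv/= in q1.
have ct := cts dtau Aq; have ca := cts da Aq.
have E : {in A, W =1 fun q => th (tau q.1) (X q) + m - 2 * m * (a q.1 - (q.2.1 ^+ 2 + q.2.2 ^+ 2))}.
  by move=> p; rewrite inE => -[/= p1 _]; rewrite in_itv/= in p1; rewrite /W /Wx NX.
have Eq : W q = th (tau q.1) (X q) + m - 2 * m * (a q.1 - (q.2.1 ^+ 2 + q.2.2 ^+ 2)) by apply: E; rewrite inE.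
have c2 : (fun q : R * (R * R) => q.2) @ q --> q.2 by exact: cvg_snd.
have c21 : (fun q : R * (R * R) => q.2.1) @ q --> q.2.1.
  by apply: cvg_comp c2 _; exact: cvg_fst.
have c22 : (fun q : R * (R * R) => q.2.2) @ q --> q.2.2.
  by apply: cvg_comp c2 _; exact: cvg_snd.
have L : (fun q => th (tau q.1) (X q) + m - 2 * m * (a q.1 - (q.2.1 ^+ 2 + q.2.2 ^+ 2))) @ within A (nbhs q) -->
   th (tau q.1) (X q) + m - 2 * m * (a q.1 - (q.2.1 ^+ 2 + q.2.2 ^+ 2)).
  apply: cvgB; last first.
    apply: cvg_within_filter; apply: cvgM; first exact: cvg_cst.
    by apply: cvgB => //; apply: cvgD; apply: cvgM.
  apply: cvgD; last exact: cvg_cst.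
  have [cw _ _] := Hw; move/subspace_continuousP : cw => cw.
  have C := cw (tau q.1, X q) (tau_ge0 q1).
  have P : (fun q : R * (R * R) => (tau q.1, X q)) @ q --> (tau q.1, X q) by apply: (@cvg_pair _ _ _ (nbhs q) (nbhs (tau q.1)) (nbhs (X q)) _ _ _ (fun q => tau q.1) X ct (@cX q)).
  move=> B HB; have HB' := C B HB.
  have {}HB' : nbhs (tau q.1, X q) (fun p : R * (R * R) => 0 <= p.1 -> B (th p.1 p.2)) by exact: HB'.
  have HP := P _ HB'.
  change (nbhs q (fun p => A p -> B (th (tau p.1) (X p)))).
  apply: (@filterS _ (nbhs q) _ _ _ _ HP) => p /= Hp [/= p1 _]; apply: Hp; apply: tau_ge0.
  by rewrite in_itv/= in p1.
rewrite -Eq in L; apply: cvg_trans L; apply: near_eq_cvg.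
apply: (@filterE _ (nbhs q) _ (fun p => A p -> _ p)) => p Ap.
by apply/esym; apply: E; rewrite inE.
Qed.

(* The paraboloid of radius kap h centred at (0, sg h) travels with the flow towards the origin. At a
   first touching point the gradients agree, so drift controls the transport terms, and the loss from
   the fractional Laplacian is at most KL s (kap h)^(-2s), which the decrease of a pays for. *)
Lemma barrier h1 : eps <= h1 <= h0 -> - m + 2 * m * a h1 <= th (tau h1) (0, sg * h1).
Proof.
move=> H1; rewrite leNgt; apply/negP => Hlt.
have cA : compact A by apply: compact_setX; [|apply: compact_setX]; exact: segment_compact.
have A1 : A (h1, (0, 0)).
  by split => /=; [|split]; rewrite /= in_itv/= ?H1//; apply/andP; split; lra.
have A0 : A !=set0 by exists (h1, (0, 0)).
have [[hs zs] /[!inE] As Hmin] := compact_EVT_min A0 cA cW.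
have W1 : W (h1, (0, 0)) < 0.
  rewrite /W /Wx NX//= /X /= !mulr0 addr0 expr0n/= addr0 subr0.
  by move: Hlt; lra.
have Ws : W (hs, zs) < 0 by apply: le_lt_trans W1; apply: Hmin; rewrite inE.
have [/= Hs _] := As; rewrite in_itv/= in Hs.
set xs := X (hs, zs); have W_xs : W (hs, zs) = Wx hs xs by [].
have glob h x : eps <= h <= h0 -> Wx hs xs <= Wx h x.
  move=> H; have k := kh0 H.
  have [N1|N1] := leP (N h x) 1; last first.
    by rewrite -W_xs; apply: ltW; apply: lt_le_trans Ws _; exact: Wx_far.
  pose z : R * R := (x.1 / (kap * h), (x.2 - sg * h) / (kap * h)).
  have Xz : X (h, z) = x.
    rewrite /X /z /= [RHS]surjective_pairing; congr pair; first by field; rewrite !gt_eqF// h_gt0.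
    by field; rewrite !gt_eqF// h_gt0.
  have nz : z.1 ^+ 2 + z.2 ^+ 2 <= 1 by rewrite -(NX (q := (h, z)))// Xz.
  have := Hmin (h, z); rewrite {2}/W Xz W_xs; apply; rewrite inE.
  have sq (c d : R) : c ^+ 2 + d ^+ 2 <= 1 -> -1 <= c <= 1.
    move=> cd; rewrite -ler_norml -(@ler_pXn2r _ 2)// ?nnegrE// expr1n real_normK ?num_real//.
    by apply: le_trans cd; rewrite lerDl sqr_ge0.
  by split => /=; [|split]; rewrite /= in_itv/= ?H//; [exact: sq nz|rewrite addrC in nz; exact: sq nz].
have Ns : N hs xs <= 1.
  by rewrite leNgt; apply/negP => /(Wx_far Hs); rewrite -W_xs leNgt Ws.
have ks := kh0 Hs; have hs0 := h_gt0 Hs.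
pose y : R * R := (xs.1, xs.2 - sg * hs).
have yN : enorm2 y ^+ 2 = N hs xs * (kap * hs) ^+ 2.
  by rewrite enorm2_sq /N /y /= divfK// expf_neq0// gt_eqF.
(* At h0 the time is 0 and the cap lies below the datum, so the minimum occurs at a positive
   time. *)
have hs_lt : hs < h0.
  rewrite lt_neqAle; have /andP[_ ->] := Hs; rewrite andbT; apply/eqP => E.
  have := init (x := xs); rewrite -E -/y => /(_ _)/wrap[|I].
    by rewrite yN ler_piMl ?sqr_ge0.
  move: Ws; rewrite W_xs /Wx E tau_h0 -E; rewrite yN mulfK in I; last by rewrite expf_neq0// gt_eqF.
  by move: I; lra.
have ts0 : 0 < tau hs by apply: tau_gt0 => //; case/andP: Hs.
set q := (kap * hs) ^+ 2 in yN; have q0 : 0 < q by rewrite exprn_gt0.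
pose l1 := - (4 * m / q * y.1); pose l2 := - (4 * m / q * y.2).
have A0' : 0 <= 2 * m / q by rewrite divr_ge0 ?mulr_ge0// ltW.
have tz z : l1 * z.1 + l2 * z.2 - (2 * m / q) * enorm2 z ^+ 2 <= th (tau hs) (xs + z) - th (tau hs) xs.
  have := glob hs (xs + z) Hs; rewrite /Wx => g.
  have -> : l1 * z.1 + l2 * z.2 - (2 * m / q) * enorm2 z ^+ 2 = 2 * m * (N hs xs - N hs (xs + z)).
    by rewrite /l1 /l2 /N -/q enorm2_sq /y /=; field; rewrite gt_eqF.
  by move: g; rewrite !mulrBr; lra.
have ty x : th (tau hs) xs - th (tau hs) x <= 2 * m.
  have := Hm xs (ltW ts0); have := Hm x (ltW ts0).
  by rewrite !ler_norml => /andP[b c] /andP[d e]; lra.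
have [dt [Hdt lo]] := wsol_touch s_ge s_lt Hw ts0 (fun x => Hm x (ltW ts0)) A0' (mulr_ge0 (ler0n _ 2) (ltW m0)) ks tz ty.
(* Splitting the fractional integral at the cap radius makes its near and far parts scale alike, and
   both merge into m KL (kap hs)^(-2s). *)
have r22 : (kap * hs) `^ (2 - 2 * s) = q * (kap * hs) `^ (- (2 * s)).
  by rewrite /q -powR_mulrn ?(ltW ks)// -powRD ?(gt_eqF ks) ?implybT.
set p := (kap * hs) `^ (- (2 * s)) in r22 lo.
have lo' : 4 * m / q * (v1 xs * y.1 + v2 xs * y.2) - m * (KL s * p) <= dt.
  apply: le_trans lo; rewrite r22 le_eqVlt; apply/orP; left; apply/eqP.
  by rewrite /KL /l1 /l2; field; rewrite gt_eqF.
have wH := w_gt0 Hs.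
(* At a fixed point N varies with h for two reasons: the centre moves and the radius shrinks with h.
   The second one is the source of the term w h / h |y|^2 in the drift condition. *)
pose dN := - 2 * sg * y.2 / q - 2 * enorm2 y ^+ 2 / (q * hs).
have HN : is_derive hs 1 (fun h => N h xs) dN.
  have dV : is_derive hs 1 (fun h : R => h^-1) (- hs ^- 2).
    have hn : hs != 0 by rewrite gt_eqF.
    have := is_deriveV (f := id) hn (is_derive_id hs 1).
    by rewrite /GRing.scale/= mulr1.
  have -> : (fun h => N h xs) = (fun h => (xs.1 ^+ 2 + (xs.2 - sg * h) ^+ 2) * (kap ^- 2 * (h^-1 * h^-1))).
    apply/funext => h; rewrite /N; congr (_ * _).
    by rewrite exprMn (invfM (kap ^+ 2)) (expr2 h) (invfM h).
  apply: is_derive_eq.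
  rewrite /dN enorm2_sq /y /GRing.scale /= /q; field.
  by rewrite !gt_eqF.
have HWx : is_derive hs 1 (fun h => Wx h xs) (dt * - (w hs)^-1 - 2 * m * (a' hs - dN)).
  have h1' := @is_derive1_comp R (fun t => th t xs) tau hs _ _ Hdt (dtau Hs).
  have h2' := da Hs.
  rewrite /Wx; apply: is_derive_eq.
  by rewrite /GRing.scale/= addr0.
(* Larger heights are earlier times, so this is the backward-in-time comparison at the touching
   point. *)
have up : 0 <= dt * - (w hs)^-1 - 2 * m * (a' hs - dN).
  have d0 : 0 < h0 - hs by rewrite subr_gt0.
  apply: (derive_ge_right (A := 0) HWx d0) => k /andP[k0 k1].
  have Hk : eps <= hs + k <= h0 by case/andP: Hs => e1 e2'; apply/andP; split; lra.
  by have := glob (hs + k) xs Hk; lra.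
have up' : dt <= - 2 * m * a' hs * w hs + 2 * m * dN * w hs.
  have := mulr_ge0 (ltW wH) up.
  have -> : w hs * (dt * - (w hs)^-1 - 2 * m * (a' hs - dN)) = - dt + (- 2 * m * a' hs * w hs + 2 * m * dN * w hs).
    by field; rewrite gt_eqF.
  lra.
have D := drift (y := y) Hs; rewrite -/q in D.
have D' : 0 <= v1 xs * y.1 + v2 xs * y.2 + w hs * sg * y.2 + w hs / hs * enorm2 y ^+ 2.
  have Exs : xs = (y.1, sg * hs + y.2).
    by apply: injective_projections => /=; [|ring].
  by rewrite Exs; apply: D; rewrite yN ler_piMl// ltW.
have mq : 0 <= 4 * m / q by rewrite divr_ge0 ?mulr_ge0// ltW.
have D2 := mulr_ge0 mq D'.
have K := a'_gt Hs; rewrite -/p in K.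
have K2 : m * (KL s * p) < m * (2 * a' hs * w hs) by rewrite ltr_pM2l.
have E : 2 * m * dN * w hs = - (4 * m / q * (w hs * sg * y.2 + w hs / hs * enorm2 y ^+ 2)).
  by rewrite /dN; field; rewrite !gt_eqF.
rewrite E in up'.
move: lo' up' D2 K2.
have -> : 4 * m / q * (v1 xs * y.1 + v2 xs * y.2 + w hs * sg * y.2 + w hs / hs * enorm2 y ^+ 2) =
  4 * m / q * (v1 xs * y.1 + v2 xs * y.2) + 4 * m / q * (w hs * sg * y.2 + w hs / hs * enorm2 y ^+ 2) by ring.
have -> : - 2 * m * a' hs * w hs = - (m * (2 * a' hs * w hs)) by ring.
set u1 := 4 * m / q * (v1 xs * y.1 + v2 xs * y.2); set u2 := 4 * m / q * (w hs * sg * y.2 + _).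
set u3 := m * (KL s * p); set u4 := m * _.
lra.
Qed.

End Barrier.

Section Solution.
Variable R : realType.
Local Notation e2 := (@e2 R).

Lemma derivable_is_derive1 (f : R -> R) (t : R) : derivable f t 1 -> is_derive t 1 f (derive1 f t).
Proof. by move=> H; rewrite derive1E; exact: DeriveDef. Qed.

Lemma derivable_shift (f : R -> R) (t : R) : derivable (fun h => f (t + h)) 0 1 -> derivable f t 1.
Proof.
move=> /derivable_is_derive1 H.
have Ht : is_derive (t - t) 1 (fun h => f (t + h)) (derive1 (fun h => f (t + h)) 0) by rewrite subrr.
have d : is_derive t 1 (fun x : R => x - t) 1 by apply: is_derive_eq; rewrite oppr0 addr0.
have := @is_derive1_comp R (fun h => f (t + h)) (fun x => x - t) t _ _ Ht d.
have -> : (fun h => f (t + h)) \o (fun x => x - t) = f by apply/funext => x /=; rewrite addrCA subrr addr0.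
by move/(@ex_derive _ _ _ _ _ _ _).
Qed.

Lemma smooth_solution_wsol s (v1 v2 : R * R -> R) theta0 theta :
  is_smooth_solution s (fun x => (v1 x, v2 x)) theta0 theta -> wsol s v1 v2 theta.
Proof.
move=> [Sm [C [_ [B E]]]]; split=> // t x t0.
have [L [HL HE]] := E t x t0.
have [_ D] := Sm [::] (t, x) t0.
exists L, (derive1 (fun tau => theta tau x) t), (dx1 (theta t) x), (dx2 (theta t) x).
split; [exact: HL| | | |exact: HE].
- apply: derivable_is_derive1; apply: derivable_shift.
  have := D ord0; set g := fun h : R => _; suff -> : g = (fun h => theta (t + h) x) by [].
  by apply/funext => h; rewrite /g e3_shift0.
- apply: derivable_is_derive1; have := D (lift ord0 ord0).
  set g := fun h : R => _; suff -> : g = (fun h => theta t (x + h *: e2 ord0)) by [].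
  by apply/funext => h; rewrite /g e3_shift.
- apply: derivable_is_derive1; have := D (lift ord0 (lift ord0 ord0)).
  set g := fun h : R => _; suff -> : g = (fun h => theta t (x + h *: e2 (lift ord0 ord0))) by [].
  by apply/funext => h; rewrite /g e3_shift.
Qed.

Lemma wsol_abs_le s v1 v2 th (V m : R) : 1 / 2 <= s -> s < 1 -> wsol s v1 v2 th ->
  (forall x, `|v1 x| <= V) -> (forall x, `|v2 x| <= V) ->
  (forall x, `|th 0 x| <= m) -> forall t x, 0 <= t -> `|th t x| <= m.
Proof.
move=> s_ge s_lt Hw HV1 HV2 H0 t x t0; rewrite ler_norml; apply/andP; split.
  by apply: (wsol_ge s_ge s_lt Hw HV1 HV2 _ x t0) => y; have := H0 y; rewrite ler_norml => /andP[].
rewrite -lerN2.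
by apply: (wsol_ge s_ge s_lt (wsolN Hw) HV1 HV2 _ x t0) => y; have := H0 y; rewrite lerN2 ler_norml => /andP[].
Qed.

End Solution.

(** * The drift *)

Section Monomials.
Variable R : realType.
Implicit Types (x : R * R) (r c : R).
Local Notation e2 := (@e2 R).

Definition qd r x : R := x.1 ^+ 2 + x.2 ^+ 2 + r.

(** Up to linear combinations this class is stable under differentiation: a derivative lowers a
    power or raises i + j and c by one each. Both preserve i + j <= 2c, which ensures
    boundedness. *)
Definition mono (i j : nat) r c x : R := x.1 ^+ i * x.2 ^+ j * qd r x `^ (- c).

Lemma qd_gt0 r x : 0 < r -> 0 < qd r x.
Proof. by move=> r0; rewrite /qd ltr_wpDl// addr_ge0// sqr_ge0. Qed.

Lemma qd_sqrt r x : 0 < r -> (qd r x `^ (1 / 2)) ^+ 2 = qd r x.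
Proof.
by move=> r0; rewrite -powR_mulrn ?powR_ge0// -powRrM mul1r mulVf// powRr1// ltW// qd_gt0.
Qed.

Lemma norm_le_qd1 r x : 0 < r -> `|x.1| <= qd r x `^ (1 / 2).
Proof.
move=> r0; rewrite -(@ler_pXn2r _ 2)// ?nnegrE ?powR_ge0// qd_sqrt// real_normK ?num_real//.
by rewrite /qd -addrA lerDl addr_ge0 ?sqr_ge0// ltW.
Qed.

Lemma norm_le_qd2 r x : 0 < r -> `|x.2| <= qd r x `^ (1 / 2).
Proof.
move=> r0; rewrite -(@ler_pXn2r _ 2)// ?nnegrE ?powR_ge0// qd_sqrt// real_normK ?num_real//.
by rewrite /qd addrAC lerDr addr_ge0 ?sqr_ge0// ltW.
Qed.

Lemma is_derive_qd1 r x c : 0 < r -> is_derive (0 : R) 1 (fun h : R => qd r (x.1 + h, x.2) `^ c)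
  (c * qd r x `^ (c - 1) * (2 * x.1)).
Proof.
move=> r0; have := @is_derive_powR_comp R (fun h : R => qd r (x.1 + h, x.2)) c 0 (2 * x.1).
rewrite {2}/qd /= addr0; apply; first exact: qd_gt0.
by rewrite /qd /=; apply: is_derive_eq; rewrite /GRing.scale/=; ring.
Qed.

Lemma is_derive_qd2 r x c : 0 < r -> is_derive (0 : R) 1 (fun h : R => qd r (x.1, x.2 + h) `^ c)
  (c * qd r x `^ (c - 1) * (2 * x.2)).
Proof.
move=> r0; have := @is_derive_powR_comp R (fun h : R => qd r (x.1, x.2 + h)) c 0 (2 * x.2).
rewrite {2}/qd /= addr0; apply; first exact: qd_gt0.
by rewrite /qd /=; apply: is_derive_eq; rewrite /GRing.scale/=; ring.
Qed.

Lemma is_derive_addl (t : R) : is_derive (0 : R) 1 (fun h : R => t + h) 1.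
Proof. by have := is_deriveD (is_derive_cst t (0 : R) 1) (is_derive_id (0 : R) 1); rewrite add0r. Qed.

Lemma is_derive_exprD (t : R) i : is_derive (0 : R) 1 (fun h : R => (t + h) ^+ i) (i%:R * t ^+ i.-1).
Proof.
have d := is_derive_addl t.
case: i => [|i]; first by rewrite mul0r; under eq_fun do rewrite expr0; exact: is_derive_cst.
have := @is_deriveX R R (fun h : R => t + h) i.+1 0 1 1 d.
by rewrite /GRing.scale/= mulr1 addr0 exprfctE.
Qed.

(** At i = 0 or j = 0 the predecessor is 0 as well, but its coefficient vanishes. *)
Definition dmono (i j : nat) r c (k : 'I_2) x : R :=
  if val k == 0%N then i%:R * mono i.-1 j r c x - 2 * c * mono i.+1 j r (c + 1) x
  else j%:R * mono i j.-1 r c x - 2 * c * mono i j.+1 r (c + 1) x.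

Lemma is_derive_mono i j r c k x : 0 < r ->
  is_derive (0 : R) 1 (fun h : R => mono i j r c (x + h *: e2 k)) (dmono i j r c k x).
Proof.
move=> r0; move: k; apply: ord2_ind.
  under eq_fun do rewrite e2_shift1.
  rewrite /mono /=; have d1 := is_derive_exprD x.1 i; have d2 := is_derive_qd1 x (- c) r0.
  apply: is_derive_eq; rewrite addr0 -surjective_pairing /dmono /mono /= /GRing.scale /= exprS.
  by rewrite -opprD; ring.
under eq_fun do rewrite e2_shift2.
rewrite /mono /=; have d1 := is_derive_exprD x.2 j; have d2 := is_derive_qd2 x (- c) r0.
apply: is_derive_eq; rewrite addr0 -surjective_pairing /dmono /mono /= /GRing.scale /= exprS.
by rewrite -opprD; ring.
Qed.

Lemma mono_bounded i j r c : 0 < r -> (i + j)%:R <= 2 * c -> exists M, forall x, `|mono i j r c x| <= M.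
Proof.
move=> r0 H; exists (r `^ (- (c - (i + j)%:R / 2))) => x.
have q0 := qd_gt0 x r0; set q := qd r x in q0.
have b1 : `|x.1| <= q `^ (1 / 2) by exact: norm_le_qd1.
have b2 : `|x.2| <= q `^ (1 / 2) by exact: norm_le_qd2.
have B : `|mono i j r c x| <= q `^ ((i + j)%:R / 2) * q `^ (- c).
  rewrite /mono !normrM !normrX -/q (ger0_norm (powR_ge0 _ _)) ler_wpM2r ?powR_ge0//.
  have -> : q `^ ((i + j)%:R / 2) = (q `^ (1 / 2)) ^+ i * (q `^ (1 / 2)) ^+ j.
    by rewrite -exprD -powR_mulrn ?powR_ge0// -powRrM; congr (_ `^ _); ring.
  by apply: ler_pM; rewrite ?exprn_ge0//; apply: lerXn2r; rewrite ?nnegrE ?powR_ge0.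
apply: le_trans B _; rewrite -powRD ?(gt_eqF q0) ?implybT//.
have -> : (i + j)%:R / 2 + - c = - (c - (i + j)%:R / 2) by ring.
apply: powR_le_neg => //; first by rewrite /q /qd lerDr addr_ge0// sqr_ge0.
by lra.
Qed.

Lemma mono_bnd k i j r c : 0 < r -> 0 <= c -> (i + j)%:R <= 2 * c -> exists M, bnd k (mono i j r c) M.
Proof.
move=> r0; elim: k i j c => [|k IH] i j c c0 H.
  by have [M HM] := mono_bounded r0 H; exists M.
have [M0 HM0] := mono_bounded r0 H.
have [] := IH i.-1 j c c0; first by apply: le_trans H; rewrite ler_nat leq_add2r leq_pred.
move=> M1 H1.
have [] := IH i j.-1 c c0; first by apply: le_trans H; rewrite ler_nat leq_add2l leq_pred.
move=> M2 H2.
have c1 : 0 <= c + 1 by lra.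
have [] := IH i.+1 j (c + 1) c1; first by rewrite addSn -natr1; lra.
move=> M3 H3.
have [] := IH i j.+1 (c + 1) c1; first by rewrite addnS -natr1; lra.
move=> M4 H4.
have B1 := bndB (bndZ i%:R H1) (bndZ (2 * c) H3); have B2 := bndB (bndZ j%:R H2) (bndZ (2 * c) H4).
set N1 := `|i%:R| * M1 + _ in B1; set N2 := `|j%:R| * M2 + _ in B2.
have n1 := bnd_ge0 B1; have n2 := bnd_ge0 B2; have n0 : 0 <= M0 by apply: le_trans (HM0 0).
exists (M0 + N1 + N2); apply: (@bndS _ _ _ _ (dmono i j r c)).
- by move=> x; apply: le_trans (HM0 x) _; lra.
- by move=> l x; exact: is_derive_mono.
- apply: ord2_ind; first by apply: bnd_le B1 => //; lra.
  by apply: bnd_le B2 => //; lra.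
Qed.

Lemma Cb_mono i j r c : 0 < r -> 0 <= c -> (i + j)%:R <= 2 * c -> Cb (mono i j r c).
Proof. by move=> r0 c0 H k; exact: mono_bnd. Qed.

End Monomials.

Section Drift.
Variable R : realType.
Local Notation e2 := (@e2 R).
Variables (lam b d : R).
Hypotheses (lam0 : 0 < lam) (b0 : 0 < b) (d0 : 0 < d).

(* Stream function of a flow carrying the x2-axis to the origin at speed about |x|^(1 - 2b) for |x|^2 > d. *)
Definition psi (x : R * R) : R := lam * (x.1 * x.2 * (qd d x `^ (- b) * qd 1 x `^ (- 2))).
Definition dv1 := pd (e2 (lift ord0 ord0)) psi.
Definition dv2 (x : R * R) := - pd (e2 ord0) psi x.

(** The argument is the squared radius, and [dprof] is minus the derivative of [prof]. *)
Definition prof (r : R) : R := lam * ((r + d) `^ (- b) * (r + 1) `^ (- 2)).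
Definition dprof (r : R) : R := prof r * (b / (r + d) + 2 / (r + 1)).

Lemma Cb_psi : Cb psi.
Proof.
have -> : psi = (fun x => lam * (mono 1 1 1 2 x * mono 0 0 d b x)).
  by apply/funext => x; rewrite /psi /mono !expr1 !expr0; ring.
apply: CbZ; apply: CbM; apply: Cb_mono => //; rewrite ?natrD ?mulr0n; move: b0; lra.
Qed.

Lemma Cb_dv1 : Cb dv1. Proof. exact: Cb_pd Cb_psi. Qed.

Lemma Cb_dv2 : Cb dv2.
Proof.
have -> : dv2 = (fun x => -1 * pd (e2 ord0) psi x) by apply/funext => x; rewrite mulN1r.
by apply: CbZ; exact: Cb_pd Cb_psi.
Qed.

Lemma div_free_drift : div_free (fun x => (dv1 x, dv2 x)).
Proof.
move=> x; rewrite /dx1 /dx2 /=.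
have [M bM] := Cb_psi 3%N.
have -> : pd (e2 (lift ord0 ord0)) dv2 x = - pd (e2 (lift ord0 ord0)) (pd (e2 ord0) psi) x.
  apply: pdE; apply: is_deriveN; exact: Cb_derive (Cb_pd _ Cb_psi).
by rewrite /dv1 (schwarz (lift ord0 ord0) ord0 bM) subrr.
Qed.

Lemma powR_pred (q c : R) : 0 < q -> q `^ (c - 1) = q `^ c / q.
Proof. by move=> q0; rewrite powRD ?(gt_eqF q0) ?implybT// powR_inv1// ltW. Qed.

Lemma dv1E x : dv1 x = x.1 * (prof (x.1 ^+ 2 + x.2 ^+ 2) - 2 * x.2 ^+ 2 * dprof (x.1 ^+ 2 + x.2 ^+ 2)).
Proof.
apply: pdE; under eq_fun do rewrite e2_shift2.
have h1 := is_derive_qd2 x (- b) d0; have h2 := is_derive_qd2 x (- 2) (@ltr01 R).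
have h3 := is_derive_addl x.2.
rewrite /psi /=; apply: is_derive_eq.
have q1 := qd_gt0 x d0; have q2 := qd_gt0 x (@ltr01 R).
rewrite addr0 -surjective_pairing !powR_pred// /dprof /prof /GRing.scale /= -/(qd d x) -/(qd 1 x).
by field; rewrite !gt_eqF.
Qed.

(** On the axis x1 = 0 this is - x2 prof(x2^2), while [dv1E] vanishes there; hence the points (0, h)
    and (0, - h) run into the origin at the rate [speed h]. *)
Lemma dv2E x : dv2 x = - x.2 * (prof (x.1 ^+ 2 + x.2 ^+ 2) - 2 * x.1 ^+ 2 * dprof (x.1 ^+ 2 + x.2 ^+ 2)).
Proof.
rewrite mulNr; congr (- _); apply: pdE; under eq_fun do rewrite e2_shift1.
have h1 := is_derive_qd1 x (- b) d0; have h2 := is_derive_qd1 x (- 2) (@ltr01 R).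
have h3 := is_derive_addl x.1.
rewrite /psi /=; apply: is_derive_eq.
have q1 := qd_gt0 x d0; have q2 := qd_gt0 x (@ltr01 R).
rewrite addr0 -surjective_pairing !powR_pred// /dprof /prof /GRing.scale /= -/(qd d x) -/(qd 1 x).
by field; rewrite !gt_eqF.
Qed.

Lemma prof_gt0 (r : R) : 0 <= r -> 0 < prof r.
Proof. by move=> r0; rewrite mulr_gt0// mulr_gt0// powR_gt0//; move: d0; lra. Qed.

Lemma prof_decr (r r' : R) : 0 <= r -> r <= r' -> prof r' <= prof r.
Proof.
move=> r0 rr; rewrite /prof ler_pM2l//; apply: ler_pM; rewrite ?powR_ge0//.
  by apply: powR_le_neg; [move: d0; lra|lra|rewrite ltW].
by apply: powR_le_neg; lra.
Qed.

Lemma is_derive_prof (r : R) : 0 <= r -> is_derive r 1 prof (- dprof r).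
Proof.
move=> r0.
have A c : is_derive r 1 (fun r : R => r + c) 1.
  have := is_deriveD (is_derive_id (r:R) (1:R)) (is_derive_cst c (r:R) (1:R)).
  by rewrite addr0.
have rd : 0 < r + d by move: d0; lra.
have r1 : 0 < r + 1 by lra.
have h1 := @is_derive_powR_comp R (fun r => r + d) (- b) r 1 rd (A d).
have h2 := @is_derive_powR_comp R (fun r => r + 1) (- 2) r 1 r1 (A 1).
rewrite /prof; apply: is_derive_eq.
by rewrite !powR_pred// /dprof /prof /GRing.scale /=; field; rewrite !gt_eqF.
Qed.

(** The derivative of r prof(r) is at least prof(r) (1 - b - 2r). Together with [prof_decr] this
    controls the profile from both sides across the cap, and it needs b < 1 and small radii. *)
Lemma prof_incr (r r' : R) : 0 <= r -> r <= r' -> b + 2 * r' <= 1 -> r * prof r <= r' * prof r'.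
Proof.
move=> r0 rr H.
have D (c : R) : 0 <= c -> is_derive c 1 (fun r => r * prof r) (prof c - c * dprof c).
  move=> c0; have h := is_derive_prof c0; apply: is_derive_eq.
  by rewrite /GRing.scale/= mulr1 mulrN addrC.
have Din c : c \in `]r, r'[ -> is_derive c 1 (fun r => r * prof r) (prof c - c * dprof c).
  by rewrite in_itv/= => /andP[h _]; apply: D; lra.
have C : {within `[r, r'], continuous (fun r => r * prof r)}.
  apply: derivable_within_continuous => x; rewrite in_itv/= => /andP[h _].
  have x0 : 0 <= x by lra.
  by have [] := D x x0.
have [c] := MVT_segment rr Din C.
rewrite in_itv/= => /andP[c1 c2] E; rewrite -subr_ge0 E mulr_ge0 ?subr_ge0//.
have c0 : 0 <= c by lra.
rewrite /dprof mulrCA ler_piMr ?(ltW (prof_gt0 c0))//.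
have cd : 0 < c + d by move: d0; lra.
have cc1 : 0 < c + 1 by lra.
have : c * (b / (c + d)) <= b.
  rewrite mulrA ler_pdivrMr// mulrC ler_wpM2l ?(ltW b0)//; move: d0; lra.
have : c * (2 / (c + 1)) <= 2 * c.
  rewrite mulrA ler_pdivrMr// (mulrC c) ler_peMr//; lra.
by rewrite mulrDr; lra.
Qed.

End Drift.

(** * The transport inequality on the cap *)

Section Bracket.
Variable R : realType.
Variables (lam b d : R).
Hypotheses (lam0 : 0 < lam) (b0 : 0 < b) (d0 : 0 < d).
Local Notation F := (prof lam b d).
Local Notation v1 := (dv1 lam b d).
Local Notation v2 := (dv2 lam b d).

Definition speed (h : R) : R := h * F (h ^+ 2).

(* With x2 = h + y2, F = prof (y1^2 + x2^2), F0 = prof (h^2) and G = -F', the sum below equals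
   y1^2 (F + F0 - 2 h x2 G) + x2 y2 (F0 - F). *)
Lemma bracket (kap h0 h y1 y2 : R) : 0 < kap -> 0 < h -> h <= h0 ->
  5 * kap + 16 * h0 ^+ 2 <= 2 * (1 - b) -> y1 ^+ 2 + y2 ^+ 2 <= (kap * h) ^+ 2 ->
  0 <= v1 (y1, h + y2) * y1 + v2 (y1, h + y2) * y2 + speed h * y2 + speed h / h * (y1 ^+ 2 + y2 ^+ 2).
Proof.
move=> k0 h_gt0 hh0 H Hy.
set x2 := h + y2; set r := y1 ^+ 2 + x2 ^+ 2; set F0 := F (h ^+ 2).
have hs : h ^+ 2 <= h0 ^+ 2 by rewrite lerXn2r// nnegrE; move: h_gt0 hh0; lra.
have hs0 : 0 < h ^+ 2 by rewrite exprn_gt0.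
have k_lt : kap <= 2 / 5 by move: b0 H; lra.
have y1s : 0 <= y1 ^+ 2 by rewrite sqr_ge0.
have /andP[y2l y2u] : - (kap * h) <= y2 <= kap * h.
  rewrite -ler_norml -(@ler_pXn2r _ 2)// ?nnegrE ?mulr_ge0 ?(ltW k0) ?(ltW h_gt0)//.
  by rewrite real_normK ?num_real//; move: y1s Hy; lra.
have kh : kap * h <= 2 / 5 * h by rewrite ler_wpM2r// ltW.
have x2l : (1 - kap) * h <= x2 by rewrite /x2; move: y2l; lra.
have x2u : x2 <= (1 + kap) * h by rewrite /x2; move: y2u; lra.
have x20 : 0 < x2 by move: x2l h_gt0 kh; lra.
have x2s : 0 < x2 ^+ 2 by rewrite exprn_gt0.
have rE : r = y1 ^+ 2 + y2 ^+ 2 + 2 * h * y2 + h ^+ 2 by rewrite /r /x2; ring.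
have r0 : 0 < r by rewrite /r; move: y1s x2s; lra.
have hy2 : h * y2 <= kap * h ^+ 2 by rewrite expr2 mulrCA ler_pM2l.
have k2 : kap * kap * h ^+ 2 <= 1 * h ^+ 2.
  by rewrite ler_wpM2r ?(ltW hs0)//; have := ler_pM (ltW k0) (ltW k0) k_lt k_lt; lra.
have k1 : kap * h ^+ 2 <= 2 / 5 * h ^+ 2 by rewrite ler_wpM2r// ltW.
have ru : r <= 4 * h0 ^+ 2.
  by rewrite rE; move: Hy hy2 k2 k1 hs; rewrite exprMn (expr2 kap) -mulrA; lra.
set f := F r; have f0 : 0 < f by apply: prof_gt0 => //; exact: ltW.
have F00 : 0 < F0 by apply: prof_gt0 => //; exact: ltW.
pose B := b / (r + d) + 2 / (r + 1).
have B0 : 0 <= B by rewrite addr_ge0// divr_ge0 ?(ltW b0)//; move: r0 d0; lra.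
have rB : r * B <= b + 2 * r.
  have rd : 0 < r + d by move: r0 d0; lra.
  have r1 : 0 < r + 1 by move: r0; lra.
  rewrite /B mulrDr lerD//.
    by rewrite mulrA ler_pdivrMr// mulrC ler_wpM2l ?(ltW b0)//; move: d0; lra.
  by rewrite mulrA ler_pdivrMr// (mulrC r) ler_peMr ?mulr_ge0 ?(ltW r0)//; move: r0; lra.
have hx : (1 - kap) * (h * x2) * B <= b + 8 * h0 ^+ 2.
  apply: (@le_trans _ _ (r * B)); last by move: rB ru; lra.
  rewrite ler_wpM2r//; apply: (@le_trans _ _ (x2 ^+ 2)); last by rewrite /r; move: y1s; lra.
  by rewrite mulrA expr2 ler_wpM2r// ltW.
(* For r <= h^2, (1 - kap)^2 h^2 <= x2^2 <= r and r F(r) <= h^2 F0; beyond h^2 the profile is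
   already below F0. *)
have fF0 : (1 - kap) ^+ 2 * f <= F0.
  have [rh|rh] := leP r (h ^+ 2).
    have := prof_incr lam0 b0 d0 (ltW r0) rh; rewrite -/f -/F0 => /(_ _)/wrap[|I].
      by move: H hs k0; lra.
    rewrite -(ler_pM2l hs0); apply: le_trans I; rewrite mulrA ler_wpM2r ?(ltW f0)//.
    apply: (@le_trans _ _ (x2 ^+ 2)); last by rewrite /r; move: y1s; lra.
    rewrite mulrC -exprMn lerXn2r// nnegrE ?(ltW x20)// mulr_ge0 ?(ltW h_gt0)//.
    by move: k_lt; lra.
  have I : f <= F0 by apply: prof_decr; rewrite ?ltW.
  apply: le_trans I; rewrite ler_piMl ?(ltW f0)// exprn_ile1//; move: k_lt k0; lra.
(* The product is nonnegative if y2 >= 0 (then r >= h^2) or if y2 < 0 and r <= h^2. Otherwise r (F0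
   - f) <= (r - h^2) F0 <= y1^2 F0, and - x2 y2 <= kap h^2 <= kap r. *)
have side : - (kap * F0 * y1 ^+ 2) <= x2 * y2 * (F0 - f).
  have P0 : 0 <= kap * F0 * y1 ^+ 2 by apply: mulr_ge0 => //; apply: mulr_ge0; apply: ltW.
  suff : 0 <= x2 * y2 * (F0 - f) \/ x2 * (- y2) * (F0 - f) <= kap * F0 * y1 ^+ 2.
    by case=> [|]; [move: P0; lra|rewrite mulrN mulNr; lra].
  have [y20|y20] := leP 0 y2.
    left; apply: mulr_ge0; first by rewrite mulr_ge0// ltW.
    rewrite subr_ge0; apply: prof_decr => //; first by rewrite ltW.
    rewrite rE; have := mulr_ge0 (ltW h_gt0) y20; have := sqr_ge0 y2; move: y1s; lra.
  have [rh|rh] := leP r (h ^+ 2).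
    left; rewrite mulr_le0//; first by rewrite mulr_ge0_le0 ?ltW.
    by rewrite subr_le0; apply: prof_decr => //; exact: ltW.
  right.
  have := prof_incr lam0 b0 d0 (ltW hs0) (ltW rh); rewrite -/f -/F0 => /(_ _)/wrap[|I].
    by move: H ru k0; lra.
  have rF : r * (F0 - f) <= y1 ^+ 2 * F0.
    have : (r - h ^+ 2) * F0 <= y1 ^+ 2 * F0.
      rewrite ler_pM2r// rE; have : y2 * (y2 + 2 * h) <= 0.
        by rewrite mulr_le0_ge0 ?(ltW y20)//; move: y2l kh h_gt0; lra.
      by lra.
    by move: I; lra.
  rewrite -(ler_pM2l r0).
  have -> : r * (x2 * - y2 * (F0 - f)) = (x2 * - y2) * (r * (F0 - f)) by ring.
  apply: (@le_trans _ _ (x2 * - y2 * (y1 ^+ 2 * F0))).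
    by rewrite ler_wpM2l// mulr_ge0 ?(ltW x20)//; move: y20; lra.
  have -> : r * (kap * F0 * y1 ^+ 2) = (kap * r) * (y1 ^+ 2 * F0) by ring.
  rewrite ler_wpM2r ?(mulr_ge0 y1s (ltW F00))//.
  apply: (@le_trans _ _ (h * (kap * h))).
    apply: ler_pM; rewrite ?(ltW x20)//; move: y20 y2l; rewrite /x2; lra.
  have -> : h * (kap * h) = kap * h ^+ 2 by ring.
  by rewrite ler_pM2l// ltW.
rewrite dv1E// dv2E//= -/r /dprof -/f -/B.
have w1 : speed h = h * F0 by [].
have w2 : speed h / h = F0 by rewrite w1 mulrC mulKf// gt_eqF.
rewrite w2 w1.
have -> : y1 * (f - 2 * x2 ^+ 2 * (f * B)) * y1 + - x2 * (f - 2 * y1 ^+ 2 * (f * B)) * y2 + h * F0 * y2 +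
  F0 * (y1 ^+ 2 + y2 ^+ 2) = y1 ^+ 2 * (f + F0 - 2 * (h * x2 * B) * f) + x2 * y2 * (F0 - f).
  by rewrite /x2; ring.
(* Times 1 - kap, the estimates [hx] and [fF0] leave the coefficient 2 (1 - b) - 5 kap - 16 h0^2 in
   front of f, which is the smallness hypothesis. *)
suff main : 0 <= f + F0 - 2 * (h * x2 * B) * f - kap * F0.
  by have := mulr_ge0 y1s main; move: side; lra.
have k1' : 0 < 1 - kap by move: k_lt; lra.
rewrite -(pmulr_rge0 _ k1').
have e1 : (1 - kap) * (h * x2) * B * f <= (b + 8 * h0 ^+ 2) * f by rewrite ler_wpM2r// ltW.
have e2 : (1 - kap) * (kap * F0) <= kap * F0 by rewrite ler_piMl ?(mulr_ge0 (ltW k0) (ltW F00))//; move: k0; lra.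
have e3 : (1 - 2 * kap) * ((1 - kap) ^+ 2 * f) <= (1 - 2 * kap) * F0.
  by rewrite ler_wpM2l//; move: k_lt; lra.
have e4 : (1 - 4 * kap) * f <= (1 - 2 * kap) * ((1 - kap) ^+ 2 * f).
  rewrite mulrA ler_wpM2r ?(ltW f0)//.
  have -> : (1 - 2 * kap) * (1 - kap) ^+ 2 = 1 - 4 * kap + kap ^+ 2 * (5 - 2 * kap) by ring.
  by rewrite lerDl mulr_ge0 ?sqr_ge0//; move: k_lt; lra.
have e5 : 0 <= (2 * (1 - b) - 5 * kap - 16 * h0 ^+ 2) * f by rewrite mulr_ge0 ?(ltW f0)//; move: H; lra.
have -> : (1 - kap) * (f + F0 - 2 * (h * x2 * B) * f - kap * F0) =
  (1 - kap) * f + (1 - kap) * F0 - 2 * ((1 - kap) * (h * x2) * B * f) - (1 - kap) * (kap * F0) by ring.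
by move: e1 e2 e3 e4 e5; lra.
Qed.

(** The flow is symmetric under reflection in the x1-axis, so the lower cap reduces to the upper
    one. *)
Lemma drift_bracket (kap h0 h sg : R) (y : R * R) : sg = 1 \/ sg = -1 -> 0 < kap -> 0 < h -> h <= h0 ->
  5 * kap + 16 * h0 ^+ 2 <= 2 * (1 - b) -> enorm2 y ^+ 2 <= (kap * h) ^+ 2 ->
  0 <= v1 (y.1, sg * h + y.2) * y.1 + v2 (y.1, sg * h + y.2) * y.2 + speed h * sg * y.2 +
    speed h / h * enorm2 y ^+ 2.
Proof.
rewrite enorm2_sq => -[]-> k0 h_gt0 hh0 H Hy.
  by have := bracket k0 h_gt0 hh0 H Hy; rewrite mul1r mulr1.
have := @bracket kap h0 h y.1 (- y.2) k0 h_gt0 hh0 H; rewrite sqrrN => /(_ Hy).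
rewrite !dv1E// !dv2E//=.
have -> : (-1 * h + y.2) ^+ 2 = (h - y.2) ^+ 2 by ring.
by set F1 := F _; set G1 := dprof _ _ _ _; set W := speed h / h; set W' := speed h; lra.
Qed.

End Bracket.

(** * Time needed to reach height eps *)

Section TravelTime.
Variable R : realType.

Lemma exists_antiderivative (f : R -> R) (a c : R) : a < c ->
  (forall x, a <= x <= c -> {for x, continuous f}) ->
  exists P : R -> R, forall x : R, a < x < c -> is_derive x 1 P (f x).
Proof.
move=> ac cf.
have I : (@lebesgue_measure R).-integrable `[a, c] (EFin \o f).
  apply: continuous_compact_integrable; first exact: segment_compact.
  apply: continuous_in_subspaceT => x; rewrite inE/= in_itv/= => H; exact: cf.
exists (fun x => \int[lebesgue_measure]_(t in `[a, x]) f t)%R => x /andP[ax xc].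
have cx : {for x, continuous f} by apply: cf; rewrite !ltW.
have [D E] := continuous_FTC1_closed xc I ax cx.
by rewrite -E derive1E; exact: DeriveDef.
Qed.

Variables (lam b eps h0 : R).
Hypotheses (lam0 : 0 < lam) (b_ge : 1 / 2 <= b) (b_lt : b < 1) (eps0 : 0 < eps) (eps_h0 : eps < h0) (h0_le1 : h0 <= 1).
Local Notation w := (speed lam b (eps ^+ 2)).

Lemma speed_gt0 h : 0 < h -> 0 < w h.
Proof. by move=> h_gt0; rewrite mulr_gt0// prof_gt0// ?exprn_gt0// sqr_ge0. Qed.

(** For eps <= h <= 1 the regularisation costs a factor of at most 2, from (2 h^2)^(-b), and the
    cutoff (1 + h^2)^(-2) a factor of at most 4; hence the 8. *)
Lemma speed_ge h : eps <= h -> h <= 1 -> lam / 8 * h `^ (1 - 2 * b) <= w h.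
Proof.
move=> eh h1; have h_gt0 : 0 < h := lt_le_trans eps0 eh.
have hs0 : 0 < h ^+ 2 by rewrite exprn_gt0.
have es : eps ^+ 2 <= h ^+ 2 by rewrite lerXn2r// nnegrE ltW.
have es0 : 0 < eps ^+ 2 by rewrite exprn_gt0.
have h2 : h ^+ 2 <= 1 by rewrite exprn_ile1// ltW.
have A : 2^-1 * h `^ (- (2 * b)) <= (h ^+ 2 + eps ^+ 2) `^ (- b).
  apply: (@le_trans _ _ ((2 * h ^+ 2) `^ (- b))); last first.
    by apply: powR_le_neg; [move: hs0 es0; lra|move: es; lra|move: b_ge; lra].
  rewrite powRM// ?(ltW hs0)//; apply: ler_pM; rewrite ?powR_ge0 ?invr_ge0//.
    rewrite -(@powR_inv1 _ 2)// ler_powR ?ler1n//; move: b_lt; lra.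
  by rewrite -powR_mulrn ?(ltW h_gt0)// -powRrM mulrN.
have B : 4^-1 <= (h ^+ 2 + 1) `^ (- 2).
  have -> : (4^-1 : R) = 2 `^ (- 2).
    by rewrite powRN powR_mulrn// -natrX.
  by apply: powR_le_neg; move: hs0 h2; lra.
have -> : h `^ (1 - 2 * b) = h * h `^ (- (2 * b)) by rewrite powRD ?(gt_eqF h_gt0) ?implybT// powRr1// ltW.
have -> : lam / 8 * (h * h `^ (- (2 * b))) = h * (lam * (2^-1 * h `^ (- (2 * b)) * 4^-1)) by field.
rewrite /speed /prof ler_pM2l// ler_pM2l//; apply: ler_pM => //; rewrite ?mulr_ge0 ?invr_ge0 ?powR_ge0//.
Qed.

Lemma continuous_speed h : 0 < h -> {for h, continuous (fun h => (w h)^-1)}.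
Proof.
move=> h_gt0; have es0 : 0 < eps ^+ 2 by rewrite exprn_gt0.
have D : is_derive (h ^+ 2) 1 (prof lam b (eps ^+ 2)) (- dprof lam b (eps ^+ 2) (h ^+ 2)).
  by apply: is_derive_prof => //; exact: sqr_ge0.
have D2 : is_derive h 1 (fun h : R => h ^+ 2) (2 * h).
  by apply: is_derive_eq; rewrite /GRing.scale/=; ring.
have D3 : is_derive h 1 (fun h : R => prof lam b (eps ^+ 2) (h ^+ 2)) (- dprof lam b (eps ^+ 2) (h ^+ 2) * (2 * h)).
  exact: (@is_derive1_comp R (prof lam b (eps ^+ 2)) (fun h => h ^+ 2) h _ _ D D2).
have wn : w h != 0 by rewrite gt_eqF// speed_gt0.
have D4 : is_derive h 1 w (h * (- dprof lam b (eps ^+ 2) (h ^+ 2) * (2 * h)) + prof lam b (eps ^+ 2) (h ^+ 2)).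
  rewrite /speed; apply: is_derive_eq.
  by rewrite /GRing.scale/= mulr1.
exact: (is_derive_continuous (is_deriveV wn D4)).
Qed.

(** Since 1 - 2b <= 0, the speed is at least lam / 8 at all heights from eps to h0, and the distance
    is at most 1, so the time bound does not involve eps. *)
Lemma travel_time : exists tau : R -> R,
  [/\ (forall h : R, eps <= h <= h0 -> is_derive h 1 tau (- (w h)^-1)),
      (forall h, eps <= h -> h < h0 -> 0 < tau h), tau h0 = 0 & tau eps <= 8 / lam].
Proof.
(* The larger interval makes the antiderivative differentiable from both sides at eps and at h0. *)
have [||P HP] := @exists_antiderivative (fun h => (w h)^-1) (eps / 2) (h0 + 1).
- by move: eps0 eps_h0; lra.
- by move=> x /andP[x1 _]; apply: continuous_speed; move: eps0; lra.
have HP' (x : R) : eps <= x <= h0 -> is_derive x 1 P (w x)^-1.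
  by move=> /andP[x1 x2]; apply: HP; apply/andP; split; move: eps0; lra.
have mvt (h : R) : eps <= h -> h < h0 -> exists2 c, eps <= c <= h0 & P h0 - P h = (w c)^-1 * (h0 - h).
  move=> e_h hh.
  have Din c : c \in `]h, h0[ -> is_derive c 1 P (w c)^-1.
    by rewrite in_itv/= => /andP[? ?]; apply: HP'; apply/andP; split; lra.
  have C : {within `[h, h0], continuous P}.
    apply: derivable_within_continuous => x; rewrite in_itv/= => /andP[x1 x2].
    have xx : eps <= x <= h0 by apply/andP; split; lra.
    by have [] := HP' x xx.
  have [c] := MVT_segment (ltW hh) Din C; rewrite in_itv/= => /andP[c1 c2] E.
  by exists c => //; apply/andP; split; lra.
exists (fun h => P h0 - P h); split.
- move=> h H; have D := HP' h H.
  by have := is_deriveB (is_derive_cst (P h0) h (1 : R)) D; rewrite sub0r.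
- move=> h e_h hh; have [c /andP[c1 _] ->] := mvt h e_h hh.
  by rewrite mulr_gt0 ?subr_gt0// invr_gt0 speed_gt0//; apply: lt_le_trans eps0 c1.
- by rewrite subrr.
have [c /andP[c1 c2] ->] := mvt eps (lexx _) eps_h0.
have c0 : 0 < c := lt_le_trans eps0 c1.
have wc : lam / 8 <= w c.
  apply: le_trans (speed_ge c1 (le_trans c2 h0_le1)).
  rewrite ler_peMr ?divr_ge0 ?(ltW lam0)//.
  have -> : 1 - 2 * b = - (2 * b - 1) by ring.
  apply: (@le_trans _ _ (1 `^ (- (2 * b - 1)))); first by rewrite powR1.
  by apply: powR_le_neg => //; move: c2 h0_le1 b_ge; lra.
apply: (@le_trans _ _ ((w c)^-1 * 1)).
  by rewrite ler_wpM2l ?invr_ge0 ?(ltW (speed_gt0 c0))//; move: eps0 h0_le1; lra.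
rewrite mulr1 -[leRHS]invrK invf_div lef_pV2 ?posrE ?speed_gt0// divr_gt0//.
Qed.

End TravelTime.

(** * The L^p bound for the drift, uniform in eps *)

Section DriftNorm.
Variable R : realType.
Local Notation mR := (measurableTypeR R).
Variables (lam a eps p : R).
Hypotheses (lam0 : 0 < lam) (a01 : 0 < a < 1) (eps0 : 0 < eps) (eps1 : eps <= 1) (p1 : 1 <= p) (ap : a * p < 2).
Local Notation b := ((a + 1) / 2).
Local Notation d := (eps ^+ 2).
Local Notation F := (prof lam b d).
Local Notation v1 := (dv1 lam b d).
Local Notation v2 := (dv2 lam b d).

Let a0 : 0 < a. Proof. by case/andP: a01. Qed.
Let a1 : a < 1. Proof. by case/andP: a01. Qed.
Let d0 : 0 < d. Proof. by rewrite exprn_gt0. Qed.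
Let b0 : 0 < b. Proof. by move: a0; lra. Qed.

Lemma drift_le x : enorm2 (v1 x, v2 x) <= 5 * lam * (qd d x `^ (- (a / 2)) * qd 1 x `^ (- 2)).
Proof.
set r := x.1 ^+ 2 + x.2 ^+ 2; have r0 : 0 <= r by rewrite addr_ge0// sqr_ge0.
have q0 := qd_gt0 x d0; have q10 := qd_gt0 x (@ltr01 R).
have f0 : 0 < F r by apply: prof_gt0.
pose B := b / (r + d) + 2 / (r + 1).
(* As b <= 1, z B <= 1 + 2, so 1 - 2 z B lies between - 5 and 1; this is the 5 in the bound. *)
have bnd z : 0 <= z -> z <= r -> `|1 - 2 * z * B| <= 5.
  move=> z0 zr; have B0 : 0 <= B by rewrite addr_ge0// divr_ge0 ?(ltW b0)// ltW.
  have : z * B <= 3.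
    apply: (@le_trans _ _ (r * B)); first by rewrite ler_wpM2r.
    have : r * (b / (r + d)) <= 1.
      rewrite mulrA ler_pdivrMr// mul1r; apply: (@le_trans _ _ r); last by rewrite lerDl ltW.
      by rewrite ler_piMr//; move: a1; lra.
    have : r * (2 / (r + 1)) <= 2 by rewrite mulrA ler_pdivrMr//; move: r0; lra.
    by rewrite /B mulrDr; lra.
  have := mulr_ge0 z0 B0; rewrite ler_norml -mulrA => ? ?; apply/andP; split; lra.
have e (c z : R) : 0 <= z -> z <= r -> (c * (F r - 2 * z * (F r * B))) ^+ 2 <= c ^+ 2 * (5 * F r) ^+ 2.
  move=> z0 zr; have -> : c * (F r - 2 * z * (F r * B)) = c * ((1 - 2 * z * B) * F r) by ring.
  have hb := bnd z z0 zr; rewrite exprMn ler_wpM2l ?sqr_ge0//; move: hb; move: (F r) (1 - 2 * z * B) => f k hk.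
  by rewrite !exprMn ler_wpM2r ?sqr_ge0// -real_normK ?num_real// lerXn2r// nnegrE.
have -> : 5 * lam * (qd d x `^ (- (a / 2)) * qd 1 x `^ (- 2)) = qd d x `^ (1 / 2) * (5 * F r).
  rewrite /prof -/(qd d x) -/(qd 1 x).
  have -> : - (a / 2) = 1 / 2 + - b by field.
  by rewrite powRD ?(gt_eqF q0) ?implybT//; ring.
have qs := qd_sqrt x d0.
rewrite -(@ler_pXn2r _ 2)// ?nnegrE ?enorm2_ge0// ?mulr_ge0 ?powR_ge0 ?(ltW f0)//; last exact: ltW.
rewrite enorm2_sq /= dv1E// dv2E// mulNr sqrrN /dprof -/r -/B [leRHS]exprMn qs.
apply: (@le_trans _ _ (r * (5 * F r) ^+ 2)).
  have r1 : x.1 ^+ 2 <= r by rewrite lerDl sqr_ge0.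
  have r2 : x.2 ^+ 2 <= r by rewrite lerDr sqr_ge0.
  have h1 := e x.1 _ (sqr_ge0 _) r2; have h2 := e x.2 _ (sqr_ge0 _) r1.
  by rewrite [leRHS]mulrDl lerD.
by rewrite ler_wpM2r ?sqr_ge0// /qd lerDl ltW.
Qed.

(** The singularity |x|^(-a p) is shared equally by the two coordinates; a p < 2 makes each exponent
    less than 1, hence integrable at 0. *)
Let al := a * p / 2.
Let al01 : 0 <= al < 1.
Proof. by rewrite /al divr_ge0 ?mulr_ge0 ?(ltW a0)//=; move: p1 ap; lra. Qed.

Definition Kdrift : R := 2 `^ (2 * al) * 3 `^ (2 * (2 - al)) * (2 * (1 / (1 - al))) ^+ 2.

Lemma drift_pow_le x : enorm2 (v1 x, v2 x) `^ p <=
  (5 * lam) `^ p * (2 `^ (2 * al) * 3 `^ (2 * (2 - al))) *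
   (nearfun al 1 (`|x.1| + eps) * nearfun al 1 (`|x.2| + eps)).
Proof.
have /andP[al0 al1] := al01.
have q0 := qd_gt0 x d0; have q10 := qd_gt0 x (@ltr01 R).
have p0 : 0 <= p by move: p1; lra.
apply: (@le_trans _ _ ((5 * lam * (qd d x `^ (- (a / 2)) * qd 1 x `^ (- 2))) `^ p)).
  apply: ge0_ler_powR => //; rewrite ?nnegrE ?enorm2_ge0 ?drift_le//.
  by rewrite mulr_ge0 ?mulr_ge0 ?powR_ge0 ?(ltW lam0).
have -> : (5 * lam * (qd d x `^ (- (a / 2)) * qd 1 x `^ (- 2))) `^ p =
    (5 * lam) `^ p * (qd d x `^ (- (a / 2) * p) * qd 1 x `^ (- 2 * p)).
  by rewrite (powRM p (x := 5 * lam)) ?powRM ?powR_ge0 ?mulr_ge0 ?powR_ge0 ?(ltW lam0)// -!powRrM.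
set y := qd d x `^ (1 / 2).
have y0 : 0 < y by rewrite powR_gt0.
have ys : y ^+ 2 = qd d x := qd_sqrt x d0.
have ey : eps <= y.
  by rewrite -(@ler_pXn2r _ 2)// ?nnegrE ?powR_ge0 ?(ltW eps0)// ys /qd lerDr addr_ge0// sqr_ge0.
have y1 : `|x.1| <= y := norm_le_qd1 x d0.
have y2 : `|x.2| <= y := norm_le_qd2 x d0.
set w := 2 * y; have w0 : 0 < w by rewrite mulr_gt0.
have N (z : R) : `|z| <= y -> w `^ (- al) * (1 + w / 1) `^ (- (2 - al)) <= nearfun al 1 (`|z| + eps).
  move=> zy; apply: nearfun_ge => //; first by rewrite ltr_wpDl.
  by rewrite /w; lra.
rewrite divr1 in N.
have NN := ler_pM (mulr_ge0 (powR_ge0 _ _) (powR_ge0 _ _)) (mulr_ge0 (powR_ge0 _ _) (powR_ge0 _ _)) (N _ y1) (N _ y2).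
have E1 : qd d x `^ (- (a / 2) * p) = 2 `^ (2 * al) * (w `^ (- al) * w `^ (- al)).
  rewrite -ys -powR_mulrn ?(ltW y0)// -powRrM -powRD ?(gt_eqF w0) ?implybT// /w powRM// ?(ltW y0)//.
  rewrite mulrA -powRD ?pnatr_eq0 ?implybT//.
  have -> : 2 * al + (- al + - al) = 0 by ring.
  by rewrite powRr0 mul1r; congr (_ `^ _); rewrite /al; field.
set z := 1 + w in N NN; have z0 : 0 < z by rewrite /z; move: w0; lra.
(* The majorant decays like the power - 2 (2 - al), and 2 (2 - al) <= 4 <= 4 p, so the factor (1 +
   |x|^2)^(-2) of the profile decays fast enough. *)
have E2 : qd 1 x `^ (- 2 * p) <= 3 `^ (2 * (2 - al)) * (z `^ (- (2 - al)) * z `^ (- (2 - al))).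
  have q11 : 1 <= qd 1 x by rewrite /qd lerDr addr_ge0// sqr_ge0.
  set t := qd 1 x `^ (1 / 2).
  have ts : t ^+ 2 = qd 1 x := qd_sqrt x ltr01.
  have t1 : 1 <= t by rewrite -(@ler_pXn2r _ 2)// ?nnegrE ?powR_ge0// ts expr1n.
  have yt : y <= t.
    rewrite -(@ler_pXn2r _ 2)// ?nnegrE ?powR_ge0// ts ys lerD2l exprn_ile1// ltW//.
  have zt : z <= 3 * t by rewrite /z /w; lra.
  rewrite -powRD ?(gt_eqF z0) ?implybT//.
  have -> : - (2 - al) + - (2 - al) = - (2 * (2 - al)) by ring.
  apply: (@le_trans _ _ (3 `^ (2 * (2 - al)) * (3 * t) `^ (- (2 * (2 - al))))); last first.
    by rewrite ler_wpM2l ?powR_ge0//; apply: powR_le_neg => //; move: al1; lra.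
  rewrite powRM//; last by lra.
  rewrite mulrA (powRN 3) mulfV ?mul1r; last by rewrite gt_eqF// powR_gt0.
  have -> : qd 1 x `^ (- 2 * p) = t `^ (- (4 * p)) by rewrite /t -powRrM; congr (_ `^ _); field.
  apply: ler_powR => //.
  by move: p1 al0 al1; lra.
rewrite E1 -[leRHS]mulrA ler_wpM2l ?powR_ge0//.
set W := w `^ _ in NN *; set Z := z `^ _ in NN E2.
have W0 : 0 <= W by exact: powR_ge0.
apply: (@le_trans _ _ (2 `^ (2 * al) * (W * W) * (3 `^ (2 * (2 - al)) * (Z * Z)))).
  by rewrite ler_wpM2l// mulr_ge0 ?powR_ge0// mulr_ge0.
have -> : 2 `^ (2 * al) * (W * W) * (3 `^ (2 * (2 - al)) * (Z * Z)) =
  2 `^ (2 * al) * 3 `^ (2 * (2 - al)) * (W * Z * (W * Z)) by ring.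
by rewrite ler_wpM2l// mulr_ge0 ?powR_ge0.
Qed.

Lemma Lp_drift_le1 : (5 * lam) `^ p * Kdrift <= 1 -> (Lp_norm_vf p (fun x => (v1 x, v2 x)) <= 1)%E.
Proof.
move=> H; have p0 : 0 < p by move: p1; lra.
rewrite /Lp_norm_vf unlock /=.
rewrite -(poweR1r p^-1); apply: gt0_ler_poweR.
- by rewrite invr_ge0 ltW.
- by rewrite in_itv/= leey andbT integral_ge0// => x _; exact: poweR_ge0.
- by rewrite in_itv/= leey andbT lee01.
under eq_integral => x _ do rewrite ger0_norm ?enorm2_ge0//.
have al0 : 0 <= al by case/andP: al01.
set c := (5 * lam) `^ p * (2 `^ (2 * al) * 3 `^ (2 * (2 - al))).
have c0 : 0 <= c by rewrite !mulr_ge0 ?powR_ge0.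
have I := near_integral2 al01 eps0 ltr01 c0.
apply: le_trans (le_trans _ I) _; last first.
  by rewrite lee_fin powR1 -mulrA; apply: le_trans H; rewrite /Kdrift /c !mulrA.
have mf := measurable_nearfun al 1 eps.
have cE : continuous (fun x => enorm2 (v1 x, v2 x)).
  move=> x; have [M1 b1] := Cb_dv1 lam b0 d0 1%N; have [M2 b2] := Cb_dv2 lam b0 d0 1%N.
  have c1 := bnd_cont b1 (x := x); have c2 := bnd_cont b2 (x := x).
  by apply: (continuous_comp (f := fun x => (v1 x, v2 x))); [exact: (cvg_pair c1 c2)|exact: continuous_enorm2].
apply: ge0_le_integral => //.
- by move=> x _; rewrite lee_fin powR_ge0.
- by apply/measurable_EFinP; apply: measurable_powR_comp; exact: continuous_measurable2.
- apply/measurable_EFinP; apply: measurable_funM => //; apply: measurable_funM.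
    exact: (measurableT_comp mf measurable_fst).
  exact: (measurableT_comp mf measurable_snd).
by move=> x _; rewrite lee_fin; exact: drift_pow_le.
Qed.

End DriftNorm.

(** * The initial datum and the separation of values *)

Section InitialDatum.
Variable R : realType.
Local Notation e2 := (@e2 R).

Lemma C2norm_le1 (f : R * R -> R) (M : R) : bnd 2 f M -> 6 * M <= 1 -> (C2norm f <= 1)%E.
Proof.
move=> bf M6; have S (g : R * R -> R) : (forall x, `|g x| <= M) -> (supnorm g <= M%:E)%E.
  by move=> H; apply: ge_ereal_sup => _ [x _ <-]; rewrite lee_fin.
apply: (@le_trans _ _ (M + M + M + M + M + M)%:E); last by rewrite lee_fin; lra.
have b1 i := bnd_pd i bf; have b0 i j := bnd_pd j (b1 i).
rewrite /C2norm !EFinD; do !apply: leeD; apply: S; rewrite /dx1 /dx2.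
- exact: bnd_abs bf.
- exact: bnd_abs (b1 _).
- exact: bnd_abs (b1 _).
- exact: bnd_abs (b0 _ _).
- exact: bnd_abs (b0 _ _).
- exact: bnd_abs (b0 _ _).
Qed.

(* Odd in x2, with maximum m at (0, h0) and minimum -m at (0, -h0). *)
Definition datum (m h0 : R) (x : R * R) : R := m * (2 * h0 * mono 0 1 (h0 ^+ 2) 1 x).

Variables (h0 : R) (h0_gt0 : 0 < h0).

Let hs : 0 < h0 ^+ 2. Proof. by rewrite exprn_gt0. Qed.

Lemma Cb_datum m : Cb (datum m h0).
Proof. by apply: CbZ; apply: CbZ; apply: Cb_mono => //; rewrite add0n mulr1 ler1n. Qed.

Lemma datumE m x : datum m h0 x = m * (2 * h0 * x.2 / (x.1 ^+ 2 + x.2 ^+ 2 + h0 ^+ 2)).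
Proof.
rewrite /datum /mono expr0 expr1 mul1r -/(qd _ x) powR_inv1 ?(ltW (qd_gt0 x hs))//.
by rewrite !mulrA.
Qed.

Lemma datum_C2 : exists2 m, 0 < m & (C2norm (datum m h0) <= 1)%E.
Proof.
have [M bM] := Cb_datum 1 2; have M0 := bnd_ge0 bM.
have m0 : 0 < (6 * M + 1)^-1 by rewrite invr_gt0; lra.
exists (6 * M + 1)^-1 => //.
have := bndZ (6 * M + 1)^-1 bM.
have -> : (fun x => (6 * M + 1)^-1 * datum 1 h0 x) = datum (6 * M + 1)^-1 h0.
  by apply/funext => x; rewrite /datum mul1r.
rewrite gtr0_norm// => /C2norm_le1; apply.
by rewrite mulrCA mulrC ler_pdivrMr ?mul1r; lra.
Qed.

(** Completing the square in the numerator; its sign yields |datum| <= m, its size the closeness to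
    the extreme value on the cap. *)
Lemma datum_dist m sg x : sg = 1 \/ sg = -1 ->
  m - sg * datum m h0 x = m * (enorm2 (x.1, x.2 - sg * h0) ^+ 2 / (x.1 ^+ 2 + x.2 ^+ 2 + h0 ^+ 2)).
Proof.
move=> Hs; have q0 := qd_gt0 x hs; rewrite /qd in q0.
have s2 : sg * sg = 1 by case: Hs => ->; ring.
rewrite datumE enorm2_sq /=.
have -> : (x.2 - sg * h0) ^+ 2 = x.2 ^+ 2 - 2 * sg * h0 * x.2 + h0 ^+ 2 * (sg * sg) by ring.
by rewrite s2; field; rewrite gt_eqF.
Qed.

Lemma datum_abs m x : 0 <= m -> `|datum m h0 x| <= m.
Proof.
move=> m0; have q0 := qd_gt0 x hs; rewrite /qd in q0.
have P sg : 0 <= m * (enorm2 (x.1, x.2 - sg * h0) ^+ 2 / (x.1 ^+ 2 + x.2 ^+ 2 + h0 ^+ 2)).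
  by rewrite mulr_ge0// divr_ge0 ?sqr_ge0// ltW.
have := P 1; rewrite -datum_dist; last by left.
have := P (-1); rewrite -datum_dist; last by right.
by rewrite ler_norml => ? ?; apply/andP; split; lra.
Qed.

Lemma datum_ge m sg kap x : 0 <= m -> sg = 1 \/ sg = -1 -> 0 <= kap -> kap <= 1 / 2 ->
  enorm2 (x.1, x.2 - sg * h0) ^+ 2 <= (kap * h0) ^+ 2 -> 3 / 4 * m <= sg * datum m h0 x.
Proof.
move=> m0 Hs k0 k1 H; have q0 := qd_gt0 x hs; rewrite /qd in q0.
have E := datum_dist m x Hs.
suff : m * (enorm2 (x.1, x.2 - sg * h0) ^+ 2 / (x.1 ^+ 2 + x.2 ^+ 2 + h0 ^+ 2)) <= m * (1 / 4).
  by rewrite -E; lra.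
rewrite ler_wpM2l// ler_pdivrMr//; apply: le_trans H _.
have : kap ^+ 2 <= 1 / 4.
  by have := ler_pM k0 k0 k1 k1; rewrite expr2; lra.
move=> /(ler_wpM2r (ltW hs)); rewrite exprMn => h; apply: le_trans h _.
by rewrite ler_wpM2l// lerDr addr_ge0// sqr_ge0.
Qed.

End InitialDatum.

(** * Both caps reach the origin with most of their amplitude *)

Section Separation.
Variable R : realType.
Variables (s lam a eps h0 m : R).
Hypotheses (s_ge : 1 / 2 <= s) (s_lt : s < 1) (a_gt : 2 * s - 1 < a) (a_lt : a < 1).
Hypotheses (lam0 : 0 < lam) (eps0 : 0 < eps) (eps_h0 : eps < h0) (h0_le : h0 <= 1) (m0 : 0 < m).
Local Notation b := ((a + 1) / 2).
(** Half of the slack 2 (1 - b) goes to the cap radius, 5 kap = 1 - b; the other half is left for 16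
    h0^2. *)
Local Notation kap := ((1 - b) / 5).
Local Notation be := (a + 1 - 2 * s).
Local Notation d := (eps ^+ 2).

(* The amplitude at height h is 7/8 - Cbarrier (h0^be - h^be): its growth rate beats the fractional loss. *)
Definition Cbarrier : R := (4 * KL s * kap `^ (- (2 * s)) + 1) / (be * lam).

Hypothesis h0_small : 16 * h0 ^+ 2 <= 1 - b.
Hypothesis h0_small' : Cbarrier * h0 `^ be <= 1 / 8.

Let w := speed lam b d.
(** The value 7/8 at h0 makes the top of the initial cap - m + 2 m (7/8) = 3 m / 4, the lower bound
    of [datum_ge]. *)
Let prof_a (h : R) : R := 7 / 8 - Cbarrier * (h0 `^ be - h `^ be).
Let dprof_a (h : R) : R := Cbarrier * be * h `^ (be - 1).

Let h0_gt0 : 0 < h0. Proof. exact: lt_trans eps_h0. Qed.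
Let a0 : 0 < a. Proof. by move: s_ge a_gt; lra. Qed.
Let b0 : 0 < b. Proof. by move: a0; lra. Qed.
Let b1 : b < 1. Proof. by move: a_lt; lra. Qed.
Let d0 : 0 < d. Proof. by rewrite exprn_gt0. Qed.
Let kap0 : 0 < kap. Proof. by move: b1; lra. Qed.
Let be0 : 0 < be. Proof. by move: a_gt; lra. Qed.
Let s01 : 0 < s < 1. Proof. by rewrite s_lt andbT; move: s_ge; lra. Qed.

Lemma Cbarrier_ge0 : 0 <= Cbarrier.
Proof.
rewrite divr_ge0 ?mulr_ge0 ?(ltW be0) ?(ltW lam0)// addr_ge0// mulr_ge0 ?powR_ge0// mulr_ge0//.
exact: KL_ge0.
Qed.

Let h_pos h : eps <= h <= h0 -> 0 < h.
Proof. by case/andP => h1 _; exact: lt_le_trans eps0 h1. Qed.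

Let a'_gt h : eps <= h <= h0 -> KL s * (kap * h) `^ (- (2 * s)) < 2 * dprof_a h * w h.
Proof.
move=> H; have hp := h_pos H; have /andP[H1 H2] := H.
have W := speed_ge lam0 (_ : 1 / 2 <= b) b1 eps0 H1 (le_trans H2 h0_le).
have {}W : lam / 8 * h `^ (1 - 2 * b) <= w h by apply: W; move: a0; lra.
have C0 := Cbarrier_ge0.
have A0 : 0 <= 2 * dprof_a h.
  by apply: mulr_ge0 => //; apply: mulr_ge0; [apply: mulr_ge0 => //; exact: ltW|exact: powR_ge0].
apply: lt_le_trans (ler_wpM2l A0 W).
(* The exponent be - 1 of the amplitude rate was chosen so that, times h^(1 - 2b), it gives h^(-2s),
   the scaling of the fractional loss. The + 1 in [Cbarrier] makes the comparison strict. *)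
have -> : 2 * dprof_a h * (lam / 8 * h `^ (1 - 2 * b)) =
    (Cbarrier * (be * lam)) / 4 * (h `^ (be - 1) * h `^ (1 - 2 * b)) by rewrite /dprof_a; field.
rewrite -powRD ?(gt_eqF hp) ?implybT//.
have -> : be - 1 + (1 - 2 * b) = - (2 * s) by field.
rewrite /Cbarrier divfK; last by rewrite mulf_neq0 ?gt_eqF.
rewrite powRM ?(ltW kap0) ?(ltW hp)// mulrA ltr_pM2r ?powR_gt0//.
by lra.
Qed.

Let da (h : R) : eps <= h <= h0 -> is_derive h 1 prof_a (dprof_a h).
Proof.
move=> H; have hp := h_pos H; have D := is_derive1_powR be hp.
rewrite /prof_a; apply: is_derive_eq; rewrite /dprof_a /GRing.scale/=; ring.
Qed.

Let a_le1 h : eps <= h <= h0 -> prof_a h <= 1.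
Proof.
move=> H; have hp := h_pos H; have /andP[_ H2] := H.
have : 0 <= Cbarrier * (h0 `^ be - h `^ be).
  rewrite mulr_ge0 ?Cbarrier_ge0// subr_ge0; apply: ge0_ler_powR => //; rewrite ?nnegrE ltW//.
by rewrite /prof_a; lra.
Qed.

Lemma drift_separates : exists2 t, 0 < t <= 8 / lam & forall theta,
  is_smooth_solution s (fun x => (dv1 lam b d x, dv2 lam b d x)) (datum m h0) theta ->
  m <= theta t (0, eps) - theta t (0, - eps).
Proof.
have b_ge : 1 / 2 <= b by move: a0; lra.
have [tau [dtau tau_gt0 tau_h0 tau_le]] := travel_time lam0 b_ge b1 eps0 eps_h0 h0_le.
have He : eps <= eps <= h0 by rewrite lexx ltW.
exists (tau eps); first by rewrite tau_le tau_gt0.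
move=> theta Hth; have Hw := smooth_solution_wsol Hth.
have [_ [_ [th0 _]]] := Hth.
have [V1 /bnd_abs B1] := Cb_dv1 lam b0 d0 0%N; have [V2 /bnd_abs B2] := Cb_dv2 lam b0 d0 0%N.
have Hm t x : 0 <= t -> `|theta t x| <= m.
  apply: (wsol_abs_le (V := Num.max V1 V2) s_ge s_lt Hw).
  - by move=> z; rewrite le_max B1.
  - by move=> z; rewrite le_max B2 orbT.
  - by move=> z; rewrite th0; apply: datum_abs => //; exact: ltW.
have w_gt0 h : eps <= h <= h0 -> 0 < w h by move=> H; apply: speed_gt0 => //; exact: h_pos H.
have drift sg h y (Hsg : sg = 1 \/ sg = -1) : eps <= h <= h0 -> enorm2 y ^+ 2 <= (kap * h) ^+ 2 ->
  0 <= dv1 lam b d (y.1, sg * h + y.2) * y.1 + dv2 lam b d (y.1, sg * h + y.2) * y.2 + w h * sg * y.2 +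
    w h / h * enorm2 y ^+ 2.
  move=> H Hy; have hp := h_pos H; have /andP[_ H2] := H.
  apply: (drift_bracket lam0 b0 d0 Hsg kap0 hp H2 _ Hy).
  by move: h0_small b1; lra.
have init sg x (Hsg : sg = 1 \/ sg = -1) : enorm2 (x.1, x.2 - sg * h0) ^+ 2 <= (kap * h0) ^+ 2 ->
  - m + 2 * m * (prof_a h0 - enorm2 (x.1, x.2 - sg * h0) ^+ 2 / (kap * h0) ^+ 2) <= sg * datum m h0 x.
  move=> H; have k2 : kap <= 1 / 2 by move: b0; lra.
  apply: le_trans (datum_ge h0_gt0 (ltW m0) Hsg (ltW kap0) k2 H).
  rewrite /prof_a subrr mulr0 subr0.
  have : 0 <= 2 * m * (enorm2 (x.1, x.2 - sg * h0) ^+ 2 / (kap * h0) ^+ 2).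
    by rewrite mulr_ge0 ?divr_ge0 ?sqr_ge0// mulr_ge0// ltW.
  by rewrite mulrBr; lra.
have l1 : (1 : R) = 1 \/ (1 : R) = -1 by left.
have l2 : (-1 : R) = 1 \/ (-1 : R) = -1 by right.
have P1 : - m + 2 * m * prof_a eps <= theta (tau eps) (0, 1 * eps).
  apply: (barrier s_ge s_lt Hw m0 Hm kap0 eps0 w_gt0 dtau tau_gt0 tau_h0 da a_le1 a'_gt) => //.
  - by move=> h y; exact: drift.
  - by move=> x Hx; rewrite th0 -[leRHS]mul1r; exact: init.
have P2 : - m + 2 * m * prof_a eps <= - theta (tau eps) (0, -1 * eps).
  (* The lower cap is the barrier with sg = -1 for - theta, which solves the same equation and has a
     positive peak at (0, - h0). *)
  apply: (barrier (th := fun t x => - theta t x) s_ge s_lt (wsolN Hw) m0 _ kap0 eps0 w_gt0 dtau tau_gt0 tau_h0 da a_le1 a'_gt) => //.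
  - by move=> t x t0; rewrite normrN; exact: Hm.
  - by move=> h y; exact: drift.
  - by move=> x Hx; rewrite th0 -[leRHS]mulN1r; exact: init.
(* The amplitude loses at most 1/8 on the way, so each value is at least m / 2 in absolute value,
   with opposite signs. *)
have P3 : 3 / 4 <= prof_a eps.
  have : 0 <= Cbarrier * eps `^ be by rewrite mulr_ge0 ?Cbarrier_ge0 ?powR_ge0.
  by rewrite /prof_a mulrBr; move: h0_small'; lra.
have P4 : 2 * m * (3 / 4) <= 2 * m * prof_a eps by rewrite ler_wpM2l ?mulr_ge0 ?(ltW m0).
rewrite mul1r in P1; rewrite mulN1r in P2; lra.
Qed.

End Separation.

(** * Choice of the scales *)

Section Scales.
Variable R : realType.

Lemma modulus_lt (rho : R -> R) (m c : R) : modulus rho -> 0 < m -> 0 < c ->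
  exists2 eps, 0 < eps < c & rho (2 * eps) < m.
Proof.
move=> [cr [_ [_ r0]]] m0 c0.
have := cr; move/subspace_continuousP => /(_ 0); rewrite /= in_itv/= lexx => /(_ isT).
move=> /cvgrPdist_lt /(_ m m0) => H.
have {}H : nbhs (0 : R) (fun x => x \in `[0, +oo[ -> `|rho 0 - rho x| < m) by exact: H.
have [e /= e0 He] := (@nbhs_ballP R R _ _).1 H.
pose eps := Num.min (e / 4) (c / 2).
have eps0 : 0 < eps by rewrite lt_min; apply/andP; split; lra.
have ee : eps <= e / 4 by rewrite ge_min lexx.
have ec : eps <= c / 2 by rewrite ge_min lexx orbT.
exists eps; first by rewrite eps0; lra.
have := He (2 * eps); rewrite /ball/= sub0r normrN gtr0_norm ?mulr_gt0// => /(_ _)/wrap[|].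
  by lra.
rewrite in_itv/= andbT mulr_ge0 ?ltW// => /(_ isT).
by rewrite r0 sub0r normrN => /(le_lt_trans (ler_norm _)).
Qed.

Lemma small_scale (c C be : R) : 0 < c -> 0 <= C -> 0 < be ->
  exists2 h, 0 < h <= 1 & 16 * h ^+ 2 <= c /\ C * h `^ be <= 1 / 8.
Proof.
(* This D has C D <= 1/8 and stays positive and finite when C = 0. *)
move=> c0 C0 be0; pose D := (8 * C + 1)^-1.
have D0 : 0 < D by rewrite invr_gt0; lra.
pose h := Num.min (Num.min 1 (c / 16)) (D `^ be^-1).
have h0 : 0 < h by rewrite !lt_min ltr01 powR_gt0// andbT /=; lra.
have h1 : h <= 1 by rewrite !ge_min lexx.
have hc : h <= c / 16 by rewrite !ge_min lexx orbT.
have hD : h <= D `^ be^-1 by rewrite !ge_min lexx !orbT.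
exists h; first by rewrite h0.
split.
  have : h ^+ 2 <= h by rewrite expr2 ler_piMl// ltW.
  by lra.
have hb : h `^ be <= D.
  rewrite -[leRHS](powRr1 (ltW D0)) -(mulVf (lt0r_neq0 be0)) powRrM.
  by apply: ge0_ler_powR; rewrite ?nnegrE ?powR_ge0// ltW.
apply: (le_trans (ler_wpM2l C0 hb)); rewrite /D ler_pdivrMr; lra.
Qed.

End Scales.

Theorem theorem1p2 (R : realType) (s p : R) :
  1 / 2 <= s < 1 -> 1 <= p -> (s = 1 / 2 \/ p < 2 / (2 * s - 1)) ->
  exists T : R, 0 < T /\
  exists theta0 : R * R -> R,
    smooth2 theta0 /\ (C2norm theta0 <= 1)%E /\
    forall rho : R -> R, modulus rho ->
      exists u : R * R -> R * R,
        smooth_vf u /\ div_free u /\ (Lp_norm_vf p u <= 1)%E /\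
        (exists theta, is_smooth_solution s u theta0 theta) /\
        forall theta : R -> R * R -> R, is_smooth_solution s u theta0 theta ->
          exists t : R, 0 < t <= T /\ breaks rho theta t.
Proof.
move=> /andP[s_ge s_lt] p1 Hp; have p0 : 0 < p by lra.
(* The midpoint of the interval from 2s - 1 to min(1, 2/p), nonempty by the hypothesis on p. At s =
   1/2 the quotient 2 / (2s - 1) is 0 by convention, so a nonpositive denominator is handled
   apart. *)
have [a /andP[a_gt a_lt] ap] : exists2 a, 2 * s - 1 < a < 1 & a * p < 2.
  have Hm : 2 * s - 1 < Num.min 1 (2 / p).
    rewrite lt_min; apply/andP; split; first lra.
    rewrite ltr_pdivlMr//; case: Hp => [->|Hp]; first lra.
    have [s1|s1] := leP (2 * s - 1) 0; first by have := mulr_le0_ge0 s1 (ltW p0); lra.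
    by move: Hp; rewrite ltr_pdivlMr// mulrC.
  have [h1 h2] := midf_lt Hm.
  move: h2; rewrite lt_min => /andP[h2 h3].
  exists ((2 * s - 1 + Num.min 1 (2 / p)) / 2); first by rewrite h1 h2.
  by rewrite -ltr_pdivlMr.
have a0 : 0 < a by lra.
have a01 : 0 < a < 1 by rewrite a0.
have al1 : 0 < 1 - a * p / 2 by lra.
have K0 : 0 < Kdrift a p.
  apply: mulr_gt0; first by rewrite mulr_gt0 ?powR_gt0.
  by rewrite exprn_gt0// mulr_gt0// divr_gt0.
(* The value for which (5 lam)^p [Kdrift] = 1; it depends on a and p alone, hence so does the time 8
   / lam. *)
pose lam := (Kdrift a p) `^ (- p^-1) / 5.
have lam0 : 0 < lam by rewrite divr_gt0 ?powR_gt0.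
have HK : (5 * lam) `^ p * Kdrift a p <= 1.
  have -> : 5 * lam = Kdrift a p `^ (- p^-1) by rewrite /lam; field.
  rewrite -powRrM mulNr mulVf ?gt_eqF// powR_inv1 ?(ltW K0)//.
  by rewrite mulVf// gt_eqF.
have c0 : 0 < 1 - (a + 1) / 2 by lra.
have be0 : 0 < a + 1 - 2 * s by lra.
have [h0 /andP[h0_gt0 h0_le1] [h16 hC]] := small_scale c0 (Cbarrier_ge0 s_ge s_lt a_gt lam0) be0.
have [m m0 Hm] := datum_C2 h0_gt0.
exists (8 / lam); split; first by rewrite divr_gt0.
exists (datum m h0); split; first exact: Cb_smooth2 (Cb_datum h0_gt0 m).
split=> // rho Hrho.
(* Only here does the modulus enter: the two points end at distance 2 eps with values at least m
   apart. *)
have [eps /andP[eps0 eps_h0] Heps] := modulus_lt Hrho m0 h0_gt0.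
have d0 : 0 < eps ^+ 2 by rewrite exprn_gt0.
have b0 : 0 < (a + 1) / 2 by lra.
have C1 := Cb_dv1 lam b0 d0; have C2 := Cb_dv2 lam b0 d0.
exists (fun x => (dv1 lam ((a + 1) / 2) (eps ^+ 2) x, dv2 lam ((a + 1) / 2) (eps ^+ 2) x)).
split; first by split; exact: Cb_smooth2.
split; first exact: div_free_drift.
split; first by apply: Lp_drift_le1 => //; lra.
split; first exact: exists_smooth_solution (Cb_datum h0_gt0 m).
have [t t0 Ht] := drift_separates s_ge s_lt a_gt a_lt lam0 eps0 eps_h0 h0_le1 m0 h16 hC.
move=> theta Hth; exists t; split=> //.
exists (0, eps), (0, - eps).
have -> : enorm2 ((0, eps) - (0, - eps)) = 2 * eps.
  apply/eqP; rewrite -(@eqrXn2 _ 2)// ?enorm2_ge0 ?mulr_ge0 ?(ltW eps0)// enorm2_sq /=.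
  by apply/eqP; ring.
apply: lt_le_trans Heps _; apply: le_trans (Ht _ Hth) _; exact: ler_norm.
Qed.
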